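(* We have $$\frac{\varphi(e^{-35\pi})}{\varphi(e^{-\pi})} = \left(\frac{m(p)}{35(\sqrt{5} - 2)}\right)^{1/2},$$ where $$p = \frac{1}{4}\big(9 - 4\sqrt{5}\big)\sqrt{\sqrt{14} + \sqrt{10}}\,\left(7^{1/4}+\sqrt{4 + \sqrt{7}}\right)^{3/2}\left(\sqrt{43 + 15\sqrt{7} + (8 + 3\sqrt{7})\sqrt{10\sqrt{7}}} + \sqrt{35 + 15\sqrt{7} + (8 + 3\sqrt{7})\sqrt{10\sqrt{7}}}\right)$$ and $$m(p) := \left(1 + \frac{5p}{2} + \frac{1}{2}\sqrt{(2 + 5p)^2 - 4(1 - p)^3}\right)^{1/2}.$$
   Context: For $|q|<1$, Ramanujan's theta function is $\varphi(q) := \sum_{n=-\infty}^{\infty} q^{n^2}$. Fractional powers of positive real numbers are the positive real ones. *)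

(* Defs.v *)
From Stdlib Require Import Reals ZArith Lra Lia.
From Coquelicot Require Import Coquelicot.
Open Scope R_scope.

(* A two-sided series converges when both of its halves (n >= 0 and n < 0) do. *)
Definition ex_bilateral (a : Z -> R) : Prop :=
  ex_series (fun n : nat => a (Z.of_nat n)) /\
  ex_series (fun n : nat => a (- Z.of_nat (S n))%Z).

Definition bilateral (a : Z -> R) : R :=
  Series (fun n : nat => a (Z.of_nat n)) +
  Series (fun n : nat => a (- Z.of_nat (S n))%Z).

(* Meaningful for |q| < 1 only, see [ex_bilateral_phi]. *)
Definition phi (q : R) : R := bilateral (fun n : Z => powerRZ q (n ^ 2)).

Lemma ex_bilateral_phi (q : R) :
  Rabs q < 1 -> ex_bilateral (fun n : Z => powerRZ q (n ^ 2)).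
Proof.
intros Hq.
assert (Habs : 0 <= Rabs q) by apply Rabs_pos.
assert (Hgeom : ex_series (fun n : nat => Rabs q ^ n)).
{ apply ex_series_geom. now rewrite Rabs_Rabsolu. }
assert (Hle : forall n k : nat, (n <= k)%nat -> Rabs q ^ k <= Rabs q ^ n).
{ intros n k Hnk. replace k with (n + (k - n))%nat by lia.
  rewrite pow_add.
  assert (0 <= Rabs q ^ n) by now apply pow_le.
  assert (Rabs q ^ (k - n) <= 1).
  { rewrite <- (pow1 (k - n)). apply pow_incr. lra. }
  nra. }
split; refine (ex_series_le _ _ _ Hgeom); intro n;
  change (norm ?x) with (Rabs x).
- replace (Z.of_nat n ^ 2)%Z with (Z.of_nat (n * n)) by lia.
  rewrite <- pow_powerRZ, <- RPow_abs. apply Hle. nia.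
- replace ((- Z.of_nat (S n)) ^ 2)%Z with (Z.of_nat (S n * S n)) by lia.
  rewrite <- pow_powerRZ, <- RPow_abs. apply Hle. nia.
Qed.

(* [Rpower x y] is [exp (y * ln x)], the positive real power for x > 0. *)
Definition m (p : R) : R :=
  Rpower (1 + 5 * p / 2 + 1 / 2 * sqrt ((2 + 5 * p) ^ 2 - 4 * (1 - p) ^ 3))
    (1 / 2).

(* Main.v *)
Require Import Defs.
From Stdlib Require Import Reals ZArith Lra Lia List FinFun Classical.
From Coquelicot Require Import Coquelicot.
Open Scope R_scope.

(* By the inversion formula phi(e^(-pi/t)) = sqrt t phi(e^(-pi t)), it suffices
   to know m = phi(q)^2 / phi(q^n)^2 for n = 5 at q = e^(-pi), and for n = 7 at
   q = e^(-pi/35).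

   Degree 5: splitting Z[i] into cosets of (2 + i) Z[i] and the triple product
   give m = 1 + 2 G / G'^5 for the class invariants G, G' at q and q^5. At
   q = e^(-pi) and at its dual e^(-pi/5) this yields (1 + 2 / g^5) (1 + 2 g) = 5
   for g = G_25, whence g = (1 + sqrt 5) / 2 and m = 5 sqrt 5 - 10.

   Degree 7: the norm form of Z[(1 + sqrt (-7)) / 2] gives s + s' = 1, where
   s = (alpha beta)^(1/8) and s' = ((1 - alpha) (1 - beta))^(1/8). Since
   q dalpha/dq = alpha (1 - alpha) phi(q)^4, differentiation gives
   m^2 = 7 (beta - s) / (s - alpha). With t = s' - s and p = 2 sqrt 2 G / G'^7
   these relations become 1 - p = t m and m^2 - 7 + 5 t m + t^3 m = 0, and
   eliminating t leaves m^4 - (2 + 5 p) m^2 + (1 - p)^3 = 0. They also give the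
   Schlaefli equation between G and G', whose solution for G' = G_25 is
   the stated radical. *)

(** * Unordered sums of nonnegative families *)

(** All sums stay real and nonnegative: theta functions are unordered sums, so a lattice identity is
    an explicit injection of index sets plus a comparison of exponents. Minus signs are moved across
    the equation, and alternating sums are split into even and odd halves. Limits are taken by
    dominated convergence over such families. The inversion formula rests on Polya's argument:
    powers of cosines, summed over an odd cycle, count walks on that cycle; when the cycle grows
    like the square root of the number of steps, both sides become Gaussian sums. The triple product
    is the finite q-binomial identity divided by its central coefficient, which cancels in every
    quotient formed later. The differential equation of the modulus comes from invariance under q ->
    q^2. In degree 7 the dual nomes e^(-pi/35) and e^(-pi/5), rather than e^(-35 pi) and e^(-5 pi),
    put alpha and beta above 1/2. This fixes the signs of all extracted roots: t < 0 and G / G' >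
    1. *)

Definition fsum {I : Type} (f : I -> R) (l : list I) : R :=
  fold_right (fun i a => f i + a) 0 l.

(** A supremum of finite sums involves no enumeration, so [Z], [Z * Z] and disjoint unions of them
    are treated alike and reindexing is free. Nonnegativity is built in, so identities with signs
    must be rearranged before they are summed. *)
Definition hsum {I : Type} (f : I -> R) (s : R) : Prop :=
  (forall i, 0 <= f i) /\
  is_lub (fun x => exists l, NoDup l /\ x = fsum f l) s.

Lemma fsum_app {I} (f : I -> R) l l' : fsum f (l ++ l') = fsum f l + fsum f l'.
Proof. induction l as [|i l IH]; simpl; [ring | rewrite IH; ring]. Qed.

Lemma fsum_ge0 {I} (f : I -> R) l : (forall i, 0 <= f i) -> 0 <= fsum f l.
Proof.
intros Hf; induction l as [|i l IH]; simpl; [lra|].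
generalize (Hf i); lra.
Qed.

Lemma fsum_incl {I} (f : I -> R) l l' :
  (forall i, 0 <= f i) -> NoDup l -> incl l l' -> fsum f l <= fsum f l'.
Proof.
intros Hf; revert l'; induction l as [|i l IH]; intros l' Hl Hi; simpl.
  now apply fsum_ge0.
inversion Hl as [|? ? Hil Hl']; subst.
destruct (in_split i l' (Hi i (or_introl eq_refl))) as (l1 & l2 & ->).
rewrite fsum_app; simpl.
assert (fsum f l <= fsum f (l1 ++ l2)); [|rewrite fsum_app in *; lra].
apply IH; trivial.
intros j Hj.
assert (Hj' := Hi j (or_intror Hj)).
apply in_app_iff in Hj'; apply in_app_iff.
destruct Hj' as [H|[<-|H]]; tauto.
Qed.

Lemma hsum_ub {I} (f : I -> R) s l : hsum f s -> NoDup l -> fsum f l <= s.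
Proof. intros [_ [Hs _]] Hl; apply Hs; eauto. Qed.

Lemma hsum_approx {I} (f : I -> R) s e :
  hsum f s -> 0 < e -> exists l, NoDup l /\ s - e < fsum f l.
Proof.
intros [Hf [_ Hs]] He.
apply NNPP; intros Hn.
assert (s <= s - e); [|lra].
apply Hs; intros x (l & Hl & ->).
apply Rnot_lt_le; intros H; apply Hn; eauto.
Qed.

Lemma hsum_intro {I} (f : I -> R) s :
  (forall i, 0 <= f i) ->
  (forall l, NoDup l -> fsum f l <= s) ->
  (forall e, 0 < e -> exists l, NoDup l /\ s - e <= fsum f l) -> hsum f s.
Proof.
intros Hf Hub Hap; split; [trivial|split].
  intros x (l & Hl & ->); auto.
intros b Hb; apply le_epsilon; intros e He.
destruct (Hap e He) as (l & Hl & H).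
assert (fsum f l <= b) by (apply Hb; eauto); lra.
Qed.

Lemma hsum_unique {I} (f : I -> R) s s' : hsum f s -> hsum f s' -> s = s'.
Proof.
intros [_ [H1 H2]] [_ [H3 H4]]; apply Rle_antisym; auto.
Qed.

Lemma hsum_ext {I} (f g : I -> R) s : (forall i, f i = g i) -> hsum f s -> hsum g s.
Proof.
intros Hfg Hf.
assert (E : forall l, fsum g l = fsum f l).
{ induction l as [|i l IH]; simpl; [easy|]; now rewrite IH, Hfg. }
apply hsum_intro.
- intros i; rewrite <- Hfg; apply Hf.
- intros l Hl; rewrite E; now apply hsum_ub.
- intros e He; destruct (hsum_approx f s e Hf He) as (l & Hl & H).
  exists l; rewrite E; split; [easy|lra].
Qed.

Lemma fsum_map {I J} (e : J -> I) (f : I -> R) l :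
  fsum f (map e l) = fsum (fun j => f (e j)) l.
Proof. induction l as [|i l IH]; simpl; [easy|now rewrite IH]. Qed.

Lemma fsum_support {I J} (e : J -> I) (f : I -> R) l :
  (forall i, f i <> 0 -> exists j, e j = i) -> NoDup l ->
  exists l', NoDup l' /\ incl (map e l') l /\ fsum f l = fsum (fun j => f (e j)) l'.
Proof.
intros He; induction l as [|i l IH]; intros Hl.
  exists nil; simpl; repeat split; [constructor|intros ? []].
inversion Hl as [|? ? Hil Hl']; subst.
destruct (IH Hl') as (l' & H1 & H2 & H3).
destruct (Req_dec (f i) 0) as [H0|H0].
- exists l'; simpl; rewrite H0, H3; repeat split; [easy| |ring].
  intros j Hj; right; auto.
- destruct (He i H0) as (j & Hj); exists (j :: l'); simpl; rewrite Hj, H3; repeat split.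
  + constructor; [|easy].
    intros H; apply Hil, H2; rewrite <- Hj; now apply in_map.
  + intros k [<-|Hk]; [now left|right; auto].
Qed.

Lemma hsum_inj {I J} (e : J -> I) (f : I -> R) (g : J -> R) s :
  (forall j j', e j = e j' -> j = j') ->
  (forall i, f i <> 0 -> exists j, e j = i) ->
  (forall i, 0 <= f i) ->
  (forall j, g j = f (e j)) ->
  hsum f s <-> hsum g s.
Proof.
intros Hinj Hsurj Hf Hg.
assert (Hgs : hsum g s <-> hsum (fun j => f (e j)) s).
{ split; apply hsum_ext; auto. }
rewrite Hgs; clear g Hg Hgs.
split; intros H; apply hsum_intro; trivial.
- intros l Hl; rewrite <- fsum_map; apply hsum_ub; [easy|].
  now apply Injective_map_NoDup.
- intros d Hd; destruct (hsum_approx f s d H Hd) as (l & Hl & Hl').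
  destruct (fsum_support e f l Hsurj Hl) as (l' & H1 & _ & H3).
  exists l'; split; [easy|lra].
- intros l Hl; destruct (fsum_support e f l Hsurj Hl) as (l' & H1 & _ & ->).
  now apply hsum_ub.
- intros d Hd; destruct (hsum_approx _ s d H Hd) as (l & Hl & Hl').
  exists (map e l); split; [now apply Injective_map_NoDup|].
  rewrite fsum_map; lra.
Qed.

Definition sum_fun {I J} (f : I -> R) (g : J -> R) (x : I + J) : R :=
  match x with inl i => f i | inr j => g j end.

Lemma hsum_sum {I J} (f : I -> R) (g : J -> R) s t :
  hsum f s -> hsum g t -> hsum (sum_fun f g) (s + t).
Proof.
intros Hf Hg; apply hsum_intro.
- intros [i|j]; [apply Hf|apply Hg].
- intros l Hl.
  assert (H : exists l1 l2, NoDup l1 /\ NoDup l2 /\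
     (forall i, In i l1 -> In (inl i) l) /\ (forall i, In i l2 -> In (inr i) l) /\
     fsum (sum_fun f g) l = fsum f l1 + fsum g l2).
  { induction l as [|x l IH].
      exists nil, nil; simpl; repeat split; try constructor; try easy; ring.
    inversion Hl as [|? ? Hil Hl']; subst.
    destruct (IH Hl') as (l1 & l2 & H1 & H2 & H3 & H4 & H5).
    destruct x as [i|j]; simpl; rewrite H5.
    - exists (i :: l1), l2; repeat split; trivial.
      + constructor; auto.
      + intros k [<-|Hk]; auto.
      + auto.
      + simpl; ring.
    - exists l1, (j :: l2); repeat split; trivial.
      + constructor; auto.
      + auto.
      + intros k [<-|Hk]; auto.
      + simpl; ring. }
  destruct H as (l1 & l2 & H1 & H2 & _ & _ & ->).
  apply Rplus_le_compat; now apply hsum_ub.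
- intros e He.
  destruct (hsum_approx f s (e / 2) Hf) as (l1 & H1 & H1'); [lra|].
  destruct (hsum_approx g t (e / 2) Hg) as (l2 & H2 & H2'); [lra|].
  exists (map inl l1 ++ map inr l2); split.
  + apply NoDup_app.
    * apply Injective_map_NoDup; [intros ? ?; congruence|easy].
    * apply Injective_map_NoDup; [intros ? ?; congruence|easy].
    * intros x Hx Hx'; apply in_map_iff in Hx; apply in_map_iff in Hx'.
      destruct Hx as (? & <- & _); destruct Hx' as (? & ? & _); discriminate.
  + rewrite fsum_app, !fsum_map; simpl; fold (fsum f l1).
    change (fun j : I => f j) with f; change (fun j : J => g j) with g; lra.
Qed.

Definition prod_fun {I J} (f : I -> R) (g : J -> R) (x : I * J) : R := f (fst x) * g (snd x).

Lemma fsum_scal {I} (f : I -> R) c l : fsum (fun i => c * f i) l = c * fsum f l.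
Proof. induction l as [|i l IH]; simpl; [ring|rewrite IH; ring]. Qed.

Lemma fsum_prod {I J} (f : I -> R) (g : J -> R) l1 l2 :
  fsum (prod_fun f g) (list_prod l1 l2) = fsum f l1 * fsum g l2.
Proof.
induction l1 as [|i l1 IH]; simpl; [ring|].
rewrite fsum_app, IH, fsum_map; unfold prod_fun; simpl.
rewrite fsum_scal; ring.
Qed.

Lemma hsum_prod {I J} (dI : forall x y : I, {x = y} + {x <> y})
  (dJ : forall x y : J, {x = y} + {x <> y}) (f : I -> R) (g : J -> R) s t :
  hsum f s -> hsum g t -> hsum (prod_fun f g) (s * t).
Proof.
intros Hf Hg.
assert (Hp : forall x, 0 <= prod_fun f g x).
{ intros [i j]; apply Rmult_le_pos; [apply Hf|apply Hg]. }
assert (Hs : 0 <= s) by (apply (hsum_ub f s nil); [easy|constructor]).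
assert (Ht : 0 <= t) by (apply (hsum_ub g t nil); [easy|constructor]).
apply hsum_intro; trivial.
- intros l Hl.
  (* A finite set of pairs lies in the product of its two projections; decidable equality serves to
     remove repetitions from these. *)
  apply Rle_trans with (fsum (prod_fun f g)
    (list_prod (nodup dI (map fst l)) (nodup dJ (map snd l)))).
  + apply fsum_incl; trivial.
    intros [i j] H; apply in_prod; apply nodup_In;
      [apply (in_map fst l (i, j) H) | apply (in_map snd l (i, j) H)].
  + rewrite fsum_prod; apply Rmult_le_compat.
    * apply fsum_ge0, Hf.
    * apply fsum_ge0, Hg.
    * apply hsum_ub, NoDup_nodup; easy.
    * apply hsum_ub, NoDup_nodup; easy.
- intros e He.
  set (d := e / (s + t + 1)).
  assert (Hd : 0 < d) by (apply Rdiv_lt_0_compat; lra).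
  assert (Hde : d * (s + t + 1) = e) by (unfold d; field; lra).
  destruct (hsum_approx f s d Hf Hd) as (l1 & H1 & H1').
  destruct (hsum_approx g t d Hg Hd) as (l2 & H2 & H2').
  exists (list_prod l1 l2); split.
  + clear -H1 H2; induction l1 as [|i l1 IH]; simpl; [constructor|].
    inversion H1; subst; apply NoDup_app.
    * apply Injective_map_NoDup; [intros ? ?; congruence|easy].
    * auto.
    * intros [i' j'] Hx Hx'; apply in_map_iff in Hx; destruct Hx as (? & [= <- <-] & _).
      apply in_prod_iff in Hx'; tauto.
  + rewrite fsum_prod.
    assert (U1 := hsum_ub f s l1 Hf H1); assert (U2 := hsum_ub g t l2 Hg H2).
    assert (V1 : 0 <= fsum f l1) by apply fsum_ge0, Hf.
    assert (V2 : 0 <= fsum g l2) by apply fsum_ge0, Hg.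
    assert (s * (t - fsum g l2) <= s * d) by (apply Rmult_le_compat_l; lra).
    assert (fsum g l2 * (s - fsum f l1) <= t * d) by (apply Rmult_le_compat; lra).
    lra.
Qed.

Lemma sum_n_fsum (f : nat -> R) n : sum_n f n = fsum f (seq 0 (S n)).
Proof.
induction n as [|n IH].
  rewrite sum_O; simpl; ring.
rewrite sum_Sn, IH, (seq_S (S n)), fsum_app; simpl.
unfold plus; simpl; ring.
Qed.

Lemma hsum_series (f : nat -> R) s : (forall n, 0 <= f n) -> is_series f s -> hsum f s.
Proof.
intros Hf Hs.
assert (Hle : forall n, sum_n f n <= s).
{ intros n; change (Rbar_le (sum_n f n) s).
  apply is_lim_seq_le_loc with (fun _ => sum_n f n) (sum_n f);
    [|apply is_lim_seq_const|exact Hs].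
  exists n; intros k Hk; rewrite !sum_n_fsum; apply fsum_incl; trivial.
    apply seq_NoDup.
  intros j; rewrite !in_seq; lia. }
apply hsum_intro; trivial.
- intros l Hl.
  apply Rle_trans with (sum_n f (list_max l)); [|easy].
  rewrite sum_n_fsum; apply fsum_incl; trivial.
  intros j Hj; apply in_seq.
  assert (H := proj1 (list_max_le l (list_max l)) (le_n _)).
  rewrite Forall_forall in H; specialize (H j Hj); lia.
- intros e He.
  change (is_lim_seq (sum_n f) s) in Hs; apply is_lim_seq_spec in Hs.
  destruct (Hs (mkposreal e He)) as (N & HN).
  exists (seq 0 (S N)); split; [apply seq_NoDup|].
  rewrite <- sum_n_fsum; specialize (HN N (le_n _)).
  simpl in HN.
  apply Rabs_def2 in HN; lra.
Qed.

Lemma hsum_bilateral (a : Z -> R) :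
  (forall n, 0 <= a n) -> ex_bilateral a -> hsum a (bilateral a).
Proof.
intros Ha [H1 H2].
assert (H := hsum_sum _ _ _ _
  (hsum_series _ _ (fun n => Ha (Z.of_nat n)) (Series_correct _ H1))
  (hsum_series _ _ (fun n => Ha (- Z.of_nat (S n))%Z) (Series_correct _ H2))).
eapply (hsum_inj (fun x : nat + nat => match x with
   inl n => Z.of_nat n | inr n => (- Z.of_nat (S n))%Z end) a); [| | |clear H|exact H].
- intros [n|n] [k|k] E; try (f_equal; lia); lia.
- intros i _; destruct (Z_le_gt_dec 0 i) as [Hi|Hi].
  + exists (inl (Z.to_nat i)); lia.
  + exists (inr (Z.to_nat (- i - 1))); lia.
- exact Ha.
- intros [n|n]; reflexivity.
Qed.

(** * Gaussian sums and lattice identities *)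

Definition gauss (x c : R) (n : Z) : R := exp (- x * (IZR n + c) ^ 2).

(** At nome [exp (- x)], [gs x 0] is theta_3 and [gs x (1 / 2)] is theta_2; the shifts 1/5 and 2/5
    come from cosets in degree 5. *)
Definition gs (x c : R) : R := bilateral (gauss x c).

Lemma gauss_pos x c n : 0 < gauss x c n.
Proof. apply exp_pos. Qed.

Lemma exp_le a b : a <= b -> exp a <= exp b.
Proof. intros [H| ->]; [left; now apply exp_increasing|right; easy]. Qed.

Lemma exp_pow x n : exp x ^ n = exp (INR n * x).
Proof.
induction n as [|n IH]; [simpl; now rewrite Rmult_0_l, exp_0|].
rewrite <- tech_pow_Rmult, IH, <- exp_plus, S_INR; f_equal; ring.
Qed.

Lemma ex_series_exp_lin x : 0 < x -> ex_series (fun n => exp (- x * INR n)).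
Proof.
intros Hx; apply ex_series_ext with (fun n => exp (- x) ^ n).
  intros n; rewrite exp_pow; f_equal; ring.
apply ex_series_geom; rewrite Rabs_pos_eq by (left; apply exp_pos).
rewrite <- exp_0; apply exp_increasing; lra.
Qed.

Lemma INR_le_sqr n : INR n <= INR n ^ 2.
Proof.
simpl; rewrite Rmult_1_r, <- mult_INR; apply le_INR; nia.
Qed.

Lemma ex_gauss x c : 0 < x -> 0 <= c <= 1 -> ex_bilateral (gauss x c).
Proof.
intros Hx Hc; split; refine (ex_series_le _ _ _ (ex_series_exp_lin x Hx)); intros n;
  change (norm ?y) with (Rabs y);
  rewrite Rabs_pos_eq by (left; apply gauss_pos); apply exp_le;
  assert (H := INR_le_sqr n); assert (H0 := pos_INR n).
- rewrite <- INR_IZR_INZ.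
  assert (x * INR n <= x * (INR n + c) ^ 2); [|lra].
  apply Rmult_le_compat_l; [lra|]; nra.
- rewrite opp_IZR, <- INR_IZR_INZ, S_INR.
  assert (x * INR n <= x * (- (INR n + 1) + c) ^ 2); [|lra].
  apply Rmult_le_compat_l; [lra|].
  replace ((- (INR n + 1) + c) ^ 2) with (INR n ^ 2 + (1 - c) * (2 * INR n + (1 - c))) by ring.
  assert (0 <= (1 - c) * (2 * INR n + (1 - c))) by (apply Rmult_le_pos; lra); lra.
Qed.

Lemma hsum_gauss x c : 0 < x -> 0 <= c <= 1 -> hsum (gauss x c) (gs x c).
Proof.
intros Hx Hc; apply hsum_bilateral; [|now apply ex_gauss].
intros n; left; apply gauss_pos.
Qed.

Lemma gs_pos x c : 0 < x -> 0 <= c <= 1 -> 0 < gs x c.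
Proof.
intros Hx Hc.
assert (H := hsum_ub _ _ (0%Z :: nil) (hsum_gauss x c Hx Hc)).
simpl in H; assert (H1 := gauss_pos x c 0).
enough (gauss x c 0 + 0 <= gs x c) by lra.
apply H; repeat constructor; intros [].
Qed.

Lemma phi_gs x : phi (exp (- x)) = gs x 0.
Proof.
unfold phi, gs, bilateral; f_equal; apply Series_ext; intros n; unfold gauss.
- replace (Z.of_nat n ^ 2)%Z with (Z.of_nat (n * n)) by lia.
  rewrite <- pow_powerRZ, exp_pow, <- INR_IZR_INZ, mult_INR; f_equal; ring.
- replace ((- Z.of_nat (S n)) ^ 2)%Z with (Z.of_nat (S n * S n)) by lia.
  rewrite <- pow_powerRZ, exp_pow, opp_IZR, <- INR_IZR_INZ, mult_INR; f_equal; ring.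
Qed.

(** * Theta identities from sublattices of quadratic integers *)

Definition gauss2 (x c y d : R) : Z * Z -> R := prod_fun (gauss x c) (gauss y d).

Lemma gauss2E x c y d m n :
  gauss2 x c y d (m, n) = exp (- (x * (IZR m + c) ^ 2 + y * (IZR n + d) ^ 2)).
Proof. unfold gauss2, prod_fun, gauss; simpl fst; simpl snd. rewrite <- exp_plus; f_equal; ring. Qed.

Lemma gauss2_ge0 x c y d p : 0 <= gauss2 x c y d p.
Proof. destruct p; rewrite gauss2E; left; apply exp_pos. Qed.

Lemma hsum_gauss2 x c y d : 0 < x -> 0 <= c <= 1 -> 0 < y -> 0 <= d <= 1 ->
  hsum (gauss2 x c y d) (gs x c * gs y d).
Proof.
intros; apply hsum_prod; try apply Z.eq_dec; now apply hsum_gauss.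
Qed.

Ltac zlia := Z.to_euclidean_division_equations; lia.
Ltac pair_inj a b c d H := cbv beta iota in H; apply pair_equal_spec in H; destruct H;
  first [exfalso; zlia | replace c with a by zlia; replace d with b by zlia; reflexivity].
Ltac exps := rewrite !gauss2E; f_equal;
  repeat rewrite ?plus_IZR, ?minus_IZR, ?mult_IZR, ?opp_IZR; field.

Lemma gs_split x : 0 < x -> gs x 0 = gs (4 * x) 0 + gs (4 * x) (1 / 2).
Proof.
intros Hx; eapply hsum_unique; [apply hsum_gauss; lra|].
apply (hsum_inj (fun s : Z + Z =>
   match s with inl n => (2 * n)%Z | inr n => (2 * n + 1)%Z end) (gauss x 0)
  (sum_fun (gauss (4 * x) 0) (gauss (4 * x) (1 / 2)))).
- intros [m|m] [n|n] H; first [f_equal; lia | exfalso; lia].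
- intros n _; destruct (Z.eq_dec (n mod 2) 0).
  + exists (inl (n / 2)%Z); zlia.
  + exists (inr (n / 2)%Z); zlia.
- intros n; left; apply gauss_pos.
- intros [n|n]; unfold sum_fun, gauss; f_equal; rewrite ?plus_IZR, mult_IZR; field.
- apply hsum_sum; apply hsum_gauss; lra.
Qed.

(** Landen's transformation: up to conjugation [(u + v, u - v)] is multiplication by 1 + i in Z[i],
    and the pairs of equal and of opposite parity are the two cosets of its image. *)
Lemma gs_sqr0 x : 0 < x -> gs x 0 ^ 2 = gs (2 * x) 0 ^ 2 + gs (2 * x) (1 / 2) ^ 2.
Proof.
intros Hx; rewrite <- !Rsqr_pow2; unfold Rsqr.
eapply hsum_unique; [apply hsum_gauss2; lra|].
apply (hsum_inj (fun s : (Z * Z) + (Z * Z) =>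
   match s with inl (u, v) => (u + v, u - v)%Z
              | inr (u, v) => (u + v + 1, u - v)%Z end) (gauss2 x 0 x 0)
  (sum_fun (gauss2 (2 * x) 0 (2 * x) 0) (gauss2 (2 * x) (1 / 2) (2 * x) (1 / 2)))).
- intros [[a b]|[a b]] [[c d]|[c d]] H; pair_inj a b c d H.
- intros [m n] _; destruct (Z.eq_dec ((m + n) mod 2) 0).
  + exists (inl ((m + n) / 2, (m - n) / 2)%Z); f_equal; zlia.
  + exists (inr ((m + n) / 2, (m - n) / 2)%Z); f_equal; zlia.
- apply gauss2_ge0.
- intros [[a b]|[a b]]; cbv beta iota delta [sum_fun]; exps.
- apply hsum_sum; apply hsum_gauss2; lra.
Qed.

Lemma gs_sqr_half x : 0 < x -> gs x (1 / 2) ^ 2 = 2 * gs (2 * x) 0 * gs (2 * x) (1 / 2).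
Proof.
intros Hx; rewrite <- !Rsqr_pow2; unfold Rsqr.
replace (2 * gs (2 * x) 0 * gs (2 * x) (1 / 2)) with
  (gs (2 * x) 0 * gs (2 * x) (1 / 2) + gs (2 * x) (1 / 2) * gs (2 * x) 0) by ring.
eapply hsum_unique; [apply hsum_gauss2; lra|].
apply (hsum_inj (fun s : (Z * Z) + (Z * Z) =>
   match s with inl (u, v) => (u + v, u - v - 1)%Z
              | inr (u, v) => (u + v, u - v)%Z end) (gauss2 x (1 / 2) x (1 / 2))
  (sum_fun (gauss2 (2 * x) 0 (2 * x) (1 / 2)) (gauss2 (2 * x) (1 / 2) (2 * x) 0))).
- intros [[a b]|[a b]] [[c d]|[c d]] H; pair_inj a b c d H.
- intros [m n] _; destruct (Z.eq_dec ((m + n) mod 2) 0).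
  + exists (inr ((m + n) / 2, (m - n) / 2)%Z); f_equal; zlia.
  + exists (inl ((m + n + 1) / 2, (m - n) / 2)%Z); f_equal; zlia.
- apply gauss2_ge0.
- intros [[a b]|[a b]]; cbv beta iota delta [sum_fun]; exps.
- apply hsum_sum; apply hsum_gauss2; lra.
Qed.

(* Cosets of (2 + i) Z[i] in Z[i]. *)
Lemma gs_quintic x : 0 < x ->
  gs x 0 ^ 2 = gs (5 * x) 0 ^ 2 + 4 * gs (5 * x) (2 / 5) * gs (5 * x) (1 / 5).
Proof.
intros Hx; rewrite <- !Rsqr_pow2; unfold Rsqr.
set (u := gs (5 * x) (2 / 5) * gs (5 * x) (1 / 5)).
replace (gs (5 * x) 0 * gs (5 * x) 0 + 4 * gs (5 * x) (2 / 5) * gs (5 * x) (1 / 5))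
  with (gs (5 * x) 0 * gs (5 * x) 0 + ((u + u) + (u + u))) by (unfold u; ring).
eapply hsum_unique; [apply hsum_gauss2; lra|].
set (G := gauss2 (5 * x) (2 / 5) (5 * x) (1 / 5)).
assert (HG : hsum G u) by (apply hsum_gauss2; lra).
(* The residue of 2m + n modulo 5 names the coset of m + n i. One nonzero coset is 1 + (2 + i) (c -
   d i), and the units -1, i, -i carry it to the other three, whence the factor 4. Dividing by 2 + i
   turns the 1 into (2 - i) / 5, which gives the shifts 2/5 and 1/5. *)
apply (hsum_inj (fun s : (Z * Z) + (((Z * Z) + (Z * Z)) + ((Z * Z) + (Z * Z))) =>
   match s with
   | inl (c, d) => (2 * c - d, c + 2 * d)%Z
   | inr (inl (inl (c, d))) => (2 * c + d + 1, c - 2 * d)%Z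
   | inr (inl (inr (c, d))) => (- (2 * c + d + 1), - (c - 2 * d))%Z
   | inr (inr (inl (c, d))) => (- (c - 2 * d), 2 * c + d + 1)%Z
   | inr (inr (inr (c, d))) => (c - 2 * d, - (2 * c + d + 1))%Z
   end) (gauss2 x 0 x 0)
  (sum_fun (gauss2 (5 * x) 0 (5 * x) 0) (sum_fun (sum_fun G G) (sum_fun G G)))).
- intros [[a b]|[[[a b]|[a b]]|[[a b]|[a b]]]] [[c d]|[[[c d]|[c d]]|[[c d]|[c d]]]] H;
    pair_inj a b c d H.
- intros [m n] _.
  assert (H : ((2 * m + n) mod 5 = 0 \/ (2 * m + n) mod 5 = 1 \/ (2 * m + n) mod 5 = 2
    \/ (2 * m + n) mod 5 = 3 \/ (2 * m + n) mod 5 = 4)%Z) by zlia.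
  destruct H as [H|[H|[H|[H|H]]]].
  + exists (inl ((2 * m + n) / 5, (2 * n - m) / 5)%Z); f_equal; zlia.
  + exists (inr (inr (inl ((2 * (n - 1) - m) / 5, (n - 1 + 2 * m) / 5)%Z))); f_equal; zlia.
  + exists (inr (inl (inl ((2 * (m - 1) + n) / 5, (m - 1 - 2 * n) / 5)%Z))); f_equal; zlia.
  + exists (inr (inl (inr ((2 * (- m - 1) - n) / 5, (- m - 1 + 2 * n) / 5)%Z))); f_equal; zlia.
  + exists (inr (inr (inr ((2 * (- n - 1) + m) / 5, (- n - 1 - 2 * m) / 5)%Z))); f_equal; zlia.
- apply gauss2_ge0.
- intros [[a b]|[[[a b]|[a b]]|[[a b]|[a b]]]]; cbv beta iota delta [sum_fun]; unfold G; exps.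
- apply hsum_sum; [apply hsum_gauss2; lra|repeat apply hsum_sum; exact HG].
Qed.

(** theta_4 at nome [exp (- x)], with the even and the odd terms of the alternating sum
    separated. *)
Definition t4 (x : R) : R := gs (4 * x) 0 - gs (4 * x) (1 / 2).

(* The norm form of Z[w], w = (1 + sqrt (-7)) / 2, which has norm 2. *)
Definition nrm7 (x : R) (p : Z * Z) : R :=
  exp (- x * IZR (fst p * fst p + fst p * snd p + 2 * (snd p * snd p))).

Definition theta7 (x : R) : R :=
  gs x 0 * gs (7 * x) 0 + gs x (1 / 2) * gs (7 * x) (1 / 2).

Lemma nrm7_ge0 x p : 0 <= nrm7 x p.
Proof. left; apply exp_pos. Qed.

Lemma nrm7E x a b : nrm7 x (a, b) = exp (- x * IZR (a * a + a * b + 2 * (b * b))).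
Proof. reflexivity. Qed.

Ltac exps7 := rewrite ?nrm7E, ?gauss2E; f_equal;
  repeat rewrite ?plus_IZR, ?minus_IZR, ?mult_IZR, ?opp_IZR; field.

(** Completing the square: a second coordinate 2v gives u^2 + 7 v^2 with u = a + v, and an odd one
    shifts both u and v by 1/2. *)
Lemma hsum_nrm7 x : 0 < x -> hsum (nrm7 x) (theta7 x).
Proof.
intros Hx.
apply (hsum_inj (fun s : (Z * Z) + (Z * Z) =>
   match s with inl (u, v) => (u - v, 2 * v)%Z
              | inr (u, v) => (u - v, 2 * v + 1)%Z end) (nrm7 x)
  (sum_fun (gauss2 x 0 (7 * x) 0) (gauss2 x (1 / 2) (7 * x) (1 / 2)))).
- intros [[a b]|[a b]] [[c d]|[c d]] H; pair_inj a b c d H.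
- intros [m n] _; destruct (Z.eq_dec (n mod 2) 0).
  + exists (inl (m + n / 2, n / 2)%Z); f_equal; zlia.
  + exists (inr (m + n / 2, n / 2)%Z); f_equal; zlia.
- apply nrm7_ge0.
- intros [[a b]|[a b]]; cbv beta iota delta [sum_fun]; exps7.
- apply hsum_sum; apply hsum_gauss2; lra.
Qed.

Ltac inj_case H := cbv beta iota in H;
  repeat match type of H with context [Z.eq_dec ?a ?b] => destruct (Z.eq_dec a b) end;
  first [discriminate H
    | apply ssrfun.inl_inj in H || apply ssrfun.inr_inj in H;
      apply pair_equal_spec in H; destruct H;
      first [exfalso; zlia | repeat f_equal; zlia]].

Lemma sum_fun_ge0 {I J} (f : I -> R) (g : J -> R) :
  (forall i, 0 <= f i) -> (forall j, 0 <= g j) -> forall p, 0 <= sum_fun f g p.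
Proof. intros Hf Hg [i|j]; simpl; auto. Qed.

(* Elements x + y sqrt (-7) with x, y odd are 2 w z or its conjugate, for a
   unique z in Z[w] not divisible by the conjugate of w. *)
Lemma gs_septic_odd x : 0 < x ->
  gs (x / 2) (1 / 2) * gs (7 * x / 2) (1 / 2) + 2 * theta7 (2 * x) = 2 * theta7 x.
Proof.
intros Hx.
replace (2 * theta7 (2 * x)) with (theta7 (2 * x) + theta7 (2 * x)) by ring.
replace (2 * theta7 x) with (theta7 x + theta7 x) by ring.
symmetry; apply (hsum_unique (sum_fun (nrm7 x) (nrm7 x))).
  apply hsum_sum; apply hsum_nrm7; lra.
(* The map [(a + 2 * b, - a)] is multiplication by the conjugate of w; it doubles the norm and
   reaches exactly the elements with even coordinate sum. The pairs [(m, n)] fill the odd coordinate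
   sums of both copies, the parity of m + n choosing the copy. *)
apply (hsum_inj (fun s : (Z * Z) + ((Z * Z) + (Z * Z)) =>
   match s with
   | inl (m, n) => if Z.eq_dec ((m + n) mod 2) 0
       then inl ((m + 3 * n + 2) / 2, (n - m) / 2)%Z
       else inr ((m - 3 * n - 1) / 2, (- m - n - 1) / 2)%Z
   | inr (inl (a, b)) => inl (a + 2 * b, - a)%Z
   | inr (inr (a, b)) => inr (a + 2 * b, - a)%Z
   end) (sum_fun (nrm7 x) (nrm7 x))
  (sum_fun (gauss2 (x / 2) (1 / 2) (7 * x / 2) (1 / 2))
     (sum_fun (nrm7 (2 * x)) (nrm7 (2 * x))))).
- intros [[a b]|[[a b]|[a b]]] [[c d]|[[c d]|[c d]]] H; inj_case H.
- intros [[u v]|[u v]] _; destruct (Z.eq_dec ((u + v) mod 2) 0).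
  + exists (inr (inl (- v, (u + v) / 2)%Z)); do 2 f_equal; zlia.
  + exists (inl (2 * u - 3 * ((u + v - 1) / 2) - 2, (u + v - 1) / 2)%Z).
    cbv beta iota; destruct Z.eq_dec; [|exfalso; zlia]; do 2 f_equal; zlia.
  + exists (inr (inr (- v, (u + v) / 2)%Z)); do 2 f_equal; zlia.
  + exists (inl (2 * u - 3 * ((u + v - 1) / 2) - 2, - ((u + v - 1) / 2) - 1)%Z).
    cbv beta iota; destruct Z.eq_dec; [exfalso; zlia|]; do 2 f_equal; zlia.
- apply sum_fun_ge0; apply nrm7_ge0.
- intros [[m n]|[[a b]|[a b]]]; cbv beta iota delta [sum_fun]; [|exps7|exps7].
  destruct Z.eq_dec as [H|H].
  + set (k := ((m + 3 * n + 2) / 2)%Z).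
    replace ((n - m) / 2)%Z with (2 * n + 1 - k)%Z by (unfold k; zlia).
    replace m with (2 * k - 3 * n - 2)%Z by (unfold k; zlia); exps7.
  + set (k := ((m - 3 * n - 1) / 2)%Z).
    replace ((- m - n - 1) / 2)%Z with (- 2 * n - 1 - k)%Z by (unfold k; zlia).
    replace m with (2 * k + 3 * n + 1)%Z by (unfold k; zlia); exps7.
- apply hsum_sum; [apply hsum_gauss2; lra|]; apply hsum_sum; apply hsum_nrm7; lra.
Qed.

(* Inclusion-exclusion on divisibility by w and by its conjugate: the elements
   of odd norm are the x + y sqrt (-7) with x + y odd. *)
Lemma gs_septic_even x : 0 < x ->
  gs (4 * x) 0 * gs (28 * x) (1 / 2) + gs (4 * x) (1 / 2) * gs (28 * x) 0
  + 2 * theta7 (2 * x) = theta7 x + theta7 (4 * x).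
Proof.
intros Hx.
replace (2 * theta7 (2 * x)) with (theta7 (2 * x) + theta7 (2 * x)) by ring.
symmetry; apply (hsum_unique (sum_fun (nrm7 x) (nrm7 (4 * x)))).
  apply hsum_sum; apply hsum_nrm7; lra.
(* The summand [nrm7 (4 * x)] stands for the multiples of 2, the product of w and its conjugate,
   which are counted twice. The map [(- 2 * b, a + b)] is multiplication by w; its value is a
   multiple of 2 when a + b is even, and is then sent to that copy. *)
apply (hsum_inj (fun s : ((Z * Z) + (Z * Z)) + ((Z * Z) + (Z * Z)) =>
   match s with
   | inl (inl (m, n)) => inl (2 * m - 2 * n - 1, 4 * n + 2)%Z
   | inl (inr (m, n)) => inl (2 * m + 1 - 2 * n, 4 * n)%Z
   | inr (inl (a, b)) => inl (a + 2 * b, - a)%Z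
   | inr (inr (a, b)) => if Z.eq_dec ((a + b) mod 2) 0
       then inr (- b, (a + b) / 2)%Z else inl (- 2 * b, a + b)%Z
   end) (sum_fun (nrm7 x) (nrm7 (4 * x)))
  (sum_fun (sum_fun (gauss2 (4 * x) 0 (28 * x) (1 / 2)) (gauss2 (4 * x) (1 / 2) (28 * x) 0))
     (sum_fun (nrm7 (2 * x)) (nrm7 (2 * x))))).
- intros [[[a b]|[a b]]|[[a b]|[a b]]] [[[c d]|[c d]]|[[c d]|[c d]]] H; inj_case H.
- intros [[u v]|[u v]] _.
  + destruct (Z.eq_dec ((u + v) mod 2) 0).
      exists (inr (inl (- v, (u + v) / 2)%Z)); do 2 f_equal; zlia.
    destruct (Z.eq_dec (u mod 2) 0).
      exists (inr (inr (v + u / 2, - (u / 2))%Z)).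
      cbv beta iota; destruct Z.eq_dec; [exfalso; zlia|]; do 2 f_equal; zlia.
    destruct (Z.eq_dec (v mod 4) 0).
      exists (inl (inr ((u - 1) / 2 + v / 4, v / 4)%Z)); do 2 f_equal; zlia.
    exists (inl (inl ((u + 1) / 2 + (v - 2) / 4, (v - 2) / 4)%Z)); do 2 f_equal; zlia.
  + exists (inr (inr (2 * v + u, - u)%Z)).
    cbv beta iota; destruct Z.eq_dec; [|exfalso; zlia]; do 2 f_equal; zlia.
- apply sum_fun_ge0; apply nrm7_ge0.
- intros [[[a b]|[a b]]|[[a b]|[a b]]]; cbv beta iota delta [sum_fun]; [exps7|exps7|exps7|].
  destruct Z.eq_dec as [H|H]; [|exps7].
  set (k := ((a + b) / 2)%Z); replace a with (2 * k - b)%Z by (unfold k; zlia); exps7.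
- repeat apply hsum_sum; first [apply hsum_nrm7 | apply hsum_gauss2]; lra.
Qed.

(** Theta form of the degree 7 modular equation, obtained by eliminating the norm-form sums between
    the preceding identities at several arguments. The products at [2 * x] and [x / 2] appear
    because Landen's transformation makes them square roots of products of thetas at [x]; these
    become the eighth roots of the moduli. *)
Lemma gs_septic x : 0 < x ->
  gs x 0 * gs (7 * x) 0
  = t4 (2 * x) * t4 (7 * (2 * x)) + / 2 * (gs (x / 2) (1 / 2) * gs (7 * x / 2) (1 / 2)).
Proof.
intros Hx; unfold t4.
assert (H1 := gs_septic_odd x Hx); assert (H2 := gs_septic_odd (2 * x) ltac:(lra)).
assert (H3 := gs_septic_even (2 * x) ltac:(lra)).
assert (H4 := gs_septic_odd (4 * x) ltac:(lra)).
assert (S1 := gs_split (2 * x) ltac:(lra)); assert (S2 := gs_split (7 * (2 * x)) ltac:(lra)).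
unfold theta7 in *.
replace (7 * (2 * (2 * x))) with (7 * (4 * x)) in * by ring.
replace (2 * (2 * x)) with (4 * x) in * by ring.
replace (2 * (4 * x)) with (8 * x) in * by ring.
replace (4 * (2 * x)) with (8 * x) in * by ring.
replace (4 * (7 * (2 * x))) with (56 * x) in * by ring.
replace (28 * (2 * x)) with (56 * x) in * by ring.
replace (2 * x / 2) with x in * by field.
replace (4 * x / 2) with (2 * x) in * by field.
replace (7 * (2 * x) / 2) with (7 * x) in * by field.
replace (7 * (4 * x) / 2) with (7 * (2 * x)) in * by field.
rewrite S1, S2 in *; nra.
Qed.

(** * Tannery's theorem *)

Lemma fsum_plus {I} (f g : I -> R) l : fsum (fun i => f i + g i) l = fsum f l + fsum g l.
Proof. induction l as [|i l IH]; simpl; [ring|rewrite IH; ring]. Qed.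

Lemma fsum_le {I} (f g : I -> R) l : (forall i, f i <= g i) -> fsum f l <= fsum g l.
Proof. intros H; induction l as [|i l IH]; simpl; [lra|generalize (H i); lra]. Qed.

Lemma fsum_ext {I} (f g : I -> R) l : (forall i, f i = g i) -> fsum f l = fsum g l.
Proof. intros H; induction l as [|i l IH]; simpl; [easy|now rewrite H, IH]. Qed.

Lemma fsum_outside {I} (f : I -> R) l l' : (forall i, 0 <= f i) -> NoDup l' ->
  exists l'', NoDup l'' /\ (forall i, In i l'' -> ~ In i l) /\
    fsum f l' <= fsum f l + fsum f l'' /\ incl l'' l'.
Proof.
intros Hf.
assert (H : forall m, NoDup m -> exists m1 m2, NoDup m1 /\ NoDup m2 /\ incl m1 l /\
  (forall i, In i m2 -> ~ In i l) /\ incl m1 m /\ incl m2 m /\ fsum f m = fsum f m1 + fsum f m2).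
{ induction m as [|i m IH]; intros Hm.
    exists nil, nil; simpl; repeat split; try constructor; try easy; ring.
  inversion Hm as [|? ? Him Hm']; subst.
  destruct (IH Hm') as (m1 & m2 & H1 & H2 & H3 & H4 & H5 & H6 & H7).
  destruct (classic (In i l)) as [Hi|Hi]; simpl; rewrite H7.
  - exists (i :: m1), m2; repeat split; trivial; simpl; try ring.
    + constructor; auto.
    + intros k [<-|Hk]; auto.
    + intros k [<-|Hk]; [now left|right; auto].
    + intros k Hk; right; auto.
  - exists m1, (i :: m2); repeat split; trivial; simpl; try ring.
    + constructor; auto.
    + intros k [<-|Hk]; auto.
    + intros k Hk; right; auto.
    + intros k [<-|Hk]; [now left|right; auto]. }
intros Hl'; destruct (H l' Hl') as (m1 & m2 & H1 & H2 & H3 & H4 & H5 & H6 & H7).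
exists m2; repeat split; trivial.
rewrite H7; assert (fsum f m1 <= fsum f l) by now apply fsum_incl.
lra.
Qed.

Lemma hsum_tail {I} (f b : I -> R) s t l : NoDup l ->
  hsum f s -> hsum b t -> (forall i, f i <= b i) -> s - fsum f l <= t - fsum b l.
Proof.
intros Hl Hf Hb Hfb.
enough (s <= fsum f l + (t - fsum b l)) by lra.
apply Hf; intros x (l' & Hl' & ->).
destruct (fsum_outside f l l' (proj1 Hf) Hl') as (l'' & H1 & H2 & H3 & _).
assert (fsum b l + fsum b l'' <= t).
{ rewrite <- fsum_app; apply hsum_ub; trivial.
  apply NoDup_app; trivial; intros i Hi Hi'; now apply (H2 i). }
assert (H4 := fsum_le f b l'' Hfb); lra.
Qed.

Lemma is_lim_seq_fsum {I} (F : nat -> I -> R) (f : I -> R) l :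
  (forall i, is_lim_seq (fun n => F n i) (f i)) ->
  is_lim_seq (fun n => fsum (F n) l) (fsum f l).
Proof.
intros H; induction l as [|i l IH]; simpl.
  apply is_lim_seq_const.
now apply is_lim_seq_plus'.
Qed.

(** A finite list carrying all but e/3 of the dominating sum bounds the tails of the terms and of
    the limit alike; on the list itself convergence is termwise. *)
Lemma tannery {I} (F : nat -> I -> R) (f b : I -> R) (S : nat -> R) (s t : R) :
  (forall n, hsum (F n) (S n)) -> hsum f s -> hsum b t ->
  eventually (fun n => forall i, F n i <= b i) ->
  (forall i, is_lim_seq (fun n => F n i) (f i)) ->
  is_lim_seq S s.
Proof.
intros HF Hf Hb [N HN] Hlim.
assert (Hfb : forall i, f i <= b i).
{ intros i; change (Rbar_le (f i) (b i)).
  apply is_lim_seq_le_loc with (fun n => F n i) (fun _ => b i);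
    [|apply Hlim|apply is_lim_seq_const].
  exists N; intros n Hn; now apply HN. }
apply is_lim_seq_spec; intros e.
assert (He : 0 < e / 3) by (generalize (cond_pos e); lra).
destruct (hsum_approx b t (e / 3) Hb He) as (l & Hl & Hl').
assert (H := is_lim_seq_fsum F f l Hlim).
apply is_lim_seq_spec in H; destruct (H (mkposreal _ He)) as [M HM]; simpl in HM.
exists (N + M)%nat; intros n Hn.
specialize (HM n ltac:(lia)); specialize (HN n ltac:(lia)).
assert (H1 := hsum_tail (F n) b (S n) t l Hl (HF n) Hb HN).
assert (H2 := hsum_tail f b s t l Hl Hf Hb Hfb).
assert (H3 := hsum_ub f s l Hf Hl); assert (H4 := hsum_ub (F n) (S n) l (HF n) Hl).
apply Rabs_def1; apply Rabs_def2 in HM; lra.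
Qed.

Lemma hsum_plus {I} (f g : I -> R) s t : hsum f s -> hsum g t ->
  hsum (fun i => f i + g i) (s + t).
Proof.
intros Hf Hg; apply hsum_intro.
- intros i; apply Rplus_le_le_0_compat; [apply Hf|apply Hg].
- intros l Hl; rewrite fsum_plus; apply Rplus_le_compat; now apply hsum_ub.
- intros e He.
  destruct (hsum_approx f s (e / 2) Hf) as (l1 & H1 & H1'); [lra|].
  destruct (hsum_approx g t (e / 2) Hg) as (l2 & H2 & H2'); [lra|].
  destruct (fsum_outside g l1 l2 (proj1 Hg) H2) as (l4 & H5 & H6 & H7 & H8).
  exists (l1 ++ l4); split.
    apply NoDup_app; trivial; intros i Hi Hi'; now apply (H6 i).
  rewrite fsum_plus, !fsum_app.
  assert (0 <= fsum f l4) by apply fsum_ge0, Hf; lra.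
Qed.

Lemma hsum_scal {I} (f : I -> R) s a : 0 <= a -> hsum f s -> hsum (fun i => a * f i) (a * s).
Proof.
intros Ha Hf; apply hsum_intro.
- intros i; apply Rmult_le_pos; [easy|apply Hf].
- intros l Hl; rewrite fsum_scal; apply Rmult_le_compat_l; [easy|now apply hsum_ub].
- intros e He.
  destruct (hsum_approx f s (e / (a + 1)) Hf) as (l & Hl & H).
    apply Rdiv_lt_0_compat; lra.
  exists l; split; trivial; rewrite fsum_scal.
  assert (a * (s - e / (a + 1)) <= a * fsum f l) by (apply Rmult_le_compat_l; lra).
  assert (a * (e / (a + 1)) <= e); [|lra].
  apply Rmult_le_reg_r with (a + 1); [lra|].
  replace (a * (e / (a + 1)) * (a + 1)) with (a * e) by (field; lra); lra.
Qed.

Lemma hsum_finite {I} (f : I -> R) l : (forall i, 0 <= f i) -> NoDup l ->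
  (forall i, ~ In i l -> f i = 0) -> hsum f (fsum f l).
Proof.
intros Hf Hl H0; apply hsum_intro; trivial.
- intros l' Hl'.
  destruct (fsum_outside f l l' Hf Hl') as (l'' & H1 & H2 & H3 & _).
  enough (fsum f l'' = 0) by lra.
  clear -H2 H0; induction l'' as [|i l'' IH]; simpl; trivial.
  rewrite IH, H0; [ring| |]; intros; apply H2; simpl; auto.
- intros e He; exists l; split; trivial; lra.
Qed.

(** * The inversion formula *)

(* [kern m r] is the binomial coefficient of 2m over m + r. *)
Fixpoint kern (m : nat) (r : Z) : R :=
  match m with
  | O => if Z.eq_dec r 0 then 1 else 0
  | S m => kern m (r - 1) + 2 * kern m r + kern m (r + 1)
  end.

Lemma kern_ge0 m r : 0 <= kern m r.
Proof.
revert r; induction m as [|m IH]; intros r; simpl.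
  destruct Z.eq_dec; lra.
generalize (IH (r - 1)%Z) (IH r) (IH (r + 1)%Z); lra.
Qed.

Lemma kern_0_pos m : 0 < kern m 0.
Proof.
induction m as [|m IH]; simpl; [lra|].
generalize (kern_ge0 m (-1)) (kern_ge0 m 1); lra.
Qed.

Lemma kern_opp m r : kern m (- r) = kern m r.
Proof.
revert r; induction m as [|m IH]; intros r; simpl.
  do 2 destruct Z.eq_dec; trivial; lia.
replace (- r - 1)%Z with (- (r + 1))%Z by lia.
replace (- r + 1)%Z with (- (r - 1))%Z by lia.
rewrite !IH; ring.
Qed.

(** The ratio of consecutive binomial coefficients, with denominators cleared so that it also holds
    where the coefficients vanish. *)
Lemma kern_step m r :
  (INR m + IZR r + 1) * kern m (r + 1) = (INR m - IZR r) * kern m r.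
Proof.
revert r; induction m as [|m IH]; intros r.
  simpl; do 2 destruct Z.eq_dec; subst; try lia; try (simpl; ring).
  replace r with (-1)%Z by lia; simpl; ring.
rewrite S_INR; cbn [kern].
replace (r + 1 - 1)%Z with r by lia.
assert (H0 := IH (r - 1)%Z); assert (H1 := IH r); assert (H2 := IH (r + 1)%Z).
replace (r - 1 + 1)%Z with r in H0 by lia.
rewrite minus_IZR in H0; rewrite plus_IZR in H2.
lra.
Qed.

Definition zrange (h : nat) : list Z :=
  map (fun k => (Z.of_nat k - Z.of_nat h)%Z) (seq 0 (2 * h + 1)).

Lemma NoDup_zrange h : NoDup (zrange h).
Proof.
apply Injective_map_NoDup; [intros a b; lia|apply seq_NoDup].
Qed.

Lemma In_zrange h j : In j (zrange h) <-> (- Z.of_nat h <= j <= Z.of_nat h)%Z.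
Proof.
unfold zrange; rewrite in_map_iff; split.
- intros (k & <- & Hk); apply in_seq in Hk; lia.
- intros Hj; exists (Z.to_nat (j + Z.of_nat h)); split; [lia|apply in_seq; lia].
Qed.

Lemma fsum_telescope (F : nat -> R) n :
  fsum (fun k => F (S k) - F k) (seq 0 n) = F n - F O.
Proof.
induction n as [|n IH]; [simpl; ring|].
rewrite seq_S, fsum_app, IH; simpl; ring.
Qed.

Definition odd_mod (h : nat) : R := 2 * INR h + 1.

(** Orthogonality of the characters of a cyclic group of odd order. Off the trivial case,
    multiplying by 2 sin y makes the sum telescope. *)
Lemma sum_cos_range (h : nat) (s : Z) :
  fsum (fun j => cos (2 * PI * IZR j * IZR s / odd_mod h)) (zrange h)
  = if Z.eq_dec (s mod (2 * Z.of_nat h + 1)) 0 then odd_mod h else 0.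
Proof.
assert (Hl : 0 < odd_mod h) by (unfold odd_mod; generalize (pos_INR h); lra).
assert (EL : odd_mod h = IZR (2 * Z.of_nat h + 1)).
{ unfold odd_mod; now rewrite plus_IZR, mult_IZR, <- INR_IZR_INZ. }
destruct Z.eq_dec as [H|H].
- rewrite (fsum_ext _ (fun _ => 1)).
  + unfold zrange; rewrite fsum_map.
    replace (odd_mod h) with (INR (2 * h + 1)) by (unfold odd_mod; rewrite plus_INR, mult_INR; simpl; ring).
    generalize (2 * h + 1)%nat; intros n.
    assert (E := fsum_telescope INR n); rewrite (fsum_ext _ (fun _ => 1)) in E; [simpl in E; lra|].
    intros k; rewrite S_INR; ring.
  + intros j.
    set (k := (s / (2 * Z.of_nat h + 1))%Z).
    assert (Es : (s = (2 * Z.of_nat h + 1) * k)%Z) by (unfold k; generalize (Z_div_mod_eq_full s (2 * Z.of_nat h + 1)); lia).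
    rewrite Es, mult_IZR, <- EL.
    replace (2 * PI * IZR j * (odd_mod h * IZR k) / odd_mod h) with (0 + 2 * IZR (j * k) * PI)
      by (rewrite mult_IZR; field; lra).
    assert (Hz : forall z, cos (0 + 2 * IZR z * PI) = 1).
    { intros z; destruct (Z_le_gt_dec 0 z) as [Hz|Hz].
      - replace z with (Z.of_nat (Z.to_nat z)) by lia.
        rewrite <- INR_IZR_INZ, cos_period; apply cos_0.
      - replace z with (- Z.of_nat (Z.to_nat (- z)))%Z by lia.
        rewrite opp_IZR, <- INR_IZR_INZ.
        replace (0 + 2 * - INR (Z.to_nat (- z)) * PI) with (- (0 + 2 * INR (Z.to_nat (- z)) * PI)) by ring.
        rewrite cos_neg, cos_period; apply cos_0. }
    apply Hz.
- set (y := PI * IZR s / odd_mod h).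
  assert (Hs : sin y <> 0).
  { intros Hs; apply sin_eq_0_0 in Hs; destruct Hs as [k Hk].
    apply H; assert (IZR s = IZR (k * (2 * Z.of_nat h + 1))).
    { rewrite mult_IZR, <- EL; apply Rmult_eq_reg_l with PI; [|apply PI_neq0].
      unfold y in Hk; transitivity (PI * IZR s / odd_mod h * odd_mod h); [field; lra|].
      rewrite Hk; ring. }
    apply eq_IZR in H0; rewrite H0; apply Z_mod_mult. }
  apply Rmult_eq_reg_l with (2 * sin y); [|lra].
  rewrite Rmult_0_r, <- fsum_scal; unfold zrange; rewrite fsum_map.
  set (F := fun k : nat => sin ((2 * (INR k - INR h) - 1) * y)).
  rewrite (fsum_ext _ (fun k => F (S k) - F k)).
  + rewrite fsum_telescope; unfold F; rewrite plus_INR, mult_INR; simpl (INR 2); simpl (INR 1); simpl (INR 0).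
    replace ((2 * ((1 + 1) * INR h + 1 - INR h) - 1) * y) with (IZR s * PI)
      by (unfold y, odd_mod in *; field; lra).
    replace ((2 * (0 - INR h) - 1) * y) with (- (IZR s * PI))
      by (unfold y, odd_mod in *; field; lra).
    rewrite sin_neg, (sin_eq_0_1 _ (ex_intro _ s eq_refl)); ring.
  + intros k; unfold F; rewrite S_INR, minus_IZR, <- !INR_IZR_INZ.
    replace ((2 * (INR k + 1 - INR h) - 1) * y) with (2 * (INR k - INR h) * y + y) by ring.
    replace ((2 * (INR k - INR h) - 1) * y) with (2 * (INR k - INR h) * y - y) by ring.
    replace (2 * PI * (INR k - INR h) * IZR s / odd_mod h) with (2 * (INR k - INR h) * y)
      by (unfold y; field; lra).
    rewrite sin_plus, sin_minus; ring.
Qed.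

(** Aliasing: counting walks on a cycle by unrolling it onto the line, or by its characters. At m =
    0 this is orthogonality; each further step multiplies by (2 cos y)^2 = 2 + 2 cos 2y, which is
    the recursion of [kern]. *)
Lemma hsum_kern (h m : nat) (s : Z) :
  hsum (fun k => odd_mod h * kern m (s + k * (2 * Z.of_nat h + 1)))
    (fsum (fun j => (2 * cos (PI * IZR j / odd_mod h)) ^ (2 * m)
        * cos (2 * PI * IZR j * IZR s / odd_mod h)) (zrange h)).
Proof.
assert (Hl : 0 < odd_mod h) by (unfold odd_mod; generalize (pos_INR h); lra).
revert s; induction m as [|m IH]; intros s.
- rewrite (fsum_ext _ (fun j => cos (2 * PI * IZR j * IZR s / odd_mod h))).
    2:{ intros j; simpl; ring. }
  rewrite sum_cos_range.
  set (L := (2 * Z.of_nat h + 1)%Z).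
  assert (HL : (0 < L)%Z) by lia.
  set (f := fun k => odd_mod h * kern 0 (s + k * L)).
  assert (Hf : forall i, 0 <= f i).
  { intros i; apply Rmult_le_pos; [lra|apply kern_ge0]. }
  destruct Z.eq_dec as [H|H].
  + replace (odd_mod h) with (fsum f ((- (s / L))%Z :: nil)).
    * apply hsum_finite; trivial.
        repeat constructor; intros [].
      intros k Hk; unfold f; simpl; destruct Z.eq_dec as [E|E]; [|ring].
      exfalso; apply Hk; left.
      assert (Hd := Z_div_mod_eq_full s L); nia.
    * unfold f; simpl; destruct Z.eq_dec as [E|E]; [ring|].
      exfalso; apply E; assert (Hd := Z_div_mod_eq_full s L); lia.
  + change 0 with (fsum f nil); apply hsum_finite; trivial; [constructor|].
    intros k _; unfold f; simpl; destruct Z.eq_dec as [E|E]; [|ring].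
    exfalso; apply H; replace s with ((- k) * L)%Z by lia; apply Z_mod_mult.
- assert (H := hsum_plus _ _ _ _ (hsum_plus _ _ _ _ (IH (s - 1)%Z)
      (hsum_scal _ _ 2 ltac:(lra) (IH s))) (IH (s + 1)%Z)).
  rewrite <- fsum_scal, <- !fsum_plus in H.
  match goal with |- hsum _ ?a => match type of H with hsum ?f ?b =>
    replace a with b; [apply hsum_ext with f; [|exact H]|] end end.
  + intros k; cbn [kern].
    replace (s + k * (2 * Z.of_nat h + 1) - 1)%Z with (s - 1 + k * (2 * Z.of_nat h + 1))%Z by ring.
    replace (s + k * (2 * Z.of_nat h + 1) + 1)%Z with (s + 1 + k * (2 * Z.of_nat h + 1))%Z by ring.
    ring.
  + apply fsum_ext; intros j.
    replace (2 * S m)%nat with (S (S (2 * m))) by lia; simpl.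
    rewrite minus_IZR, plus_IZR.
    set (y := PI * IZR j / odd_mod h).
    replace (2 * PI * IZR j * (IZR s - 1) / odd_mod h) with (2 * IZR s * y - 2 * y)
      by (unfold y; field; lra).
    replace (2 * PI * IZR j * (IZR s + 1) / odd_mod h) with (2 * IZR s * y + 2 * y)
      by (unfold y; field; lra).
    replace (2 * PI * IZR j * IZR s / odd_mod h) with (2 * IZR s * y)
      by (unfold y; field; lra).
    rewrite cos_minus, cos_plus, (cos_2a_cos y); simpl; ring.
Qed.

Lemma exp_opp_div_le y : y < 1 -> exp (- (y / (1 - y))) <= 1 - y.
Proof.
intros Hy; rewrite exp_Ropp.
apply Rle_trans with (/ (1 + y / (1 - y))); [|right; field; lra].
apply Rinv_le_contravar; [|apply exp_ineq1_le].
replace (1 + y / (1 - y)) with (/ (1 - y)) by (field; lra).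
apply Rinv_0_lt_compat; lra.
Qed.

Lemma one_minus_le_exp y : 1 - y <= exp (- y).
Proof. generalize (exp_ineq1_le (- y)); lra. Qed.

(** Each ratio from [kern_step] is at most exp (- (2i + 1) / (m + R)), and the odd numbers add up to
    r^2. Freezing the denominator at [R] is what lets the exponents be added. *)
Lemma kern_upper m R r : (r <= R)%nat -> (R <= m)%nat -> (0 < m)%nat ->
  kern m (Z.of_nat r) <= kern m 0 * exp (- (INR r ^ 2 / (INR m + INR R))).
Proof.
intros Hr HR Hm; apply le_INR in HR; apply lt_INR in Hm; simpl (INR 0) in Hm.
induction r as [|r IH].
  simpl (INR 0); replace (- (0 ^ 2 / (INR m + INR R))) with 0
    by (field; generalize (pos_INR R); lra).
  rewrite exp_0; simpl; lra.
assert (Hr' := pos_INR r); apply le_INR in Hr; rewrite S_INR in Hr.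
specialize (IH ltac:(apply INR_le; lra)).
assert (H := kern_step m (Z.of_nat r)); rewrite <- INR_IZR_INZ in H.
replace (Z.of_nat (S r)) with (Z.of_nat r + 1)%Z by lia; rewrite S_INR.
replace (kern m (Z.of_nat r + 1)) with
  (kern m (Z.of_nat r) * (1 - (2 * INR r + 1) / (INR m + INR r + 1))).
2:{ apply Rmult_eq_reg_l with (INR m + INR r + 1); [|lra]; rewrite H; field; lra. }
replace (- ((INR r + 1) ^ 2 / (INR m + INR R))) with
  (- (INR r ^ 2 / (INR m + INR R)) + - ((2 * INR r + 1) / (INR m + INR R))) by (field; lra).
rewrite exp_plus, <- Rmult_assoc.
apply Rmult_le_compat; trivial.
- apply kern_ge0.
- replace (1 - (2 * INR r + 1) / (INR m + INR r + 1)) with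
    ((INR m - INR r) / (INR m + INR r + 1)) by (field; lra).
  apply Rdiv_le_0_compat; lra.
- eapply Rle_trans; [apply one_minus_le_exp|]; apply exp_le, Ropp_le_contravar.
  apply Rmult_le_compat_l; [lra|]; apply Rinv_le_contravar; lra.
Qed.

Lemma kern_lower m R r : (r <= R)%nat -> (R < m)%nat ->
  kern m 0 * exp (- (INR r ^ 2 / (INR m - INR R))) <= kern m (Z.of_nat r).
Proof.
intros Hr HR; apply lt_INR in HR.
induction r as [|r IH].
  simpl (INR 0); replace (- (0 ^ 2 / (INR m - INR R))) with 0 by (field; lra).
  rewrite exp_0; simpl; lra.
assert (Hr' := pos_INR r); apply le_INR in Hr; rewrite S_INR in Hr.
specialize (IH ltac:(apply INR_le; lra)).
assert (H := kern_step m (Z.of_nat r)); rewrite <- INR_IZR_INZ in H.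
replace (Z.of_nat (S r)) with (Z.of_nat r + 1)%Z by lia; rewrite S_INR.
replace (kern m (Z.of_nat r + 1)) with
  (kern m (Z.of_nat r) * / (1 + (2 * INR r + 1) / (INR m - INR r))).
2:{ apply Rmult_eq_reg_l with (INR m + INR r + 1); [|lra]; rewrite H; field; lra. }
replace (- ((INR r + 1) ^ 2 / (INR m - INR R))) with
  (- (INR r ^ 2 / (INR m - INR R)) + - ((2 * INR r + 1) / (INR m - INR R))) by (field; lra).
rewrite exp_plus, <- Rmult_assoc.
assert (Hy : 0 <= (2 * INR r + 1) / (INR m - INR r)) by (apply Rdiv_le_0_compat; lra).
apply Rmult_le_compat; trivial.
- apply Rmult_le_pos; [apply kern_ge0|left; apply exp_pos].
- left; apply exp_pos.
- rewrite exp_Ropp; apply Rinv_le_contravar; [lra|].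
  apply Rle_trans with (1 + (2 * INR r + 1) / (INR m - INR R)); [|apply exp_ineq1_le].
  apply Rplus_le_compat_l, Rmult_le_compat_l; [lra|]; apply Rinv_le_contravar; lra.
Qed.

Lemma kern_zero m r : (m < r)%nat -> kern m (Z.of_nat r) = 0.
Proof.
induction r as [|r IH]; [lia|]; intros Hr.
assert (H := kern_step m (Z.of_nat r)); rewrite <- INR_IZR_INZ in H.
replace (Z.of_nat r + 1)%Z with (Z.of_nat (S r)) in H by lia.
assert (H0 : (INR m - INR r) * kern m (Z.of_nat r) = 0).
{ destruct (Nat.eq_dec m r) as [->|Hn]; [ring|rewrite IH by lia; ring]. }
rewrite H0 in H; apply Rmult_integral in H; destruct H as [H|H]; trivial.
generalize (pos_INR m) (pos_INR r); lra.
Qed.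

Lemma kern_bound m r : (0 < m)%nat ->
  kern m (Z.of_nat r) <= kern m 0 * exp (- (INR r ^ 2 / (2 * INR m))).
Proof.
intros Hm; destruct (le_lt_dec r m) as [Hr|Hr].
- replace (2 * INR m) with (INR m + INR m) by ring; now apply kern_upper.
- rewrite kern_zero by easy; apply Rmult_le_pos; left; [apply kern_0_pos|apply exp_pos].
Qed.

Lemma cos_taylor t : - PI / 2 <= t <= PI / 2 ->
  1 - t ^ 2 / 2 <= cos t <= 1 - t ^ 2 / 2 + t ^ 4 / 24.
Proof.
intros [H1 H2]; assert (H := cos_bound t 0 H1 H2).
unfold cos_approx, cos_term in H; simpl in H; simpl; lra.
Qed.

(** Half the true exponent, but valid on the whole window: it supplies the dominating family, while
    [cos_pow_approx] gives the limit of each term. *)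
Lemma cos_pow_bound t n : - PI / 2 <= t <= PI / 2 ->
  0 <= cos t ^ (2 * n) <= exp (- (INR n * t ^ 2 / 2)).
Proof.
intros Ht; assert (H := cos_taylor t Ht).
assert (H0 : 0 <= cos t) by (apply cos_ge_0; lra).
split; [now apply pow_le|].
assert (cos t <= exp (- (t ^ 2 / 4))).
{ apply Rle_trans with (1 - t ^ 2 / 4); [|apply one_minus_le_exp].
  assert (PI <= 4) by apply PI_4.
  assert (t ^ 2 <= 4) by nra; nra. }
replace (exp (- (INR n * t ^ 2 / 2))) with (exp (- (t ^ 2 / 4)) ^ (2 * n)).
  apply pow_incr; lra.
rewrite exp_pow, mult_INR; f_equal; simpl; field.
Qed.

Lemma cos_pow_approx t n : -1 <= t <= 1 ->
  exp (- (INR n * t ^ 2 / (1 - t ^ 2 / 2))) <= cos t ^ (2 * n)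
  <= exp (- (INR n * t ^ 2 * (1 - t ^ 2 / 12))).
Proof.
intros Ht.
assert (Hpi : 2 <= PI) by (generalize PI2_1; lra).
assert (H := cos_taylor t ltac:(lra)).
assert (H0 : 0 <= cos t) by (apply cos_ge_0; lra).
assert (Hn := pos_INR n).
split.
- replace (exp (- (INR n * t ^ 2 / (1 - t ^ 2 / 2)))) with
   (exp (- (t ^ 2 / 2 / (1 - t ^ 2 / 2))) ^ (2 * n)).
  2:{ rewrite exp_pow, mult_INR; f_equal; simpl; field; nra. }
  apply pow_incr; split; [left; apply exp_pos|].
  eapply Rle_trans; [apply exp_opp_div_le; nra|lra].
- replace (exp (- (INR n * t ^ 2 * (1 - t ^ 2 / 12)))) with
   (exp (- (t ^ 2 / 2 - t ^ 4 / 24)) ^ (2 * n)).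
  2:{ rewrite exp_pow, mult_INR; f_equal; simpl; field. }
  apply pow_incr; split; [easy|].
  eapply Rle_trans; [|apply one_minus_le_exp]; lra.
Qed.

Lemma is_lim_seq_exp (u : nat -> R) (l : R) :
  is_lim_seq u l -> is_lim_seq (fun n => exp (u n)) (exp l).
Proof.
apply is_lim_seq_continuous, derivable_continuous_pt, derivable_pt_exp.
Qed.

Lemma is_lim_seq_eventually_gt (u : nat -> R) (l a : R) :
  is_lim_seq u l -> a < l -> eventually (fun n => a < u n).
Proof.
intros Hu Ha; apply is_lim_seq_spec in Hu.
destruct (Hu (mkposreal (l - a) ltac:(lra))) as [N HN]; simpl in HN.
exists N; intros n Hn; specialize (HN n Hn); apply Rabs_def2 in HN; lra.
Qed.

Lemma is_lim_seq_eventually_lt (u : nat -> R) (l a : R) :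
  is_lim_seq u l -> l < a -> eventually (fun n => u n < a).
Proof.
intros Hu Ha; apply is_lim_seq_spec in Hu.
destruct (Hu (mkposreal (a - l) ltac:(lra))) as [N HN]; simpl in HN.
exists N; intros n Hn; specialize (HN n Hn); apply Rabs_def2 in HN; lra.
Qed.

Lemma is_lim_seq_inv_sqrt : is_lim_seq (fun n => / sqrt (INR n)) 0.
Proof.
replace (Finite 0) with (Rbar_inv p_infty) by reflexivity.
apply is_lim_seq_inv; [|discriminate].
eapply filterlim_comp; [apply is_lim_seq_INR|apply filterlim_sqrt_p].
Qed.

(** A cycle length proportional to the square root of the number of steps is the scale on which both
    sides of [hsum_kern] converge to Gaussian sums. *)
Lemma exists_window c : 0 < c -> exists h : nat -> nat,
  is_lim_seq (fun n => odd_mod (h n) / sqrt (INR n)) (/ sqrt c).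
Proof.
intros Hc.
assert (Hpos : forall n, 0 <= sqrt (INR n) / sqrt c / 2).
{ intros n; repeat apply Rdiv_le_0_compat; try lra; [apply sqrt_pos|now apply sqrt_lt_R0]. }
exists (fun n => proj1_sig (nfloor_ex _ (Hpos n))).
assert (Hsc := sqrt_lt_R0 c Hc).
apply is_lim_seq_le_le_loc with (fun n => / sqrt c - / sqrt (INR n))
  (fun n => / sqrt c + / sqrt (INR n)).
- exists 1%nat; intros n Hn.
  destruct (nfloor_ex _ (Hpos n)) as (k & H1 & H2); simpl; unfold odd_mod.
  assert (Hs : 0 < sqrt (INR n)) by (apply sqrt_lt_R0; apply le_INR in Hn; simpl in Hn; lra).
  set (s := sqrt (INR n)) in *.
  assert (E1 : (/ sqrt c - / s) = (s / sqrt c - 1) / s) by (field; lra).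
  assert (E2 : (/ sqrt c + / s) = (s / sqrt c + 1) / s) by (field; lra).
  rewrite E1, E2; split; apply Rmult_le_compat_r;
    try (left; now apply Rinv_0_lt_compat); lra.
- replace (Finite (/ sqrt c)) with (Finite (/ sqrt c - 0)) by (f_equal; ring).
  apply is_lim_seq_minus'; [apply is_lim_seq_const|apply is_lim_seq_inv_sqrt].
- replace (Finite (/ sqrt c)) with (Finite (/ sqrt c + 0)) by (f_equal; ring).
  apply is_lim_seq_plus'; [apply is_lim_seq_const|apply is_lim_seq_inv_sqrt].
Qed.

Lemma is_lim_seq_opp' (u : nat -> R) (l : R) :
  is_lim_seq u l -> is_lim_seq (fun n => - u n) (- l).
Proof. exact (proj1 (is_lim_seq_opp u l)). Qed.

Section Window.

Variables (c : R) (h : nat -> nat).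
Hypothesis (Hc : 0 < c).
Let l n := odd_mod (h n).
Hypothesis (Hh : is_lim_seq (fun n => l n / sqrt (INR n)) (/ sqrt c)).

Lemma window_pos n : 1 <= l n.
Proof. unfold l, odd_mod; generalize (pos_INR (h n)); lra. Qed.

Lemma window_sqr : is_lim_seq (fun n => INR n / l n ^ 2) c.
Proof.
assert (Hsc := sqrt_lt_R0 c Hc).
assert (H := is_lim_seq_mult' _ _ _ _ Hh Hh).
apply is_lim_seq_inv in H; [|intros E; injection E; apply Rgt_not_eq; apply Rmult_lt_0_compat; now apply Rinv_0_lt_compat].
replace (Rbar_inv (/ sqrt c * / sqrt c)) with (Finite c) in H.
2:{ simpl; f_equal; rewrite <- Rinv_mult, sqrt_sqrt by lra; field; lra. }
apply is_lim_seq_ext_loc with (2 := H); exists 1%nat; intros n Hn.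
assert (0 < INR n) by (apply le_INR in Hn; simpl in Hn; lra).
assert (Hs := sqrt_lt_R0 _ H0); assert (Hl := window_pos n).
rewrite <- (sqrt_sqrt (INR n)) at 3 by lra.
field; lra.
Qed.

Lemma window_inv : is_lim_seq (fun n => / l n) 0.
Proof.
assert (Hsc := sqrt_lt_R0 c Hc).
assert (H := Hh); apply is_lim_seq_inv in H.
2:{ intros E; injection E; apply Rgt_not_eq; now apply Rinv_0_lt_compat. }
simpl in H; rewrite Rinv_inv in H.
assert (H' := is_lim_seq_mult' _ _ _ _ H is_lim_seq_inv_sqrt).
rewrite Rmult_0_r in H'.
apply is_lim_seq_ext_loc with (2 := H'); exists 1%nat; intros n Hn.
assert (0 < INR n) by (apply le_INR in Hn; simpl in Hn; lra).
assert (Hs := sqrt_lt_R0 _ H0); assert (Hl := window_pos n).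
field; lra.
Qed.

Lemma cos_window_lim j :
  is_lim_seq (fun n => cos (PI * IZR j / l n) ^ (2 * n)) (gauss (PI ^ 2 * c) 0 j).
Proof.
set (t := fun n => PI * IZR j / l n).
assert (Ht : is_lim_seq t 0).
{ replace 0 with (PI * IZR j * 0) by ring.
  apply is_lim_seq_mult'; [apply is_lim_seq_const|apply window_inv]. }
assert (Ht2 : is_lim_seq (fun n => t n ^ 2) 0).
{ replace 0 with (0 * (0 * 1)) by ring.
  apply is_lim_seq_mult'; trivial; apply is_lim_seq_mult'; trivial; apply is_lim_seq_const. }
assert (HN : is_lim_seq (fun n => INR n * t n ^ 2) (PI ^ 2 * c * IZR j ^ 2)).
{ apply is_lim_seq_ext with (fun n => PI ^ 2 * IZR j ^ 2 * (INR n / l n ^ 2)).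
    intros n; unfold t; assert (Hl := window_pos n); field; lra.
  replace (PI ^ 2 * c * IZR j ^ 2) with (PI ^ 2 * IZR j ^ 2 * c) by ring.
  apply is_lim_seq_mult'; [apply is_lim_seq_const|apply window_sqr]. }
assert (HL : - (PI ^ 2 * c) * (IZR j + 0) ^ 2 = - (PI ^ 2 * c * IZR j ^ 2)) by ring.
unfold gauss; rewrite HL.
apply is_lim_seq_le_le_loc with (fun n => exp (- (INR n * t n ^ 2 / (1 - t n ^ 2 / 2))))
  (fun n => exp (- (INR n * t n ^ 2 * (1 - t n ^ 2 / 12)))).
- destruct (is_lim_seq_eventually_gt t 0 (-1) Ht ltac:(lra)) as [N1 H1].
  destruct (is_lim_seq_eventually_lt t 0 1 Ht ltac:(lra)) as [N2 H2].
  exists (N1 + N2)%nat; intros n Hn; apply cos_pow_approx.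
  generalize (H1 n ltac:(lia)) (H2 n ltac:(lia)); lra.
- apply is_lim_seq_exp, is_lim_seq_opp'.
  replace (PI ^ 2 * c * IZR j ^ 2) with (PI ^ 2 * c * IZR j ^ 2 / (1 - 0 / 2)) by field.
  apply is_lim_seq_div'; [exact HN| |lra].
  apply is_lim_seq_minus'; [apply is_lim_seq_const|].
  apply is_lim_seq_div'; [exact Ht2|apply is_lim_seq_const|lra].
- apply is_lim_seq_exp, is_lim_seq_opp'.
  replace (PI ^ 2 * c * IZR j ^ 2) with (PI ^ 2 * c * IZR j ^ 2 * (1 - 0 / 12)) by field.
  apply is_lim_seq_mult'; [exact HN|].
  apply is_lim_seq_minus'; [apply is_lim_seq_const|].
  apply is_lim_seq_div'; [exact Ht2|apply is_lim_seq_const|lra].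
Qed.

Lemma cos_sum_lim :
  is_lim_seq (fun n => fsum (fun j => cos (PI * IZR j / l n) ^ (2 * n)) (zrange (h n)))
    (gs (PI ^ 2 * c) 0).
Proof.
assert (HP : 0 < PI ^ 2) by (generalize PI_RGT_0; nra).
assert (HPc : 0 < PI ^ 2 * c) by nra.
(* Extension by 0 outside the growing window gives all n the common index set [Z]. *)
set (F := fun n j => if in_dec Z.eq_dec j (zrange (h n)) then cos (PI * IZR j / l n) ^ (2 * n) else 0).
assert (HF0 : forall n j, 0 <= F n j).
{ intros n j; unfold F; destruct in_dec; [|lra].
  rewrite pow_mult; apply pow_le; simpl; nra. }
(* The divisor 4 in the dominating exponent collects a factor 1/2 from [cos_pow_bound] and another
   from n / l^2 > c / 2, which holds eventually. *)
apply tannery with F (gauss (PI ^ 2 * c) 0) (gauss (PI ^ 2 * c / 4) 0) (gs (PI ^ 2 * c / 4) 0).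
- intros n.
  replace (fsum (fun j => cos (PI * IZR j / l n) ^ (2 * n)) (zrange (h n)))
    with (fsum (F n) (zrange (h n))).
  + apply hsum_finite; [apply HF0|apply NoDup_zrange|].
    intros j Hj; unfold F; now destruct in_dec.
  + assert (E : forall L, incl L (zrange (h n)) ->
      fsum (F n) L = fsum (fun j => cos (PI * IZR j / l n) ^ (2 * n)) L); [|now apply E].
    induction L as [|j L IH]; intros HL; simpl; trivial.
    rewrite IH by (intros k Hk; apply HL; now right); f_equal.
    unfold F; destruct in_dec as [|Hj]; trivial; exfalso; apply Hj, HL; now left.
- apply hsum_gauss; lra.
- apply hsum_gauss; lra.
- destruct (is_lim_seq_eventually_gt _ c (c / 2) window_sqr ltac:(lra)) as [N HN].
  exists N; intros n Hn j; specialize (HN n Hn); unfold F.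
  destruct in_dec as [Hj|Hj]; [|left; apply gauss_pos].
  apply In_zrange in Hj; assert (Hl := window_pos n).
  destruct Hj as [Hj1 Hj2]; apply IZR_le in Hj1, Hj2.
  rewrite opp_IZR, <- INR_IZR_INZ in Hj1; rewrite <- INR_IZR_INZ in Hj2.
  assert (Hpi := PI_RGT_0).
  assert (Ht : - PI / 2 <= PI * IZR j / l n <= PI / 2).
  { assert (EL : l n = 2 * INR (h n) + 1) by reflexivity.
    split; apply Rmult_le_reg_r with (2 * l n); try lra.
    - replace (PI * IZR j / l n * (2 * l n)) with (PI * (2 * IZR j)) by (field; lra).
      replace (- PI / 2 * (2 * l n)) with (PI * (- l n)) by field.
      apply Rmult_le_compat_l; lra.
    - replace (PI * IZR j / l n * (2 * l n)) with (PI * (2 * IZR j)) by (field; lra).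
      replace (PI / 2 * (2 * l n)) with (PI * l n) by field.
      apply Rmult_le_compat_l; lra. }
  eapply Rle_trans; [apply cos_pow_bound; exact Ht|].
  unfold gauss; apply exp_le.
  replace (- (INR n * (PI * IZR j / l n) ^ 2 / 2)) with
    (- (PI ^ 2 * IZR j ^ 2 * (INR n / l n ^ 2 / 2))) by (field; lra).
  replace (- (PI ^ 2 * c / 4) * (IZR j + 0) ^ 2) with (- (PI ^ 2 * IZR j ^ 2 * (c / 4))) by field.
  apply Ropp_le_contravar, Rmult_le_compat_l; [|lra].
  assert (0 <= IZR j ^ 2) by nra; nra.
- intros j; apply is_lim_seq_ext_loc with (2 := cos_window_lim j).
  assert (Hi := window_inv).
  destruct (is_lim_seq_eventually_lt _ 0 (/ (2 * (IZR (Z.abs j) + 1))) Hi) as [N HN].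
    apply Rinv_0_lt_compat; generalize (IZR_le 0 (Z.abs j) ltac:(lia)); lra.
  exists N; intros n Hn; specialize (HN n Hn).
  unfold F; destruct in_dec as [|Hj]; trivial.
  exfalso; apply Hj, In_zrange.
  apply Rinv_lt_cancel in HN; [|generalize (window_pos n); lra].
  unfold l, odd_mod in HN.
  assert (IZR (Z.abs j) < IZR (Z.of_nat (h n))) by (rewrite <- INR_IZR_INZ; lra).
  apply lt_IZR in H; lia.
Qed.

Lemma window_nat n : odd_mod (h n) = INR (2 * h n + 1).
Proof. unfold odd_mod; rewrite plus_INR, mult_INR; simpl; ring. Qed.

Lemma kern_window_lim (k : nat) :
  is_lim_seq (fun n => kern n (Z.of_nat (k * (2 * h n + 1))) / kern n 0)
    (exp (- (INR k ^ 2 / c))).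
Proof.
set (r := fun n => (k * (2 * h n + 1))%nat).
assert (Hr : forall n, INR (r n) = INR k * l n).
{ intros n; unfold r, l; now rewrite mult_INR, window_nat. }
assert (H0 : is_lim_seq (fun n => INR k / l n) 0).
{ replace 0 with (INR k * 0) by ring.
  apply is_lim_seq_mult'; [apply is_lim_seq_const|apply window_inv]. }
assert (Hk : 0 <= INR k) by apply pos_INR.
assert (Hw := window_sqr).
assert (Hlt : eventually (fun n => INR (r n) < INR n)).
{ assert (H : is_lim_seq (fun n => INR n / l n ^ 2 - INR k / l n) (c - 0))
    by now apply is_lim_seq_minus'.
  destruct (is_lim_seq_eventually_gt _ _ 0 H ltac:(lra)) as [N HN].
  exists N; intros n Hn; specialize (HN n Hn); assert (Hl := window_pos n); rewrite Hr.
  replace (INR n / l n ^ 2 - INR k / l n) with ((INR n - INR k * l n) / l n ^ 2) in HN by (field; lra).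
  apply Rmult_lt_compat_r with (r := l n ^ 2) in HN; [|nra].
  replace ((INR n - INR k * l n) / l n ^ 2 * l n ^ 2) with (INR n - INR k * l n) in HN by (field; lra).
  lra. }
apply is_lim_seq_le_le_loc with
  (fun n => exp (- (INR k ^ 2 / (INR n / l n ^ 2 - INR k / l n))))
  (fun n => exp (- (INR k ^ 2 / (INR n / l n ^ 2 + INR k / l n)))).
- destruct Hlt as [N HN]; exists N; intros n Hn; specialize (HN n Hn).
  assert (HK := kern_0_pos n); assert (Hl := window_pos n).
  assert (Hrn : (r n < n)%nat) by now apply INR_lt.
  assert (Hlow := kern_lower n (r n) (r n) (le_n _) Hrn).
  assert (Hup := kern_upper n (r n) (r n) (le_n _) ltac:(lia) ltac:(lia)).
  rewrite Hr in Hlow, Hup, HN; fold (r n).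
  assert (HkL : 0 <= INR k * l n) by (apply Rmult_le_pos; lra).
  replace ((INR k * l n) ^ 2 / (INR n - INR k * l n)) with
    (INR k ^ 2 / (INR n / l n ^ 2 - INR k / l n)) in Hlow.
  2:{ field; repeat split; lra. }
  replace ((INR k * l n) ^ 2 / (INR n + INR k * l n)) with
    (INR k ^ 2 / (INR n / l n ^ 2 + INR k / l n)) in Hup.
  2:{ field; repeat split; lra. }
  assert (E : kern n (Z.of_nat (r n)) / kern n 0 * kern n 0 = kern n (Z.of_nat (r n)))
    by (field; lra).
  split; apply Rmult_le_reg_r with (kern n 0); trivial; rewrite E; lra.
- apply is_lim_seq_exp, is_lim_seq_opp'.
  replace (INR k ^ 2 / c) with (INR k ^ 2 / (c - 0)) by (f_equal; ring).
  apply is_lim_seq_div'; [apply is_lim_seq_const| |lra].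
  now apply is_lim_seq_minus'.
- apply is_lim_seq_exp, is_lim_seq_opp'.
  replace (INR k ^ 2 / c) with (INR k ^ 2 / (c + 0)) by (f_equal; ring).
  apply is_lim_seq_div'; [apply is_lim_seq_const| |lra].
  now apply is_lim_seq_plus'.
Qed.

Lemma kern_abs m j : kern m j = kern m (Z.of_nat (Z.abs_nat j)).
Proof.
destruct (Z_le_gt_dec 0 j) as [Hj|Hj].
- f_equal; lia.
- rewrite <- kern_opp; f_equal; lia.
Qed.

(** The cosine sum of [cos_sum_lim] again, now read through [hsum_kern] as a sum of binomial
    coefficients spaced by the window length; these decay like a Gaussian with exponent 1/c. *)
Lemma kern_sum_lim :
  is_lim_seq (fun n => fsum (fun j => cos (PI * IZR j / l n) ^ (2 * n)) (zrange (h n))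
     * 4 ^ n / (l n * kern n 0)) (gs (/ c) 0).
Proof.
assert (Hci := Rinv_0_lt_compat c Hc).
apply tannery with (fun n k => kern n (k * (2 * Z.of_nat (h n) + 1)) / kern n 0)
  (gauss (/ c) 0) (gauss (/ c / 4) 0) (gs (/ c / 4) 0).
- intros n; assert (Hl := window_pos n); assert (HK := kern_0_pos n).
  assert (H := hsum_scal _ _ (/ (l n * kern n 0))
    ltac:(left; apply Rinv_0_lt_compat; nra) (hsum_kern (h n) n 0)).
  match goal with |- hsum _ ?a => match type of H with hsum ?f ?b =>
    replace a with b; [apply hsum_ext with f; [|exact H]|] end end.
  + intros k; fold (l n); rewrite Z.add_0_l; field; lra.
  + rewrite (fsum_ext _ (fun j => 4 ^ n * cos (PI * IZR j / l n) ^ (2 * n))).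
    * rewrite fsum_scal; field; lra.
    * intros j; fold (l n).
      replace (2 * PI * IZR j * 0 / l n) with 0 by (field; lra).
      rewrite cos_0, Rpow_mult_distr, (pow_mult 2 2); replace (2 ^ 2) with 4 by ring; ring.
- apply hsum_gauss; lra.
- apply hsum_gauss; lra.
- destruct (is_lim_seq_eventually_lt _ c (2 * c) window_sqr ltac:(lra)) as [N HN].
  exists (S N); intros n Hn k; specialize (HN n ltac:(lia)).
  assert (Hl := window_pos n); assert (HK := kern_0_pos n).
  rewrite kern_abs; set (r := Z.abs_nat _).
  assert (Hr : INR r ^ 2 = IZR k ^ 2 * l n ^ 2).
  { unfold r; rewrite INR_IZR_INZ, Nat2Z.inj_abs_nat, <- !Rsqr_pow2, abs_IZR, <- Rsqr_abs, mult_IZR.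
    unfold l, odd_mod; rewrite plus_IZR, mult_IZR, <- INR_IZR_INZ; unfold Rsqr; ring. }
  assert (Hn0 : 0 < INR n) by (apply lt_0_INR; lia).
  assert (Hb := kern_bound n r ltac:(lia)); rewrite Hr in Hb.
  apply Rmult_le_reg_r with (kern n 0); trivial.
  replace (kern n (Z.of_nat r) / kern n 0 * kern n 0) with (kern n (Z.of_nat r)) by (field; lra).
  eapply Rle_trans; [exact Hb|]; rewrite Rmult_comm; apply Rmult_le_compat_r; [lra|].
  unfold gauss; apply exp_le.
  replace (- (/ c / 4) * (IZR k + 0) ^ 2) with (- (IZR k ^ 2 * (/ (2 * c) / 2))) by (field; lra).
  replace (IZR k ^ 2 * l n ^ 2 / (2 * INR n)) with (IZR k ^ 2 * (/ (INR n / l n ^ 2) / 2))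
    by (field; lra).
  apply Ropp_le_contravar, Rmult_le_compat_l; [nra|].
  apply Rmult_le_compat_r; [lra|]; apply Rinv_le_contravar; [|lra].
  apply Rdiv_lt_0_compat; [lra|nra].
- intros k.
  replace (gauss (/ c) 0 k) with (exp (- (INR (Z.abs_nat k) ^ 2 / c))).
  + apply is_lim_seq_ext with (2 := kern_window_lim (Z.abs_nat k)); intros n.
    rewrite (kern_abs n (k * _)); do 3 f_equal; lia.
  + unfold gauss; f_equal.
    rewrite INR_IZR_INZ, Nat2Z.inj_abs_nat, <- !Rsqr_pow2, abs_IZR, <- Rsqr_abs.
    unfold Rsqr; field; lra.
Qed.

Lemma central_lim :
  is_lim_seq (fun n => sqrt (INR n) * kern n 0 / 4 ^ n)
    (sqrt c * gs (PI ^ 2 * c) 0 / gs (/ c) 0).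
Proof.
assert (Hci := Rinv_0_lt_compat c Hc); assert (Hsc := sqrt_lt_R0 c Hc).
assert (HP : 0 < PI ^ 2) by (generalize PI_RGT_0; nra).
assert (H1 := gs_pos (/ c) 0 Hci ltac:(lra)).
assert (H2 := gs_pos (PI ^ 2 * c) 0 ltac:(nra) ltac:(lra)).
assert (H := is_lim_seq_div' _ _ _ _ cos_sum_lim (is_lim_seq_mult' _ _ _ _ Hh kern_sum_lim)
   ltac:(apply Rgt_not_eq, Rmult_lt_0_compat; [now apply Rinv_0_lt_compat|lra])).
replace (sqrt c * gs (PI ^ 2 * c) 0 / gs (/ c) 0) with
  (gs (PI ^ 2 * c) 0 / (/ sqrt c * gs (/ c) 0)) by (field; lra).
apply is_lim_seq_ext_loc with (2 := H).
destruct (is_lim_seq_eventually_gt _ _ 0 cos_sum_lim H2) as [N HN].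
exists (S N); intros n Hn; specialize (HN n ltac:(lia)).
assert (Hl := window_pos n); assert (HK := kern_0_pos n).
assert (Hn0 : 0 < sqrt (INR n)) by (apply sqrt_lt_R0, lt_0_INR; lia).
field; repeat split; try lra.
apply pow_nonzero; lra.
Qed.

End Window.

(* Polya: as the central term does not depend on c, the ratio is determined by
   its value at the fixed point c = 1 / PI. *)
Lemma gs_inversion x : 0 < x -> gs x 0 = sqrt (PI / x) * gs (PI ^ 2 / x) 0.
Proof.
intros Hx; assert (HP := PI_RGT_0).
assert (Hc : 0 < x / PI ^ 2) by (apply Rdiv_lt_0_compat; nra).
assert (Hd : 0 < / PI) by now apply Rinv_0_lt_compat.
destruct (exists_window _ Hc) as [h Hh].
destruct (exists_window _ Hd) as [h' Hh'].
assert (H1 := central_lim _ _ Hc Hh); assert (H2 := central_lim _ _ Hd Hh').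
apply is_lim_seq_unique in H1, H2; rewrite H1 in H2; apply Rbar_finite_eq in H2; rename H2 into E.
replace (PI ^ 2 * (x / PI ^ 2)) with x in E by (field; lra).
replace (/ (x / PI ^ 2)) with (PI ^ 2 / x) in E by (field; lra).
replace (PI ^ 2 * / PI) with PI in E by (field; lra).
rewrite Rinv_inv in E.
assert (G1 := gs_pos PI 0 HP ltac:(lra)).
assert (G2 := gs_pos (PI ^ 2 / x) 0 ltac:(apply Rdiv_lt_0_compat; nra) ltac:(lra)).
replace (sqrt (/ PI) * gs PI 0 / gs PI 0) with (sqrt (/ PI)) in E by (field; lra).
assert (S1 := sqrt_lt_R0 _ Hc).
apply Rmult_eq_reg_l with (sqrt (x / PI ^ 2) / gs (PI ^ 2 / x) 0).
2:{ apply Rgt_not_eq, Rdiv_lt_0_compat; lra. }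
transitivity (sqrt (x / PI ^ 2) * sqrt (PI / x)); [|field; lra].
rewrite <- sqrt_mult_alt by lra.
replace (x / PI ^ 2 * (PI / x)) with (/ PI) by (field; lra).
rewrite <- E; field; lra.
Qed.

Lemma t4_eq x : 0 < x -> t4 x = 2 * gs (4 * x) 0 - gs x 0.
Proof. intros Hx; rewrite (gs_split x Hx); unfold t4; ring. Qed.

(** Inverting both terms of theta_4 = 2 theta_3(q^4) - theta_3(q) and splitting the second by parity
    leaves only theta_2. *)
Lemma t4_inversion x : 0 < x -> t4 x = sqrt (PI / x) * gs (PI ^ 2 / x) (1 / 2).
Proof.
intros Hx; assert (HP := PI_RGT_0).
assert (Hy : 0 < PI ^ 2 / (4 * x)) by (apply Rdiv_lt_0_compat; nra).
rewrite t4_eq, (gs_inversion x Hx), (gs_inversion (4 * x)) by lra.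
rewrite (gs_split _ Hy).
replace (4 * (PI ^ 2 / (4 * x))) with (PI ^ 2 / x) by (field; lra).
replace (PI / (4 * x)) with (/ 2 ^ 2 * (PI / x)) by (field; lra).
rewrite sqrt_mult_alt, sqrt_inv, sqrt_pow2 by lra.
field.
Qed.

(** The sign of the difference defining [t4] is not visible termwise; inversion turns it into a sum
    of positive terms. *)
Lemma t4_pos x : 0 < x -> 0 < t4 x.
Proof.
intros Hx; assert (HP := PI_RGT_0); rewrite t4_inversion by easy.
apply Rmult_lt_0_compat; [apply sqrt_lt_R0, Rdiv_lt_0_compat; lra|].
apply gs_pos; [apply Rdiv_lt_0_compat; nra|lra].
Qed.

Lemma gs_half_inversion x : 0 < x -> gs x (1 / 2) = sqrt (PI / x) * t4 (PI ^ 2 / x).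
Proof.
intros Hx; assert (HP := PI_RGT_0).
assert (Hy : 0 < PI ^ 2 / x) by (apply Rdiv_lt_0_compat; nra).
rewrite (t4_inversion _ Hy).
replace (PI ^ 2 / (PI ^ 2 / x)) with x by (field; lra).
replace (PI / (PI ^ 2 / x)) with (/ (PI / x)) by (field; lra).
rewrite sqrt_inv; field.
apply Rgt_not_eq, sqrt_lt_R0, Rdiv_lt_0_compat; lra.
Qed.

(** * The triple product and degree 5 *)

(* [jcoef y N n] is the coefficient of z^n in the product over k = 1..N of
   (1 + z q^(2k-1)) (1 + q^(2k-1) / z), for q = exp (- y). *)
Fixpoint jcoef (y : R) (N : nat) (n : Z) : R :=
  match N with
  | O => if Z.eq_dec n 0 then 1 else 0
  | S N => (1 + exp (- y * (2 * INR N + 1)) ^ 2) * jcoef y N n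
      + exp (- y * (2 * INR N + 1)) * (jcoef y N (n - 1) + jcoef y N (n + 1))
  end.

(* The same product at z = exp (- w). *)
Fixpoint jprod (y w : R) (N : nat) : R :=
  match N with
  | O => 1
  | S N => (1 + exp (- y * (2 * INR N + 1) - w)) * (1 + exp (- y * (2 * INR N + 1) + w))
      * jprod y w N
  end.

Lemma jcoef_ge0 y N n : 0 <= jcoef y N n.
Proof.
revert n; induction N as [|N IH]; intros n; cbn [jcoef].
  destruct Z.eq_dec; lra.
assert (H := exp_pos (- y * (2 * INR N + 1))).
apply Rplus_le_le_0_compat; apply Rmult_le_pos; auto.
- assert (H' := pow2_ge_0 (exp (- y * (2 * INR N + 1)))); lra.
- lra.
- now apply Rplus_le_le_0_compat.
Qed.

Lemma jcoef_0_pos y N : 0 < jcoef y N 0.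
Proof.
induction N as [|N IH]; cbn [jcoef]; [simpl; lra|].
assert (H := exp_pos (- y * (2 * INR N + 1))).
assert (H1 := jcoef_ge0 y N (0 - 1)); assert (H2 := jcoef_ge0 y N (0 + 1)).
apply Rplus_lt_le_0_compat; [apply Rmult_lt_0_compat|apply Rmult_le_pos]; nra.
Qed.

Lemma jcoef_opp y N n : jcoef y N (- n) = jcoef y N n.
Proof.
revert n; induction N as [|N IH]; intros n; cbn [jcoef].
  do 2 destruct Z.eq_dec; trivial; lia.
replace (- n - 1)%Z with (- (n + 1))%Z by lia.
replace (- n + 1)%Z with (- (n - 1))%Z by lia.
rewrite !IH; ring.
Qed.

(** The q-analogue of [kern_step]: [jcoef y N n] is q^(n^2) times the q^2-binomial coefficient of 2N
    over N + n, and this is the ratio of two neighbours with denominators cleared. *)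
Lemma jcoef_step y N n :
  jcoef y N (n + 1) * (1 - exp (- y * (2 * (INR N + IZR n + 1))))
  = exp (- y * (2 * IZR n + 1)) * (1 - exp (- y * (2 * (INR N - IZR n)))) * jcoef y N n.
Proof.
revert n; induction N as [|N IH]; intros n.
  simpl; destruct (Z.eq_dec (n + 1) 0) as [H|H]; destruct (Z.eq_dec n 0) as [H'|H']; try lia.
  - replace n with (-1)%Z by lia.
    replace (- y * (2 * (0 + -1 + 1))) with 0 by ring; rewrite exp_0; ring.
  - subst n; replace (- y * (2 * (0 - 0))) with 0 by ring; rewrite exp_0; ring.
  - ring.
(* With u = q^n and v = q^N all exponentials become monomials, and the induction step is an identity
   of rational functions in u, v and q. *)
set (u := exp (- y * IZR n)); set (v := exp (- y * INR N)); set (q := exp (- y)).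
assert (Hu : 0 < u) by apply exp_pos; assert (Hq : 0 < q) by apply exp_pos.
assert (Hi : exp (y * IZR n) = / u) by (unfold u; rewrite <- exp_Ropp; f_equal; ring).
assert (Hqi : exp y = / q) by (unfold q; rewrite <- exp_Ropp; f_equal; ring).
assert (H0 := IH (n - 1)%Z); assert (H1 := IH n); assert (H2 := IH (n + 1)%Z).
replace (n - 1 + 1)%Z with n in H0 by lia.
rewrite S_INR; cbn [jcoef].
replace (n + 1 - 1)%Z with n by lia.
rewrite minus_IZR in H0; rewrite plus_IZR in H2.
set (K0 := jcoef y N n) in *; set (K1 := jcoef y N (n + 1)) in *.
set (K2 := jcoef y N (n + 1 + 1)) in *; set (Km := jcoef y N (n - 1)) in *.
replace (exp (- y * (2 * (INR N + (IZR n - 1) + 1)))) with (v ^ 2 * u ^ 2) in H0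
  by (unfold u, v; rewrite !exp_pow, <- exp_plus; f_equal; simpl; ring).
replace (exp (- y * (2 * (IZR n - 1) + 1))) with (u ^ 2 * / q) in H0
  by (unfold u; rewrite exp_pow, <- Hqi, <- exp_plus; f_equal; simpl; ring).
replace (exp (- y * (2 * (INR N - (IZR n - 1))))) with (v ^ 2 * q ^ 2 * (/ u) ^ 2) in H0
  by (rewrite <- Hi; unfold v, q; rewrite !exp_pow, <- !exp_plus; f_equal; simpl; ring).
replace (exp (- y * (2 * (INR N + IZR n + 1)))) with (v ^ 2 * u ^ 2 * q ^ 2) in H1
  by (unfold u, v, q; rewrite !exp_pow, <- !exp_plus; f_equal; simpl; ring).
replace (exp (- y * (2 * IZR n + 1))) with (u ^ 2 * q) in *
  by (unfold u, q; rewrite exp_pow, <- exp_plus; f_equal; simpl; ring).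
replace (exp (- y * (2 * (INR N - IZR n)))) with (v ^ 2 * (/ u) ^ 2) in H1
  by (rewrite <- Hi; unfold v; rewrite !exp_pow, <- !exp_plus; f_equal; simpl; ring).
replace (exp (- y * (2 * (INR N + (IZR n + 1) + 1)))) with (v ^ 2 * u ^ 2 * q ^ 4) in H2
  by (unfold u, v, q; rewrite !exp_pow, <- !exp_plus; f_equal; simpl; ring).
replace (exp (- y * (2 * (IZR n + 1) + 1))) with (u ^ 2 * q ^ 3) in H2
  by (unfold u, q; rewrite !exp_pow, <- exp_plus; f_equal; simpl; ring).
replace (exp (- y * (2 * (INR N - (IZR n + 1))))) with (v ^ 2 * (/ q) ^ 2 * (/ u) ^ 2) in H2
  by (rewrite <- Hi, <- Hqi; unfold v; rewrite !exp_pow, <- !exp_plus; f_equal; simpl; ring).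
replace (exp (- y * (2 * (INR N + 1 + IZR n + 1)))) with (v ^ 2 * u ^ 2 * q ^ 4)
  by (unfold u, v, q; rewrite !exp_pow, <- !exp_plus; f_equal; simpl; ring).
replace (exp (- y * (2 * (INR N + 1 - IZR n)))) with (v ^ 2 * q ^ 2 * (/ u) ^ 2)
  by (rewrite <- Hi; unfold v, q; rewrite !exp_pow, <- !exp_plus; f_equal; simpl; ring).
replace (exp (- y * (2 * INR N + 1))) with (v ^ 2 * q)
  by (unfold v, q; rewrite exp_pow, <- exp_plus; f_equal; simpl; ring).
replace (u ^ 2 * / q * (1 - v ^ 2 * q ^ 2 * (/ u) ^ 2) * Km) with
  ((u ^ 2 - v ^ 2 * q ^ 2) / q * Km) in H0 by (field; lra).
replace (u ^ 2 * q * (1 - v ^ 2 * (/ u) ^ 2) * K0) with (q * (u ^ 2 - v ^ 2) * K0) in H1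
  by (field; lra).
replace (u ^ 2 * q ^ 3 * (1 - v ^ 2 * (/ q) ^ 2 * (/ u) ^ 2) * K1) with
  (q * (u ^ 2 * q ^ 2 - v ^ 2) * K1) in H2 by (field; lra).
replace (u ^ 2 * q * (1 - v ^ 2 * q ^ 2 * (/ u) ^ 2)) with
  (q * (u ^ 2 - v ^ 2 * q ^ 2)) by (field; lra).
assert (H0' : (u ^ 2 - v ^ 2 * q ^ 2) * Km = q * (K0 * (1 - v ^ 2 * u ^ 2)))
  by (rewrite H0; field; lra).
transitivity ((1 - v ^ 2 * u ^ 2 * q ^ 4) * ((1 + (v ^ 2 * q) ^ 2) * K1 + v ^ 2 * q * K0)
   + v ^ 2 * q * (K2 * (1 - v ^ 2 * u ^ 2 * q ^ 4))); [ring|].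
rewrite H2.
transitivity (q * (u ^ 2 - v ^ 2 * q ^ 2) * ((1 + (v ^ 2 * q) ^ 2) * K0 + v ^ 2 * q * K1)
   + v ^ 2 * q * q * ((u ^ 2 - v ^ 2 * q ^ 2) * Km)); [|ring].
rewrite H0'.
enough (E' : (1 + v ^ 4 * q ^ 4) * (K1 * (1 - v ^ 2 * u ^ 2 * q ^ 2))
   = (1 + v ^ 4 * q ^ 4) * (q * (u ^ 2 - v ^ 2) * K0)) by (clear -E'; lra).
now rewrite H1.
Qed.

Lemma exp_lt_1 x : x < 0 -> exp x < 1.
Proof. intros Hx; rewrite <- exp_0; now apply exp_increasing. Qed.

(** Every step ratio is at most q^(2n+1), and the odd exponents add up to a square. The bound is
    also the limit for large N, so the limit family dominates its own approximations. *)
Lemma jcoef_bound y N (n : nat) : 0 < y ->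
  jcoef y N (Z.of_nat n) <= jcoef y N 0 * exp (- y * INR n ^ 2).
Proof.
intros Hy; induction n as [|n IH].
  simpl (INR 0); replace (- y * 0 ^ 2) with 0 by ring; rewrite exp_0; simpl; lra.
assert (Hn := pos_INR n); assert (HN := pos_INR N).
replace (Z.of_nat (S n)) with (Z.of_nat n + 1)%Z by lia.
assert (H := jcoef_step y N (Z.of_nat n)); rewrite <- INR_IZR_INZ in H.
set (e1 := exp (- y * (2 * (INR N + INR n + 1)))) in H.
set (e2 := exp (- y * (2 * (INR N - INR n)))) in H.
assert (Hyn : 0 <= y * INR n) by (apply Rmult_le_pos; lra).
assert (HyN : 0 <= y * INR N) by (apply Rmult_le_pos; lra).
assert (H1 : e1 < 1) by (apply exp_lt_1; lra).
assert (H12 : e1 <= e2) by (apply exp_le; lra).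
assert (HK := jcoef_ge0 y N (Z.of_nat n)).
assert (HE := exp_pos (- y * (2 * INR n + 1))).
rewrite S_INR; replace (- y * (INR n + 1) ^ 2) with (- y * INR n ^ 2 + - y * (2 * INR n + 1)) by ring.
rewrite exp_plus.
apply Rle_trans with (jcoef y N (Z.of_nat n) * exp (- y * (2 * INR n + 1))).
- apply Rmult_le_reg_r with (1 - e1); [lra|]; rewrite H.
  rewrite Rmult_assoc, (Rmult_comm (1 - e2)), <- Rmult_assoc, (Rmult_comm (exp _)).
  apply Rmult_le_compat_l; [apply Rmult_le_pos; lra|lra].
- rewrite <- Rmult_assoc; apply Rmult_le_compat_r; lra.
Qed.

Lemma is_lim_seq_exp_INR y a : 0 < y -> is_lim_seq (fun N => exp (- y * (2 * INR N + a))) 0.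
Proof.
intros Hy; apply is_lim_seq_ext with (fun N => exp (- y * a) * exp (- y * 2) ^ N).
  intros N; rewrite exp_pow, <- exp_plus; f_equal; ring.
replace 0 with (exp (- y * a) * 0) by ring.
apply is_lim_seq_mult'; [apply is_lim_seq_const|apply is_lim_seq_geom].
rewrite Rabs_pos_eq by (left; apply exp_pos).
apply exp_lt_1; lra.
Qed.

Lemma jcoef_lim y (n : nat) : 0 < y ->
  is_lim_seq (fun N => jcoef y N (Z.of_nat n) / jcoef y N 0) (exp (- y * INR n ^ 2)).
Proof.
intros Hy; induction n as [|n IH].
  simpl (INR 0); replace (- y * 0 ^ 2) with 0 by ring; rewrite exp_0.
  apply is_lim_seq_ext with (fun _ => 1); [|apply is_lim_seq_const].
  intros N; simpl (Z.of_nat 0); field; apply Rgt_not_eq, jcoef_0_pos.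
assert (Hn := pos_INR n).
apply is_lim_seq_ext with (fun N => jcoef y N (Z.of_nat n) / jcoef y N 0
  * (exp (- y * (2 * INR n + 1)) * ((1 - exp (- y * (2 * INR N + - 2 * INR n)))
     / (1 - exp (- y * (2 * INR N + (2 * INR n + 2))))))).
- intros N; assert (H := jcoef_step y N (Z.of_nat n)); rewrite <- INR_IZR_INZ in H.
  replace (Z.of_nat (S n)) with (Z.of_nat n + 1)%Z by lia.
  replace (- y * (2 * INR N + - 2 * INR n)) with (- y * (2 * (INR N - INR n))) by ring.
  replace (- y * (2 * INR N + (2 * INR n + 2))) with (- y * (2 * (INR N + INR n + 1))) by ring.
  assert (exp (- y * (2 * (INR N + INR n + 1))) < 1).
  { apply exp_lt_1; assert (0 <= y * INR n) by (apply Rmult_le_pos; lra).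
    assert (0 <= y * INR N) by (apply Rmult_le_pos; [lra|apply pos_INR]); lra. }
  assert (H' := jcoef_0_pos y N).
  replace (jcoef y N (Z.of_nat n + 1)) with
    (jcoef y N (Z.of_nat n + 1) * (1 - exp (- y * (2 * (INR N + INR n + 1))))
      / (1 - exp (- y * (2 * (INR N + INR n + 1))))) by (field; lra).
  rewrite H; field; lra.
- rewrite S_INR; replace (- y * (INR n + 1) ^ 2) with (- y * INR n ^ 2 + - y * (2 * INR n + 1)) by ring.
  replace (exp (- y * INR n ^ 2 + - y * (2 * INR n + 1))) with
    (exp (- y * INR n ^ 2) * (exp (- y * (2 * INR n + 1)) * ((1 - 0) / (1 - 0))))
    by (rewrite exp_plus; field).
  apply is_lim_seq_mult'; trivial.
  apply is_lim_seq_mult'; [apply is_lim_seq_const|].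
  apply is_lim_seq_div'; [| |lra]; apply is_lim_seq_minus'; try apply is_lim_seq_const;
    now apply is_lim_seq_exp_INR.
Qed.

Lemma jcoef_abs y N n : jcoef y N n = jcoef y N (Z.of_nat (Z.abs_nat n)).
Proof.
destruct (Z_le_gt_dec 0 n) as [Hn|Hn]; [f_equal; lia|].
rewrite <- jcoef_opp; f_equal; lia.
Qed.

Lemma INR_abs_nat_sqr n : INR (Z.abs_nat n) ^ 2 = IZR n ^ 2.
Proof.
rewrite INR_IZR_INZ, Nat2Z.inj_abs_nat, <- !Rsqr_pow2, abs_IZR.
symmetry; apply Rsqr_abs.
Qed.

Lemma jcoef_boundZ y N n : 0 < y -> jcoef y N n / jcoef y N 0 <= exp (- y * IZR n ^ 2).
Proof.
intros Hy; assert (H := jcoef_0_pos y N).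
apply Rmult_le_reg_r with (jcoef y N 0); trivial.
replace (jcoef y N n / jcoef y N 0 * jcoef y N 0) with (jcoef y N n) by (field; lra).
rewrite jcoef_abs, <- INR_abs_nat_sqr, Rmult_comm; now apply jcoef_bound.
Qed.

Lemma jcoef_limZ y n : 0 < y ->
  is_lim_seq (fun N => jcoef y N n / jcoef y N 0) (exp (- y * IZR n ^ 2)).
Proof.
intros Hy; rewrite <- INR_abs_nat_sqr.
apply is_lim_seq_ext with (2 := jcoef_lim y (Z.abs_nat n) Hy).
intros N; now rewrite <- jcoef_abs.
Qed.

Lemma hsum_shift (f : Z -> R) s k : hsum f s -> hsum (fun n => f (n + k)%Z) s.
Proof.
intros H; apply (hsum_inj (fun n => (n + k)%Z) f (fun n => f (n + k)%Z)); trivial.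
- intros; lia.
- intros i _; exists (i - k)%Z; lia.
- apply H.
Qed.

Lemma hsum_jprod y w N : hsum (fun n => jcoef y N n * exp (- w * IZR n)) (jprod y w N).
Proof.
induction N as [|N IH]; cbn [jprod].
- set (f := fun n => jcoef y 0 n * exp (- w * IZR n)).
  assert (Hf : forall n, 0 <= f n).
  { intros n; apply Rmult_le_pos; [apply jcoef_ge0|left; apply exp_pos]. }
  replace 1 with (fsum f (0%Z :: nil)).
  + apply hsum_finite; trivial; [repeat constructor; intros []|].
    intros n Hn; unfold f; simpl; destruct Z.eq_dec as [->|E]; [|ring].
    exfalso; apply Hn; now left.
  + unfold f; simpl; rewrite Rmult_0_r, exp_0; ring.
- set (a := exp (- y * (2 * INR N + 1))).
  assert (Ha : 0 < a) by apply exp_pos.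
  assert (H1 := hsum_scal _ _ (1 + a ^ 2) ltac:(nra) IH).
  assert (H2 := hsum_scal _ _ (a * exp (- w)) ltac:(generalize (exp_pos (- w)); nra) (hsum_shift _ _ (-1) IH)).
  assert (H3 := hsum_scal _ _ (a * exp w) ltac:(generalize (exp_pos w); nra) (hsum_shift _ _ 1 IH)).
  assert (H := hsum_plus _ _ _ _ H1 (hsum_plus _ _ _ _ H2 H3)).
  match goal with |- hsum _ ?x => match type of H with hsum ?f ?b =>
    replace x with b; [apply hsum_ext with f; [|exact H]|] end end.
  + intros n; cbn [jcoef]; fold a; rewrite !plus_IZR.
    replace (- w * (IZR n + -1)) with (- w * IZR n + w) by ring.
    replace (- w * (IZR n + 1)) with (- w * IZR n + - w) by ring.
    rewrite !exp_plus; replace (n + -1)%Z with (n - 1)%Z by lia.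
    assert (E : exp w * exp (- w) = 1) by (rewrite <- exp_plus, Rplus_opp_r; apply exp_0).
    transitivity ((1 + a ^ 2) * (jcoef y N n * exp (- w * IZR n)) +
       (a * (jcoef y N (n - 1) * exp (- w * IZR n)) * (exp w * exp (- w)) +
        a * (jcoef y N (n + 1) * exp (- w * IZR n)) * (exp w * exp (- w)))); [ring|].
    rewrite E; ring.
  + unfold Rminus; rewrite !exp_plus; fold a.
    assert (E : exp w * exp (- w) = 1) by (rewrite <- exp_plus, Rplus_opp_r; apply exp_0).
    transitivity ((1 + a * exp (- w) + a * exp w + a ^ 2 * (exp w * exp (- w))) * jprod y w N);
      [rewrite E; ring|ring].
Qed.

(** Jacobi's triple product at z = exp (- 2 y c), divided by the central coefficient; completing the
    square in y n^2 + 2 y c n produces the factor exp (y c^2). *)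
Lemma jprod_lim y c : 0 < y -> 0 <= c <= 1 ->
  is_lim_seq (fun N => jprod y (2 * y * c) N / jcoef y N 0) (exp (y * c ^ 2) * gs y c).
Proof.
intros Hy Hc.
assert (H : hsum (fun n => exp (- y * IZR n ^ 2) * exp (- (2 * y * c) * IZR n))
   (exp (y * c ^ 2) * gs y c)).
{ eapply hsum_ext; [|apply hsum_scal; [left; apply exp_pos|apply hsum_gauss; lra]].
  intros n; unfold gauss; simpl; rewrite <- !exp_plus; f_equal; ring. }
eapply tannery with (2 := H) (3 := H).
- intros N; unfold Rdiv; rewrite Rmult_comm; apply hsum_scal; [|apply hsum_jprod].
  left; apply Rinv_0_lt_compat, jcoef_0_pos.
- exists O; intros N _ n; simpl; rewrite <- Rmult_assoc; apply Rmult_le_compat_r.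
    left; apply exp_pos.
  rewrite Rmult_comm; now apply jcoef_boundZ.
- intros n; simpl.
  apply is_lim_seq_ext with (fun N => jcoef y N n / jcoef y N 0 * exp (- (2 * y * c) * IZR n)).
    intros N; unfold Rdiv; ring.
  apply is_lim_seq_mult'; [now apply jcoef_limZ|apply is_lim_seq_const].
Qed.

(* The product [jprod] at z = - 1. *)
Fixpoint jalt (y : R) (N : nat) : R :=
  match N with
  | O => 1
  | S N => (1 - exp (- y * (2 * INR N + 1))) ^ 2 * jalt y N
  end.

(** At z = -1 the expansion alternates. Its even and odd halves are nonnegative and are recovered
    from the values at z = 1 and z = -1. *)
Lemma hsum_jalt y N :
  hsum (fun n => jcoef y N (2 * n)) ((jprod y 0 N + jalt y N) / 2) /\
  hsum (fun n => jcoef y N (2 * n + 1)) ((jprod y 0 N - jalt y N) / 2).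
Proof.
induction N as [|N [IH1 IH2]]; cbn [jprod jalt].
- split.
  + replace ((1 + 1) / 2) with (fsum (fun n => jcoef y 0 (2 * n)) (0%Z :: nil)) by (simpl; field).
    apply hsum_finite; [intros; apply jcoef_ge0|repeat constructor; intros []|].
    intros n Hn; cbn [jcoef]; destruct Z.eq_dec as [E|E]; trivial.
    exfalso; apply Hn; left; lia.
  + replace ((1 - 1) / 2) with (fsum (fun n => jcoef y 0 (2 * n + 1)) nil) by (simpl; field).
    apply hsum_finite; [intros; apply jcoef_ge0|constructor|].
    intros n Hn; cbn [jcoef]; destruct Z.eq_dec as [E|E]; trivial; lia.
- set (a := exp (- y * (2 * INR N + 1))).
  assert (Ha : 0 < a) by apply exp_pos.
  rewrite Rminus_0_r, Rplus_0_r; fold a.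
  assert (A1 := hsum_scal _ _ (1 + a ^ 2) ltac:(nra) IH1).
  assert (A2 := hsum_scal _ _ a ltac:(lra) (hsum_shift _ _ (-1) IH2)).
  assert (A3 := hsum_scal _ _ a ltac:(lra) IH2).
  assert (B1 := hsum_scal _ _ (1 + a ^ 2) ltac:(nra) IH2).
  assert (B2 := hsum_scal _ _ a ltac:(lra) IH1).
  assert (B3 := hsum_scal _ _ a ltac:(lra) (hsum_shift _ _ 1 IH1)).
  assert (H := hsum_plus _ _ _ _ A1 (hsum_plus _ _ _ _ A2 A3)).
  assert (H' := hsum_plus _ _ _ _ B1 (hsum_plus _ _ _ _ B2 B3)).
  split.
  + match goal with |- hsum _ ?x => match type of H with hsum ?f ?b =>
      replace x with b by field; apply hsum_ext with f; [|exact H] end end.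
    intros n; cbn [jcoef]; fold a.
    replace (2 * (n + -1) + 1)%Z with (2 * n - 1)%Z by lia; ring.
  + match goal with |- hsum _ ?x => match type of H' with hsum ?f ?b =>
      replace x with b by field; apply hsum_ext with f; [|exact H'] end end.
    intros n; cbn [jcoef]; fold a.
    replace (2 * (n + 1))%Z with (2 * n + 1 + 1)%Z by lia.
    replace (2 * n + 1 - 1)%Z with (2 * n)%Z by lia; ring.
Qed.

Lemma jalt_lim y : 0 < y -> is_lim_seq (fun N => jalt y N / jcoef y N 0) (t4 y).
Proof.
intros Hy.
assert (H1 : is_lim_seq (fun N => (jprod y 0 N + jalt y N) / 2 / jcoef y N 0) (gs (4 * y) 0)).
{ eapply tannery with (f := gauss (4 * y) 0) (b := gauss (4 * y) 0).
  - intros N; unfold Rdiv at 1; rewrite Rmult_comm; apply hsum_scal; [|apply hsum_jalt].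
    left; apply Rinv_0_lt_compat, jcoef_0_pos.
  - apply hsum_gauss; lra.
  - apply hsum_gauss; lra.
  - exists O; intros N _ n; cbv beta; rewrite Rmult_comm.
    eapply Rle_trans; [now apply jcoef_boundZ|].
    unfold gauss; apply exp_le; rewrite mult_IZR; right; ring.
  - intros n; cbv beta.
    apply is_lim_seq_ext with (fun N => jcoef y N (2 * n) / jcoef y N 0).
      intros N; unfold Rdiv; apply Rmult_comm.
    replace (gauss (4 * y) 0 n) with (exp (- y * IZR (2 * n) ^ 2)); [now apply jcoef_limZ|].
    unfold gauss; f_equal; rewrite mult_IZR; ring. }
assert (H2 : is_lim_seq (fun N => (jprod y 0 N - jalt y N) / 2 / jcoef y N 0) (gs (4 * y) (1 / 2))).
{ eapply tannery with (f := gauss (4 * y) (1 / 2)) (b := gauss (4 * y) (1 / 2)).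
  - intros N; unfold Rdiv at 1; rewrite Rmult_comm; apply hsum_scal; [|apply hsum_jalt].
    left; apply Rinv_0_lt_compat, jcoef_0_pos.
  - apply hsum_gauss; lra.
  - apply hsum_gauss; lra.
  - exists O; intros N _ n; cbv beta; rewrite Rmult_comm.
    eapply Rle_trans; [now apply jcoef_boundZ|].
    unfold gauss; apply exp_le; rewrite plus_IZR, mult_IZR; right; field.
  - intros n; cbv beta.
    apply is_lim_seq_ext with (fun N => jcoef y N (2 * n + 1) / jcoef y N 0).
      intros N; unfold Rdiv; apply Rmult_comm.
    replace (gauss (4 * y) (1 / 2) n) with (exp (- y * IZR (2 * n + 1) ^ 2)); [now apply jcoef_limZ|].
    unfold gauss; f_equal; rewrite plus_IZR, mult_IZR; field. }
apply is_lim_seq_ext with (2 := is_lim_seq_minus' _ _ _ _ H1 H2).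
intros N; field; apply Rgt_not_eq, jcoef_0_pos.
Qed.

(* (-q; q^2)_N, (q; q^2)_N, (-q^2; q^2)_N and (q^2; q^2)_N for q = exp (- x). *)
Fixpoint poch_odd_plus (x : R) (N : nat) : R :=
  match N with O => 1 | S N => (1 + exp (- x * (2 * INR N + 1))) * poch_odd_plus x N end.

Fixpoint poch_odd_minus (x : R) (N : nat) : R :=
  match N with O => 1 | S N => (1 - exp (- x * (2 * INR N + 1))) * poch_odd_minus x N end.

Fixpoint poch_even_plus (x : R) (N : nat) : R :=
  match N with O => 1 | S N => (1 + exp (- x * (2 * INR N + 2))) * poch_even_plus x N end.

Fixpoint poch_even_minus (x : R) (N : nat) : R :=
  match N with O => 1 | S N => (1 - exp (- x * (2 * INR N + 2))) * poch_even_minus x N end.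

Lemma poch_odd_plus_pos x N : 0 < poch_odd_plus x N.
Proof.
induction N as [|N IH]; cbn [poch_odd_plus]; [lra|].
generalize (exp_pos (- x * (2 * INR N + 1))); nra.
Qed.

Lemma poch_even_plus_pos x N : 0 < poch_even_plus x N.
Proof.
induction N as [|N IH]; cbn [poch_even_plus]; [lra|].
generalize (exp_pos (- x * (2 * INR N + 2))); nra.
Qed.

Lemma exp_lin_lt_1 x a N : 0 < x -> 0 < a -> exp (- x * (2 * INR N + a)) < 1.
Proof.
intros Hx Ha; apply exp_lt_1.
assert (0 <= x * INR N) by (apply Rmult_le_pos; [lra|apply pos_INR]); nra.
Qed.

Lemma poch_odd_minus_pos x N : 0 < x -> 0 < poch_odd_minus x N.
Proof.
intros Hx; induction N as [|N IH]; cbn [poch_odd_minus]; [lra|].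
apply Rmult_lt_0_compat; trivial.
generalize (exp_lin_lt_1 x 1 N Hx ltac:(lra)); lra.
Qed.

Lemma poch_even_minus_pos x N : 0 < x -> 0 < poch_even_minus x N.
Proof.
intros Hx; induction N as [|N IH]; cbn [poch_even_minus]; [lra|].
apply Rmult_lt_0_compat; trivial.
generalize (exp_lin_lt_1 x 2 N Hx ltac:(lra)); lra.
Qed.

Lemma jprod_0 x N : jprod x 0 N = poch_odd_plus x N ^ 2.
Proof.
induction N as [|N IH]; cbn [jprod poch_odd_plus]; [ring|].
rewrite IH, Rminus_0_r, Rplus_0_r; ring.
Qed.

Lemma jalt_poch x N : jalt x N = poch_odd_minus x N ^ 2.
Proof.
induction N as [|N IH]; cbn [jalt poch_odd_minus]; [ring|rewrite IH; ring].
Qed.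

(** At z = q the second factors are the first ones shifted by one step: the factor 2 is their term
    at exponent 0, and 1 + q^(2N) supplies the missing last one. *)
Lemma jprod_half x N :
  jprod x x N * (1 + exp (- x * (2 * INR N))) = 2 * poch_even_plus x N ^ 2.
Proof.
induction N as [|N IH]; cbn [jprod poch_even_plus].
  simpl; rewrite !Rmult_0_r, exp_0; ring.
rewrite S_INR.
replace (- x * (2 * INR N + 1) - x) with (- x * (2 * INR N + 2)) by ring.
replace (- x * (2 * INR N + 1) + x) with (- x * (2 * INR N)) by ring.
replace (- x * (2 * (INR N + 1))) with (- x * (2 * INR N + 2)) by ring.
set (b := exp (- x * (2 * INR N + 2))).
transitivity ((1 + b) ^ 2 * (jprod x x N * (1 + exp (- x * (2 * INR N))))); [ring|].
rewrite IH; ring.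
Qed.

(** Finite form of Euler's identity (-q; q^2) (q; q^2) (-q^2; q^2) = 1: the factors pair up into
    squares of exponentials that interleave in a product of length 2N. *)
Lemma poch_euler x N :
  poch_odd_plus x N * poch_odd_minus x N * (poch_even_plus x N * poch_even_minus x N)
  = poch_even_minus x (2 * N).
Proof.
induction N as [|N IH]; [simpl; ring|].
replace (2 * S N)%nat with (S (S (2 * N))) by lia.
cbn [poch_odd_plus poch_odd_minus poch_even_plus poch_even_minus].
rewrite <- IH, S_INR, mult_INR; simpl (INR 2).
set (a := exp (- x * (2 * INR N + 1))); set (b := exp (- x * (2 * INR N + 2))).
replace (exp (- x * (2 * ((1 + 1) * INR N + 1) + 2))) with (b ^ 2)
  by (unfold b; rewrite exp_pow; f_equal; simpl; ring).
replace (exp (- x * (2 * ((1 + 1) * INR N) + 2))) with (a ^ 2)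
  by (unfold a; rewrite exp_pow; f_equal; simpl; ring).
ring.
Qed.

Lemma poch_even_minus_tail x N k : 0 < x ->
  poch_even_minus x N * (1 - exp (- x * (2 * INR N + 2)) / (1 - exp (- x * 2)))
  <= poch_even_minus x (k + N) <= poch_even_minus x N.
Proof.
intros Hx.
set (a := exp (- x * 2)).
assert (Ha : 0 < a < 1) by (split; [apply exp_pos|apply exp_lt_1; lra]).
assert (HN := poch_even_minus_pos x N Hx).
assert (E : forall n, exp (- x * (2 * INR n + 2)) = a ^ S n).
{ intros n; unfold a; rewrite exp_pow, S_INR; f_equal; ring. }
rewrite E; set (s := a ^ S N / (1 - a)).
assert (Hs : 0 < s) by (apply Rdiv_lt_0_compat; [apply pow_lt|]; lra).
(* The induction needs the partial geometric sum: s is the whole tail, s (1 - a^k) its first k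
   terms. *)
enough (H : poch_even_minus x N * (1 - s * (1 - a ^ k)) <= poch_even_minus x (k + N)
  <= poch_even_minus x N).
{ assert (0 < a ^ k) by now apply pow_lt.
  assert (poch_even_minus x N * (1 - s) <= poch_even_minus x N * (1 - s * (1 - a ^ k))) by
    (apply Rmult_le_compat_l; [lra|assert (0 < s * a ^ k) by now apply Rmult_lt_0_compat]; lra).
  lra. }
induction k as [|k IH]; [simpl; lra|].
cbn [Nat.add poch_even_minus]; rewrite E.
assert (Hp := poch_even_minus_pos x (k + N) Hx).
set (t := a ^ S (k + N)).
assert (Et : t = s * (1 - a) * a ^ k).
{ unfold t, s; replace (S (k + N)) with (S N + k)%nat by lia; rewrite pow_add; field; lra. }
assert (Hk : 0 < a ^ k) by now apply pow_lt.
assert (Hk1 : a ^ k <= 1) by (rewrite <- (pow1 k); apply pow_incr; lra).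
assert (Ht : 0 < t < 1).
{ unfold t; split; [now apply pow_lt|]; rewrite <- E; apply exp_lin_lt_1; lra. }
split; [|nra].
simpl (a ^ S k).
apply Rle_trans with ((1 - t) * (poch_even_minus x N * (1 - s * (1 - a ^ k)))).
2:{ apply Rmult_le_compat_l; lra. }
replace (1 - s * (1 - a * a ^ k)) with (1 - s * (1 - a ^ k) - t) by (rewrite Et; ring).
rewrite <- Rmult_assoc, (Rmult_comm (1 - t)), Rmult_assoc.
apply Rmult_le_compat_l; [lra|].
assert (0 <= t * (s * (1 - a ^ k))); [|lra].
apply Rmult_le_pos; [lra|apply Rmult_le_pos; lra].
Qed.

Lemma poch_even_minus_ratio x : 0 < x ->
  is_lim_seq (fun N => poch_even_minus x (2 * N) / poch_even_minus x N) 1.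
Proof.
intros Hx.
apply is_lim_seq_le_le with
  (fun N => 1 - exp (- x * (2 * INR N + 2)) / (1 - exp (- x * 2))) (fun _ => 1).
- intros N; assert (H := poch_even_minus_tail x N N Hx).
  assert (HN := poch_even_minus_pos x N Hx).
  replace (N + N)%nat with (2 * N)%nat in H by lia.
  assert (E : poch_even_minus x (2 * N) / poch_even_minus x N * poch_even_minus x N
    = poch_even_minus x (2 * N)) by (field; lra).
  split; apply Rmult_le_reg_r with (poch_even_minus x N); lra.
- replace (Finite 1) with (Finite (1 - 0 / (1 - exp (- x * 2)))).
  2:{ f_equal; field; generalize (exp_lt_1 (- x * 2) ltac:(lra)); lra. }
  apply is_lim_seq_minus'; [apply is_lim_seq_const|].
  apply is_lim_seq_div'; [now apply is_lim_seq_exp_INR|apply is_lim_seq_const|].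
  generalize (exp_lt_1 (- x * 2) ltac:(lra)); lra.
- apply is_lim_seq_const.
Qed.

(* sqrt 2 times the sixth power of the class invariant G. *)
Definition cls6 (x : R) : R := gs x 0 ^ 2 / (gs x (1 / 2) * t4 x).

Lemma cls6_pos x : 0 < x -> 0 < cls6 x.
Proof.
intros Hx; apply Rdiv_lt_0_compat; [apply pow_lt, gs_pos; lra|].
apply Rmult_lt_0_compat; [apply gs_pos; lra|now apply t4_pos].
Qed.

(** The triple products at z = 1, q and -1 combine in [cls6] to (-q; q^2)^4 over (-q^2; q^2)^2 (q;
    q^2)^2, up to a constant; Euler's identity turns this into a sixth power. The exponential is the
    completed square at c = 1/2. *)
Lemma poch_odd_plus_lim x : 0 < x ->
  is_lim_seq (fun N => poch_odd_plus x N ^ 6) (2 * exp (- (x / 4)) * cls6 x).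
Proof.
intros Hx.
assert (H0 := gs_pos x 0 Hx ltac:(lra)); assert (H2 := gs_pos x (1 / 2) Hx ltac:(lra)).
assert (H4 := t4_pos x Hx).
assert (L0 := jprod_lim x 0 Hx ltac:(lra)).
assert (L2 := jprod_lim x (1 / 2) Hx ltac:(lra)).
assert (L4 := jalt_lim x Hx); assert (LR := poch_even_minus_ratio x Hx).
replace (2 * x * 0) with 0 in L0 by ring.
replace (2 * x * (1 / 2)) with x in L2 by field.
replace (exp (x * 0 ^ 2) * gs x 0) with (gs x 0) in L0
  by (replace (x * 0 ^ 2) with 0 by ring; rewrite exp_0; ring).
assert (HE := exp_pos (x * (1 / 2) ^ 2)).
assert (LE := is_lim_seq_exp_INR x 0 Hx).
assert (L := is_lim_seq_mult' _ _ _ _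
  (is_lim_seq_div' _ _ _ _ (is_lim_seq_mult' _ _ _ _ LR LR)
    (is_lim_seq_plus' _ _ _ _ (is_lim_seq_const 1) LE) ltac:(lra))
  (is_lim_seq_mult' _ _ _ _ (is_lim_seq_const 2)
    (is_lim_seq_div' _ _ _ _ (is_lim_seq_mult' _ _ _ _ L0 L0)
      (is_lim_seq_mult' _ _ _ _ L2 L4)
      ltac:(apply Rgt_not_eq; repeat apply Rmult_lt_0_compat; lra)))).
replace (2 * exp (- (x / 4)) * cls6 x) with
  (1 * 1 / (1 + 0) * (2 * (gs x 0 * gs x 0 / (exp (x * (1 / 2) ^ 2) * gs x (1 / 2) * t4 x)))).
2:{ unfold cls6; rewrite exp_Ropp; replace (x * (1 / 2) ^ 2) with (x / 4) in * by field.
    field; lra. }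
apply is_lim_seq_ext with (2 := L); intros N.
assert (HJ := jcoef_0_pos x N); assert (P1 := poch_odd_plus_pos x N).
assert (P2 := poch_odd_minus_pos x N Hx); assert (P3 := poch_even_plus_pos x N).
assert (P4 := poch_even_minus_pos x N Hx).
assert (E := jprod_half x N); rewrite <- (Rplus_0_r (2 * INR N)) in E.
assert (HX := exp_pos (- x * (2 * INR N + 0))).
rewrite <- poch_euler, jprod_0, jalt_poch.
replace (jprod x x N) with (2 * poch_even_plus x N ^ 2 / (1 + exp (- x * (2 * INR N + 0))))
  by (rewrite <- E; field; lra).
field; repeat split; lra.
Qed.

(** Odd exponents grouped by tens: 1 and 9 pair up, as do 3 and 7, while 5 gives the same product at
    [5 * x]. *)
Lemma poch_quintic x N :
  poch_odd_plus x (5 * N)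
  = jprod (5 * x) (4 * x) N * jprod (5 * x) (2 * x) N * poch_odd_plus (5 * x) N.
Proof.
induction N as [|N IH]; [simpl; ring|].
replace (5 * S N)%nat with (S (S (S (S (S (5 * N)))))) by lia.
cbn [poch_odd_plus jprod]; rewrite IH, !S_INR, mult_INR; simpl (INR 5).
replace (- x * (2 * ((1 + 1 + 1 + 1 + 1) * INR N) + 1)) with
  (- (5 * x) * (2 * INR N + 1) + 4 * x) by ring.
replace (- x * (2 * ((1 + 1 + 1 + 1 + 1) * INR N + 1) + 1)) with
  (- (5 * x) * (2 * INR N + 1) + 2 * x) by ring.
replace (- x * (2 * ((1 + 1 + 1 + 1 + 1) * INR N + 1 + 1) + 1)) with
  (- (5 * x) * (2 * INR N + 1)) by ring.
replace (- x * (2 * ((1 + 1 + 1 + 1 + 1) * INR N + 1 + 1 + 1) + 1)) with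
  (- (5 * x) * (2 * INR N + 1) - 2 * x) by ring.
replace (- x * (2 * ((1 + 1 + 1 + 1 + 1) * INR N + 1 + 1 + 1 + 1) + 1)) with
  (- (5 * x) * (2 * INR N + 1) - 4 * x) by ring.
ring.
Qed.

(* With G and G' the class invariants at x and 5 x, this is the sixth power of
   (phi(q)^2 / phi(q^5)^2 - 1) / 2 = G / G'^5. *)
Lemma quintic_multiplier x : 0 < x ->
  ((gs x 0 ^ 2 / gs (5 * x) 0 ^ 2 - 1) / 4) ^ 6 = cls6 x / (16 * cls6 (5 * x) ^ 5).
Proof.
intros Hx.
assert (H0 := gs_pos (5 * x) 0 ltac:(lra) ltac:(lra)).
assert (C1 := cls6_pos x Hx); assert (C5 := cls6_pos (5 * x) ltac:(lra)).
rewrite (gs_quintic x Hx).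
set (A := gs (5 * x) (2 / 5)); set (B := gs (5 * x) (1 / 5)).
assert (L0 := jprod_lim (5 * x) 0 ltac:(lra) ltac:(lra)).
assert (L2 := jprod_lim (5 * x) (2 / 5) ltac:(lra) ltac:(lra)); fold A in L2.
assert (L1 := jprod_lim (5 * x) (1 / 5) ltac:(lra) ltac:(lra)); fold B in L1.
replace (2 * (5 * x) * 0) with 0 in L0 by ring.
replace (exp (5 * x * 0 ^ 2) * gs (5 * x) 0) with (gs (5 * x) 0) in L0
  by (replace (5 * x * 0 ^ 2) with 0 by ring; rewrite exp_0; ring).
replace (2 * (5 * x) * (2 / 5)) with (4 * x) in L2 by field.
replace (2 * (5 * x) * (1 / 5)) with (2 * x) in L1 by field.
assert (L := is_lim_seq_div' _ _ _ _ (is_lim_seq_mult' _ _ _ _ L2 L1)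
  (is_lim_seq_mult' _ _ _ _ L0 L0) ltac:(apply Rgt_not_eq; nra)).
set (r := exp (5 * x * (2 / 5) ^ 2) * A * (exp (5 * x * (1 / 5) ^ 2) * B)
  / (gs (5 * x) 0 * gs (5 * x) 0)) in L.
assert (Er : r = exp x * (A * B / gs (5 * x) 0 ^ 2)).
{ unfold r; replace (exp x) with (exp (5 * x * (2 / 5) ^ 2) * exp (5 * x * (1 / 5) ^ 2)).
    field; lra.
  rewrite <- exp_plus; f_equal; field. }
(* This quotient has its limit computed twice: here from the triple products at c = 2/5 and 1/5, in
   [M6] from the class invariants at x and 5x. *)
assert (L6 : is_lim_seq (fun N => (poch_odd_plus x (5 * N)) ^ 6 / (poch_odd_plus (5 * x) N ^ 6) ^ 5)
   (r ^ 6)).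
{ assert (LL := is_lim_seq_mult' _ _ _ _ L L).
  assert (L3 := is_lim_seq_mult' _ _ _ _ LL (is_lim_seq_mult' _ _ _ _ LL LL)).
  replace (r ^ 6) with (r * r * (r * r * (r * r))) by ring.
  apply is_lim_seq_ext with (2 := L3); intros N.
  assert (HJ := jcoef_0_pos (5 * x) N); assert (HP := poch_odd_plus_pos (5 * x) N).
  rewrite poch_quintic, jprod_0; field; lra. }
assert (D1 := exp_pos (- (x / 4))); assert (D5 := exp_pos (- (5 * x / 4))).
assert (M1 := is_lim_seq_subseq _ _ (fun N => (5 * N)%nat)
  ltac:(apply eventually_subseq; intros; lia) (poch_odd_plus_lim x Hx)).
assert (M5 := poch_odd_plus_lim (5 * x) ltac:(lra)).
set (c := 2 * exp (- (5 * x / 4)) * cls6 (5 * x)) in M5.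
assert (Hc : 0 < c) by (apply Rmult_lt_0_compat; [apply Rmult_lt_0_compat|]; lra).
assert (Ec : c = 2 * exp (- (5 * x / 4)) * cls6 (5 * x)) by reflexivity; clearbody c.
assert (M := is_lim_seq_mult' _ _ _ _ M5 M5).
assert (M' := is_lim_seq_mult' _ _ _ _ M5 (is_lim_seq_mult' _ _ _ _ M M)).
assert (M6 := is_lim_seq_div' _ _ _ _ M1 M' ltac:(apply Rgt_not_eq; repeat apply Rmult_lt_0_compat; lra)).
apply is_lim_seq_unique in L6; apply is_lim_seq_unique in M6.
rewrite (Lim_seq_ext _ (fun N => poch_odd_plus x (5 * N) ^ 6 / (poch_odd_plus (5 * x) N ^ 6) ^ 5)) in M6
  by (intros N; f_equal; ring).
rewrite L6 in M6; apply Rbar_finite_eq in M6.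
replace ((gs (5 * x) 0 ^ 2 + 4 * A * B) / gs (5 * x) 0 ^ 2 - 1) with
  (4 * (A * B / gs (5 * x) 0 ^ 2)) by (field; lra).
set (s := A * B / gs (5 * x) 0 ^ 2) in *.
replace ((4 * s / 4) ^ 6) with (r ^ 6 * exp (- x) ^ 6).
2:{ rewrite Er; transitivity (s ^ 6 * (exp x * exp (- x)) ^ 6); [ring|].
    rewrite <- exp_plus, Rplus_opp_r, exp_0; field. }
rewrite M6, Ec.
replace (exp (- x)) with (exp (- (x / 4)) ^ 4) by (rewrite exp_pow; f_equal; simpl; field).
replace (exp (- (5 * x / 4))) with (exp (- (x / 4)) ^ 5) in * by (rewrite exp_pow; f_equal; simpl; field).
field; lra.
Qed.

(** * The differential equation of the modulus *)

Lemma hsum_is_series (f : nat -> R) s : hsum f s -> is_series f s.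
Proof.
intros Hf; change (is_lim_seq (sum_n f) s); apply is_lim_seq_spec; intros e.
destruct (hsum_approx f s e Hf (cond_pos e)) as (l & Hl & H).
exists (list_max l); intros n Hn; rewrite sum_n_fsum.
assert (H1 := hsum_ub f s (seq 0 (S n)) Hf (seq_NoDup _ _)).
assert (H2 : fsum f l <= fsum f (seq 0 (S n))).
{ apply fsum_incl; trivial; [apply Hf|].
  intros j Hj; apply in_seq.
  assert (H2 := proj1 (list_max_le l (list_max l)) (le_n _)).
  rewrite Forall_forall in H2; specialize (H2 j Hj); lia. }
apply Rabs_def1; lra.
Qed.

Definition is_sqr (k : nat) : R := if Nat.eq_dec (Nat.sqrt k * Nat.sqrt k) k then 1 else 0.

(** The theta function once more, as a power series in q, so that it can be differentiated and
    studied at q = 0. *)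
Definition theta_coef (k : nat) : R :=
  match k with O => 1 | S _ => 2 * is_sqr k end.

Lemma is_sqr_sqr n : is_sqr (n * n) = 1.
Proof.
unfold is_sqr; destruct Nat.eq_dec as [|H]; trivial; exfalso; apply H.
now rewrite Nat.sqrt_square.
Qed.

Lemma is_sqr_neq0 k : is_sqr k <> 0 -> exists n, (n * n = k)%nat.
Proof. unfold is_sqr; destruct Nat.eq_dec as [H|H]; [eauto|now intros []]. Qed.

Lemma is_sqr_bound k : 0 <= is_sqr k <= 1.
Proof. unfold is_sqr; destruct Nat.eq_dec; lra. Qed.

Definition theta (q : R) : R := PSeries theta_coef q.
Definition dtheta (q : R) : R := PSeries (PS_derive theta_coef) q.

Lemma theta_gs x : 0 < x -> theta (exp (- x)) = gs x 0.
Proof.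
intros Hx; unfold theta, PSeries; apply is_series_unique, hsum_is_series.
destruct (ex_gauss x 0 Hx ltac:(lra)) as [E1 E2].
assert (H1 := hsum_series _ _ (fun n => Rlt_le _ _ (gauss_pos x 0 (Z.of_nat n))) (Series_correct _ E1)).
assert (H2 := hsum_series _ _ (fun n => Rlt_le _ _ (gauss_pos x 0 (- Z.of_nat (S n)))) (Series_correct _ E2)).
assert (Hq : forall n, 0 < exp (- x) ^ n) by (intros; apply pow_lt, exp_pos).
(* The coefficient 2 is split into one copy for n >= 0 and one for n < 0; the second copy omits k =
   0. *)
apply hsum_ext with (fun k => is_sqr k * exp (- x) ^ k + (if Nat.eq_dec k 0 then 0 else is_sqr k * exp (- x) ^ k)).
{ intros [|k]; unfold theta_coef; destruct Nat.eq_dec; try lia; [|ring].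
  unfold is_sqr; simpl; ring. }
unfold gs, bilateral; apply hsum_plus.
- apply (hsum_inj (fun n => (n * n)%nat) _ (fun n => gauss x 0 (Z.of_nat n))); [| | | |exact H1].
  + intros; nia.
  + intros k Hk; apply is_sqr_neq0; intros H0; apply Hk; rewrite H0; ring.
  + intros k; apply Rmult_le_pos; [apply is_sqr_bound|now left].
  + intros n; rewrite is_sqr_sqr, exp_pow, mult_INR; unfold gauss.
    rewrite <- INR_IZR_INZ, Rmult_1_l; f_equal; ring.
- apply (hsum_inj (fun n => (S n * S n)%nat) _ (fun n => gauss x 0 (- Z.of_nat (S n)))); [| | | |exact H2].
  + intros; nia.
  + intros k Hk; destruct Nat.eq_dec as [|H0]; [now elim Hk|].
    destruct (is_sqr_neq0 k) as [[|n] Hn]; [intros E; apply Hk; rewrite E; ring|lia|].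
    now exists n.
  + intros k; destruct Nat.eq_dec; [lra|].
    apply Rmult_le_pos; [apply is_sqr_bound|now left].
  + intros n; destruct Nat.eq_dec as [|_]; [lia|].
    rewrite is_sqr_sqr, exp_pow, mult_INR; unfold gauss.
    rewrite opp_IZR, <- INR_IZR_INZ, Rmult_1_l; f_equal; ring.
Qed.

Lemma theta_radius q : Rabs q < 1 -> Rbar_lt (Rabs q) (CV_radius theta_coef).
Proof.
intros Hq; apply Rbar_lt_le_trans with 1; [easy|].
apply (CV_radius_bounded theta_coef); exists 2; intros n.
rewrite pow1, Rmult_1_r; unfold theta_coef.
destruct n as [|n]; [rewrite Rabs_R1; lra|].
generalize (is_sqr_bound (S n)); intros H; rewrite Rabs_pos_eq; lra.
Qed.

Lemma is_derive_theta q : Rabs q < 1 -> is_derive theta q (dtheta q).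
Proof. intros Hq; apply is_derive_PSeries; now apply theta_radius. Qed.

Lemma dtheta_0 : dtheta 0 = 2.
Proof.
unfold dtheta; rewrite PSeries_0; unfold PS_derive, theta_coef, is_sqr; simpl; ring.
Qed.

Lemma theta_0 : theta 0 = 1.
Proof. unfold theta; now rewrite PSeries_0. Qed.

Lemma continuity_pt_theta q : Rabs q < 1 -> continuity_pt theta q.
Proof. intros Hq; apply PSeries_continuity; now apply theta_radius. Qed.

Lemma continuity_pt_dtheta q : Rabs q < 1 -> continuity_pt dtheta q.
Proof.
intros Hq; apply PSeries_continuity; rewrite CV_radius_derive; now apply theta_radius.
Qed.

(* The even and odd parts of theta, that is, theta_3 and theta_2 at q^4. *)
Definition evn (q : R) : R := theta (q ^ 4).
Definition odn (q : R) : R := theta q - theta (q ^ 4).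
Definition devn (q : R) : R := 4 * q ^ 3 * dtheta (q ^ 4).
Definition dodn (q : R) : R := dtheta q - 4 * q ^ 3 * dtheta (q ^ 4).

Lemma evn_gs x : 0 < x -> evn (exp (- x)) = gs (4 * x) 0.
Proof.
intros Hx; unfold evn; rewrite exp_pow, <- theta_gs by lra; do 2 f_equal; simpl; ring.
Qed.

Lemma odn_gs x : 0 < x -> odn (exp (- x)) = gs (4 * x) (1 / 2).
Proof.
intros Hx; change (odn (exp (- x))) with (theta (exp (- x)) - evn (exp (- x))).
rewrite evn_gs, theta_gs, (gs_split x) by lra; ring.
Qed.

Lemma exp_opp_ln q : 0 < q -> exp (- - ln q) = q.
Proof. intros Hq; rewrite Ropp_involutive; now apply exp_ln. Qed.

Lemma ln_opp_pos q : 0 < q < 1 -> 0 < - ln q.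
Proof.
intros Hq; assert (H := ln_increasing q 1); rewrite ln_1 in H; specialize (H ltac:(lra) ltac:(lra)); lra.
Qed.

Lemma pow_lt_1 q n : 0 < q < 1 -> (0 < n)%nat -> 0 < q ^ n < 1.
Proof.
intros Hq Hn; split; [now apply pow_lt|].
destruct n as [|n]; [lia|]; simpl.
assert (q ^ n <= 1) by (rewrite <- (pow1 n); apply pow_incr; lra).
assert (0 < q ^ n) by now apply pow_lt.
nra.
Qed.

Lemma Rabs_lt_1 q : 0 < q < 1 -> Rabs q < 1.
Proof. intros Hq; rewrite Rabs_pos_eq; lra. Qed.

Lemma is_derive_evn q : Rabs q < 1 -> is_derive evn q (devn q).
Proof.
intros Hq.
assert (H4 : Rabs (q ^ 4) < 1).
{ rewrite <- RPow_abs; assert (H := Rabs_pos q).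
  replace (Rabs q ^ 4) with (Rabs q * (Rabs q * (Rabs q * Rabs q))) by ring.
  assert (Rabs q * Rabs q < 1) by nra; assert (0 <= Rabs q * Rabs q) by nra.
  assert (Rabs q * (Rabs q * Rabs q) < 1) by nra.
  assert (0 <= Rabs q * (Rabs q * Rabs q)) by nra; nra. }
unfold evn, devn.
apply (is_derive_comp theta (fun q => q ^ 4) q (dtheta (q ^ 4)) (4 * q ^ 3)).
- now apply is_derive_theta.
- auto_derive; trivial; ring.
Qed.

Lemma is_derive_odn q : Rabs q < 1 -> is_derive odn q (dodn q).
Proof.
intros Hq; apply (is_derive_minus theta evn); [now apply is_derive_theta|now apply is_derive_evn].
Qed.

Lemma evn_pos q : 0 < q < 1 -> 0 < evn q.
Proof.
intros Hq; rewrite <- (exp_opp_ln q), evn_gs by (try apply ln_opp_pos; lra).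
apply gs_pos; [generalize (ln_opp_pos q Hq)|]; lra.
Qed.

Lemma odn_pos q : 0 < q < 1 -> 0 < odn q.
Proof.
intros Hq; rewrite <- (exp_opp_ln q), odn_gs by (try apply ln_opp_pos; lra).
apply gs_pos; [generalize (ln_opp_pos q Hq)|]; lra.
Qed.

Lemma evn_sqr q : 0 < q < 1 -> evn q ^ 2 = evn (q ^ 2) ^ 2 + odn (q ^ 2) ^ 2.
Proof.
intros Hq; assert (Hx := ln_opp_pos q Hq); set (x := - ln q) in *.
assert (Eq : q = exp (- x)) by (unfold x; rewrite exp_opp_ln; lra).
replace (q ^ 2) with (exp (- (2 * x))) by (rewrite Eq, exp_pow; f_equal; simpl; ring).
rewrite Eq, !evn_gs, odn_gs, gs_sqr0 by lra.
now replace (2 * (4 * x)) with (4 * (2 * x)) by ring.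
Qed.

Lemma odn_sqr q : 0 < q < 1 -> odn q ^ 2 = 2 * evn (q ^ 2) * odn (q ^ 2).
Proof.
intros Hq; assert (Hx := ln_opp_pos q Hq); set (x := - ln q) in *.
assert (Eq : q = exp (- x)) by (unfold x; rewrite exp_opp_ln; lra).
replace (q ^ 2) with (exp (- (2 * x))) by (rewrite Eq, exp_pow; f_equal; simpl; ring).
rewrite Eq, evn_gs, !odn_gs, gs_sqr_half by lra.
now replace (2 * (4 * x)) with (4 * (2 * x)) by ring.
Qed.

Lemma quartic_pos q : 0 < q < 1 -> 0 < evn q ^ 4 - odn q ^ 4.
Proof.
intros Hq; assert (Hx := ln_opp_pos q Hq); set (x := - ln q) in *.
assert (Eq : q = exp (- x)) by (unfold x; rewrite exp_opp_ln; lra).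
assert (He := evn_pos q Hq); assert (Ho := odn_pos q Hq).
assert (H : 0 < evn q - odn q).
{ rewrite Eq, evn_gs, odn_gs by lra; apply (t4_pos x Hx). }
replace (evn q ^ 4 - odn q ^ 4) with
  ((evn q - odn q) * ((evn q + odn q) * (evn q ^ 2 + odn q ^ 2))) by ring.
repeat apply Rmult_lt_0_compat; nra.
Qed.

Lemma is_derive_eq_on (f g : R -> R) (q l l' : R) : 0 < q < 1 ->
  (forall r, 0 < r < 1 -> f r = g r) -> is_derive f q l -> is_derive g q l' -> l = l'.
Proof.
intros Hq Hfg Hf Hg.
assert (H : is_derive g q l).
{ apply is_derive_ext_loc with (2 := Hf).
  apply (locally_interval _ q 0 1); simpl; try lra; intros; apply Hfg; simpl in *; lra. }
apply is_derive_unique in H; apply is_derive_unique in Hg; congruence.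
Qed.

Lemma is_derive_sqr_arg (f : R -> R) (q l : R) :
  is_derive f (q ^ 2) l -> is_derive (fun r => f (r ^ 2)) q (2 * q * l).
Proof.
intros H; apply (is_derive_comp f (fun r => r ^ 2) q l (2 * q)); trivial.
auto_derive; trivial; ring.
Qed.

Lemma is_derive_pow2 (f : R -> R) (q l : R) :
  is_derive f q l -> is_derive (fun r => f r ^ 2) q (2 * f q * l).
Proof.
intros H; replace (2 * f q * l) with (l * (2 * f q)) by ring.
apply (is_derive_comp (fun y => y ^ 2) f q (2 * f q) l); trivial.
auto_derive; trivial; ring.
Qed.

Lemma is_derive_Rmult (f g : R -> R) (q a b : R) :
  is_derive f q a -> is_derive g q b -> is_derive (fun r => f r * g r) q (a * g q + f q * b).
Proof. intros Hf Hg; apply (is_derive_mult f g q a b Hf Hg Rmult_comm). Qed.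

(* The Landen relations [evn_sqr] and [odn_sqr] make this quotient invariant
   under q -> q^2, hence equal to its limit 1 at 0. *)
Definition wfun (q : R) : R :=
  q * (dodn q * evn q - odn q * devn q) / (odn q * evn q * (evn q ^ 4 - odn q ^ 4)).

Lemma wfun_sqr q : 0 < q < 1 -> wfun q = wfun (q ^ 2).
Proof.
intros Hq; assert (Hq2 := pow_lt_1 q 2 Hq ltac:(lia)).
assert (A1 := Rabs_lt_1 q Hq); assert (A2 := Rabs_lt_1 _ Hq2).
assert (D1 := is_derive_eq_on _ _ q _ _ Hq evn_sqr (is_derive_pow2 _ _ _ (is_derive_evn q A1))
  (is_derive_plus _ _ _ _ _
    (is_derive_pow2 (fun r => evn (r ^ 2)) _ _ (is_derive_sqr_arg _ _ _ (is_derive_evn _ A2)))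
    (is_derive_pow2 (fun r => odn (r ^ 2)) _ _ (is_derive_sqr_arg _ _ _ (is_derive_odn _ A2))))).
assert (D2 := is_derive_eq_on _ _ q _ _ Hq odn_sqr (is_derive_pow2 _ _ _ (is_derive_odn q A1))
  (is_derive_Rmult (fun r => 2 * evn (r ^ 2)) (fun r => odn (r ^ 2)) q _ _
    (is_derive_scal _ _ 2 _ (is_derive_sqr_arg _ _ _ (is_derive_evn _ A2)))
    (is_derive_sqr_arg _ _ _ (is_derive_odn _ A2)))).
assert (E1 := evn_sqr q Hq); assert (E2 := odn_sqr q Hq).
assert (P1 := evn_pos q Hq); assert (P2 := odn_pos q Hq); assert (P3 := quartic_pos q Hq).
assert (P4 := evn_pos _ Hq2); assert (P5 := odn_pos _ Hq2); assert (P6 := quartic_pos _ Hq2).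
unfold wfun, plus in *; simpl in D1, D2; unfold scal in D2; simpl in D2; unfold mult in D2; simpl in D2.
set (q2 := q ^ 2) in *.
change (q * (q * 1)) with q2 in D1, D2.
set (e := evn q) in *; set (o := odn q) in *; set (e2 := evn q2) in *; set (o2 := odn q2) in *.
set (de := devn q) in *; set (d := dodn q) in *; set (de2 := devn q2) in *; set (d2 := dodn q2) in *.
assert (F1 : e * (q * de) = 2 * q2 * (e2 * de2 + o2 * d2)).
{ unfold q2 at 1; transitivity (q * (2 * e * de) / 2); [field|].
  rewrite D1; field. }
assert (F2 : o * (q * d) = 2 * q2 * (de2 * o2 + e2 * d2)).
{ unfold q2 at 1; transitivity (q * (2 * o * d) / 2); [field|].
  rewrite D2; field. }
assert (F4 : e ^ 4 - o ^ 4 = (e2 ^ 2 - o2 ^ 2) ^ 2).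
{ replace (e ^ 4) with ((e ^ 2) ^ 2) by ring; replace (o ^ 4) with ((o ^ 2) ^ 2) by ring.
  rewrite E1, E2; ring. }
assert (F3 : q * (d * e - o * de) * (o * e) = 2 * q2 * (e2 ^ 2 - o2 ^ 2) * (d2 * e2 - o2 * de2)).
{ transitivity (o * (q * d) * e ^ 2 - e * (q * de) * o ^ 2); [ring|].
  rewrite F1, F2, E1, E2; ring. }
assert (P7 : e2 ^ 2 - o2 ^ 2 <> 0).
{ intros H; rewrite F4, H in P3; lra. }
assert (P8 : e2 ^ 4 - o2 ^ 4 = (e2 ^ 2 - o2 ^ 2) * (e2 ^ 2 + o2 ^ 2)) by ring.
transitivity (q * (d * e - o * de) * (o * e) / (o ^ 2 * e ^ 2 * (e ^ 4 - o ^ 4))).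
  field; repeat split; lra.
rewrite F3, F4, E1, E2, P8; field; repeat split; trivial; try lra.
nra.
Qed.

Lemma is_lim_seq_pow0 (u : nat -> R) k : is_lim_seq u 0 -> is_lim_seq (fun n => u n ^ S k) 0.
Proof.
intros Hu; replace 0 with (0 ^ S k) by (simpl; ring).
apply (is_lim_seq_continuous (fun x => x ^ S k)); trivial.
apply derivable_continuous_pt, derivable_pt_pow.
Qed.

(** [wfun] has the form 0 / 0 at q = 0: the factor q meets the simple zero of [odn], whose slope 2
    is the coefficient of q in theta. *)
Lemma odn_ratio_lim (u : nat -> R) : (forall n, 0 < u n < 1) -> is_lim_seq u 0 ->
  is_lim_seq (fun n => odn (u n) / u n) 2.
Proof.
intros Hu1 Hu.
assert (H0 : odn 0 = 0).
{ unfold odn; replace (0 ^ 4) with 0 by ring; ring. }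
assert (H : is_derive odn 0 2).
{ replace 2 with (dodn 0).
    apply is_derive_odn; rewrite Rabs_R0; lra.
  unfold dodn; rewrite dtheta_0; ring. }
apply is_derive_Reals in H.
apply is_lim_seq_spec; intros e.
destruct (H e (cond_pos e)) as [d Hd].
apply is_lim_seq_spec in Hu; destruct (Hu d) as [N HN].
exists N; intros n Hn; specialize (HN n Hn); rewrite Rminus_0_r in HN.
specialize (Hd (u n) ltac:(generalize (Hu1 n); lra) HN).
now rewrite H0, Rminus_0_r, Rplus_0_l in Hd.
Qed.

Lemma wfun_lim (u : nat -> R) : (forall n, 0 < u n < 1) -> is_lim_seq u 0 ->
  is_lim_seq (fun n => wfun (u n)) 1.
Proof.
intros Hu1 Hu.
assert (R0 : Rabs 0 < 1) by (rewrite Rabs_R0; lra).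
assert (U3 := is_lim_seq_pow0 u 2 Hu); assert (U4 := is_lim_seq_pow0 u 3 Hu).
assert (T1 := is_lim_seq_continuous theta _ _ (continuity_pt_theta 0 R0) Hu).
assert (T4 := is_lim_seq_continuous theta _ _ (continuity_pt_theta 0 R0) U4).
assert (D1 := is_lim_seq_continuous dtheta _ _ (continuity_pt_dtheta 0 R0) Hu).
assert (D4 := is_lim_seq_continuous dtheta _ _ (continuity_pt_dtheta 0 R0) U4).
rewrite theta_0 in T1, T4; rewrite dtheta_0 in D1, D4.
assert (LO := odn_ratio_lim u Hu1 Hu).
assert (Le : is_lim_seq (fun n => evn (u n)) 1) by exact T4.
assert (Lo : is_lim_seq (fun n => odn (u n)) (1 - 1)) by exact (is_lim_seq_minus' _ _ _ _ T1 T4).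
assert (Lde : is_lim_seq (fun n => devn (u n)) (4 * 0 * 2)).
{ exact (is_lim_seq_mult' _ _ _ _ (is_lim_seq_mult' _ _ _ _ (is_lim_seq_const 4) U3) D4). }
assert (Ldo : is_lim_seq (fun n => dodn (u n)) (2 - 4 * 0 * 2)) by exact (is_lim_seq_minus' _ _ _ _ D1 Lde).
assert (Lnum := is_lim_seq_minus' _ _ _ _ (is_lim_seq_mult' _ _ _ _ Ldo Le)
  (is_lim_seq_mult' _ _ _ _ Lo Lde)).
assert (Le2 := is_lim_seq_mult' _ _ _ _ Le Le); assert (Le4 := is_lim_seq_mult' _ _ _ _ Le2 Le2).
assert (Lo2 := is_lim_seq_mult' _ _ _ _ Lo Lo); assert (Lo4 := is_lim_seq_mult' _ _ _ _ Lo2 Lo2).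
assert (Lden := is_lim_seq_mult' _ _ _ _ (is_lim_seq_mult' _ _ _ _ LO Le)
  (is_lim_seq_minus' _ _ _ _ Le4 Lo4)).
assert (L := is_lim_seq_div' _ _ _ _ Lnum Lden ltac:(lra)).
replace 1 with (((2 - 4 * 0 * 2) * 1 - (1 - 1) * (4 * 0 * 2)) /
  (2 * 1 * (1 * 1 * (1 * 1) - (1 - 1) * (1 - 1) * ((1 - 1) * (1 - 1))))) by field.
apply is_lim_seq_ext with (2 := L); intros n; unfold wfun.
assert (P1 := Hu1 n); assert (P2 := evn_pos _ P1); assert (P3 := odn_pos _ P1).
assert (P4 := quartic_pos _ P1).
replace (evn (u n) * evn (u n) * (evn (u n) * evn (u n))
  - odn (u n) * odn (u n) * (odn (u n) * odn (u n))) with (evn (u n) ^ 4 - odn (u n) ^ 4) by ring.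
field; repeat split; lra.
Qed.

Lemma wfun_eq_1 q : 0 < q < 1 -> wfun q = 1.
Proof.
intros Hq.
assert (H1 : forall n, 0 < q ^ (2 ^ n) < 1).
{ intros n; apply pow_lt_1; trivial; generalize (Nat.pow_nonzero 2 n); lia. }
assert (H : is_lim_seq (fun n => wfun (q ^ (2 ^ n))) 1).
{ apply wfun_lim; trivial.
  apply is_lim_seq_le_le with (fun _ => 0) (fun n => q ^ n).
  - intros n; split; [now left; apply H1|].
    assert (Hn : (n <= 2 ^ n)%nat) by (apply Nat.lt_le_incl, Nat.pow_gt_lin_r; lia).
    replace (2 ^ n)%nat with (n + (2 ^ n - n))%nat by lia.
    rewrite pow_add; apply Rle_trans with (q ^ n * 1); [|lra].
    apply Rmult_le_compat_l; [left; apply pow_lt; lra|].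
    rewrite <- (pow1 (2 ^ n - n)); apply pow_incr; lra.
  - apply is_lim_seq_const.
  - apply is_lim_seq_geom; now apply Rabs_lt_1. }
assert (E : forall n, wfun (q ^ (2 ^ n)) = wfun q).
{ induction n as [|n IH]; [simpl; now rewrite Rmult_1_r|].
  rewrite <- IH; simpl (2 ^ S n)%nat.
  replace (2 ^ n + (2 ^ n + 0))%nat with (2 ^ n * 2)%nat by lia.
  rewrite pow_mult; symmetry; apply wfun_sqr, H1. }
assert (H2 : is_lim_seq (fun n => wfun (q ^ (2 ^ n))) (wfun q)).
{ apply is_lim_seq_ext with (fun _ => wfun q); [now intros|apply is_lim_seq_const]. }
apply is_lim_seq_unique in H, H2; rewrite H in H2; apply Rbar_finite_eq in H2; easy.
Qed.

(* The fourth root of the modulus alpha at q^4. *)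
Definition rho (q : R) : R := odn q / evn q.

(** The equation q dalpha/dq = alpha (1 - alpha) phi^4 transferred to rho, where alpha at q^4 is
    rho^4: the 4 from the argument cancels the 4 from the power. *)
Definition drho (q : R) : R := rho q * (1 - rho q ^ 4) * evn q ^ 4 / q.

Lemma rho_pos q : 0 < q < 1 -> 0 < rho q.
Proof. intros Hq; apply Rdiv_lt_0_compat; [now apply odn_pos|now apply evn_pos]. Qed.

Lemma rho_quartic q : 0 < q < 1 -> (1 - rho q ^ 4) * evn q ^ 4 = evn q ^ 4 - odn q ^ 4.
Proof. intros Hq; assert (H := evn_pos q Hq); unfold rho; field; lra. Qed.

Lemma rho_lt_1 q : 0 < q < 1 -> 0 < 1 - rho q ^ 4.
Proof.
intros Hq; assert (H := evn_pos q Hq); assert (H1 := quartic_pos q Hq).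
rewrite <- rho_quartic in H1 by easy.
assert (0 < evn q ^ 4) by now apply pow_lt.
apply Rmult_lt_reg_r with (evn q ^ 4); lra.
Qed.

Lemma is_derive_rho q : 0 < q < 1 -> is_derive rho q (drho q).
Proof.
intros Hq; assert (A := Rabs_lt_1 q Hq).
assert (P1 := evn_pos q Hq); assert (P2 := odn_pos q Hq); assert (P3 := quartic_pos q Hq).
assert (W := wfun_eq_1 q Hq).
replace (drho q) with ((dodn q * evn q - odn q * devn q) / evn q ^ 2).
  apply (is_derive_div odn evn q (dodn q) (devn q)).
  - now apply is_derive_odn.
  - now apply is_derive_evn.
  - lra.
unfold drho; rewrite Rmult_assoc, rho_quartic by easy.
transitivity (rho q * (evn q ^ 4 - odn q ^ 4) / q * wfun q); [|rewrite W; ring].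
unfold wfun, rho; field; lra.
Qed.

Lemma drho_pos q : 0 < q < 1 -> 0 < drho q.
Proof.
intros Hq; apply Rdiv_lt_0_compat; [|lra].
apply Rmult_lt_0_compat; [apply Rmult_lt_0_compat; [now apply rho_pos|now apply rho_lt_1]|].
apply pow_lt; now apply evn_pos.
Qed.

Lemma rho_increasing a b : 0 < a -> a < b -> b < 1 -> rho a < rho b.
Proof.
intros Ha Hab Hb; apply (incr_function rho 0 1 drho); simpl; trivial.
- intros x H0 H1; now apply is_derive_rho.
- intros x H0 H1; now apply drho_pos.
Qed.

(** * Degree 7 *)

(* theta_4 at q^4. *)
Definition cmp (q : R) : R := t4 (4 * - ln q).

(** Jacobi's theta_3^4 = theta_2^4 + theta_4^4. Two Landen steps, from y to 2y to 4y, express both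
    sides as polynomials in the thetas at 4y. *)
Lemma cmp_quartic q : 0 < q < 1 -> cmp q ^ 4 = evn q ^ 4 - odn q ^ 4.
Proof.
intros Hq; assert (Hx := ln_opp_pos q Hq); unfold cmp; set (x := - ln q) in *.
assert (Eq : q = exp (- x)) by (unfold x; rewrite exp_opp_ln; lra).
rewrite Eq, evn_gs, odn_gs by lra.
set (y := 4 * x); assert (Hy : 0 < y) by (unfold y; lra).
assert (S0 := gs_split y Hy).
assert (S1 := gs_sqr0 y Hy); assert (S2 := gs_sqr_half y Hy).
assert (S3 := gs_sqr0 (2 * y) ltac:(lra)); assert (S4 := gs_sqr_half (2 * y) ltac:(lra)).
replace (2 * (2 * y)) with (4 * y) in * by ring.
unfold t4; set (e := gs (4 * y) 0) in *; set (o := gs (4 * y) (1 / 2)) in *.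
set (E2 := gs (2 * y) 0) in *; set (O2 := gs (2 * y) (1 / 2)) in *.
replace (gs y (1 / 2) ^ 4) with ((gs y (1 / 2) ^ 2) ^ 2) by ring; rewrite S2.
transitivity ((gs y 0 ^ 2) * (gs y 0 ^ 2) - 4 * E2 ^ 2 * O2 ^ 2); [|ring].
rewrite S1, S3, S4; ring.
Qed.

Lemma cmp_pos q : 0 < q < 1 -> 0 < cmp q.
Proof. intros Hq; apply t4_pos; generalize (ln_opp_pos q Hq); lra. Qed.

Lemma sqr_inj a b : 0 <= a -> 0 <= b -> a ^ 2 = b ^ 2 -> a = b.
Proof. intros Ha Hb H; apply Rsqr_inj; trivial; now rewrite !Rsqr_pow2. Qed.

Lemma t4_sqr x : 0 < x -> t4 (2 * x) ^ 2 = gs x 0 * t4 x.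
Proof.
intros Hx; rewrite (gs_split x Hx); unfold t4.
assert (S1 := gs_sqr0 (4 * x) ltac:(lra)); assert (S2 := gs_sqr_half (4 * x) ltac:(lra)).
replace (4 * (2 * x)) with (2 * (4 * x)) by ring.
transitivity (gs (4 * x) 0 ^ 2 - gs (4 * x) (1 / 2) ^ 2); [rewrite S1, S2; ring|ring].
Qed.

(* (alpha beta)^(1/8) + ((1 - alpha) (1 - beta))^(1/8) = 1 in degree 7. *)
Lemma septic_modular q : 0 < q < 1 ->
  sqrt (cmp q / evn q * (cmp (q ^ 7) / evn (q ^ 7))) + sqrt (rho q * rho (q ^ 7)) = 1.
Proof.
intros Hq; assert (Hx := ln_opp_pos q Hq); set (x := - ln q) in *.
assert (Eq : q = exp (- x)) by (unfold x; rewrite exp_opp_ln; lra).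
assert (Eq7 : q ^ 7 = exp (- (7 * x))) by (rewrite Eq, exp_pow; f_equal; simpl; ring).
unfold cmp, rho; rewrite Eq7; replace (- ln q) with x by reflexivity.
rewrite ln_exp, Ropp_involutive, Eq, !evn_gs, !odn_gs by lra.
replace (4 * (7 * x)) with (7 * (4 * x)) by ring.
set (y := 4 * x); assert (Hy : 0 < y) by (unfold y; lra).
assert (H := gs_septic y Hy).
assert (P1 := gs_pos y 0 Hy ltac:(lra)); assert (P7 := gs_pos (7 * y) 0 ltac:(lra) ltac:(lra)).
assert (Q1 := t4_pos y Hy); assert (Q7 := t4_pos (7 * y) ltac:(lra)).
assert (O1 := gs_pos y (1 / 2) Hy ltac:(lra)); assert (O7 := gs_pos (7 * y) (1 / 2) ltac:(lra) ltac:(lra)).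
assert (A1 := t4_pos (2 * y) ltac:(lra)); assert (A7 := t4_pos (7 * (2 * y)) ltac:(lra)).
assert (B1 := gs_pos (y / 2) (1 / 2) ltac:(lra) ltac:(lra)).
assert (B7 := gs_pos (7 * y / 2) (1 / 2) ltac:(lra) ltac:(lra)).
assert (C1 := t4_sqr y Hy); assert (C7 := t4_sqr (7 * y) ltac:(lra)).
replace (2 * (7 * y)) with (7 * (2 * y)) in C7 by ring.
assert (D1 := gs_sqr_half (y / 2) ltac:(lra)); assert (D7 := gs_sqr_half (7 * y / 2) ltac:(lra)).
replace (2 * (y / 2)) with y in D1 by field; replace (2 * (7 * y / 2)) with (7 * y) in D7 by field.
set (e := gs y 0) in *; set (e7 := gs (7 * y) 0) in *.
assert (Pe : 0 < e * e7) by (apply Rmult_lt_0_compat; lra).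
replace (t4 y / e * (t4 (7 * y) / e7)) with ((t4 (2 * y) * t4 (7 * (2 * y)) / (e * e7)) ^ 2).
2:{ transitivity (t4 (2 * y) ^ 2 * t4 (7 * (2 * y)) ^ 2 / (e * e7) ^ 2); [field; lra|].
    rewrite C1, C7; field; lra. }
replace (gs y (1 / 2) / e * (gs (7 * y) (1 / 2) / e7)) with
  ((gs (y / 2) (1 / 2) * gs (7 * y / 2) (1 / 2) / 2 / (e * e7)) ^ 2).
2:{ transitivity (gs (y / 2) (1 / 2) ^ 2 * gs (7 * y / 2) (1 / 2) ^ 2 / 4 / (e * e7) ^ 2); [field; lra|].
    rewrite D1, D7; field; lra. }
rewrite !sqrt_pow2.
- apply Rmult_eq_reg_r with (e * e7); [|lra]; rewrite Rmult_1_l, H; field; lra.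
- left; apply Rdiv_lt_0_compat; trivial; apply Rdiv_lt_0_compat; [|lra].
  now apply Rmult_lt_0_compat.
- left; apply Rdiv_lt_0_compat; trivial; now apply Rmult_lt_0_compat.
Qed.

(** The s = (alpha beta)^(1/8) of degree 7, each rho being a fourth root of a modulus. *)
Definition sept (q : R) : R := sqrt (rho q * rho (q ^ 7)).

Lemma sept_pos q : 0 < q < 1 -> 0 < sept q.
Proof.
intros Hq; apply sqrt_lt_R0, Rmult_lt_0_compat; apply rho_pos; trivial.
now apply pow_lt_1; [|lia].
Qed.

Lemma sept_sqr q : 0 < q < 1 -> sept q ^ 2 = rho q * rho (q ^ 7).
Proof.
intros Hq; apply pow2_sqrt; left; apply Rmult_lt_0_compat; apply rho_pos; trivial.
now apply pow_lt_1; [|lia].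
Qed.

Lemma sept_compl q : 0 < q < 1 -> 0 < 1 - sept q /\
  (1 - sept q) ^ 8 = (1 - rho q ^ 4) * (1 - rho (q ^ 7) ^ 4).
Proof.
intros Hq; assert (Hq7 : 0 < q ^ 7 < 1) by (apply pow_lt_1; [easy|lia]).
assert (H := septic_modular q Hq); fold (sept q) in H.
assert (P1 := evn_pos q Hq); assert (P7 := evn_pos _ Hq7).
assert (C1 := cmp_pos q Hq); assert (C7 := cmp_pos _ Hq7).
assert (E : 1 - sept q = sqrt (cmp q / evn q * (cmp (q ^ 7) / evn (q ^ 7)))) by lra.
assert (Hp : 0 < cmp q / evn q * (cmp (q ^ 7) / evn (q ^ 7))).
{ apply Rmult_lt_0_compat; now apply Rdiv_lt_0_compat. }
rewrite E; split; [now apply sqrt_lt_R0|].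
change 8%nat with (2 * 4)%nat; rewrite pow_mult, pow2_sqrt by lra.
transitivity (cmp q ^ 4 / evn q ^ 4 * (cmp (q ^ 7) ^ 4 / evn (q ^ 7) ^ 4)); [field; lra|].
rewrite !cmp_quartic by easy; unfold rho; field; lra.
Qed.

Lemma is_derive_pow_arg (f : R -> R) (q l : R) k :
  is_derive f (q ^ k) l -> is_derive (fun r => f (r ^ k)) q (INR k * q ^ pred k * l).
Proof.
intros H; apply (is_derive_comp f (fun r => r ^ k) q l (INR k * q ^ pred k)); trivial.
auto_derive; trivial; ring.
Qed.

Lemma is_derive_pow_val (f : R -> R) (q l : R) k :
  is_derive f q l -> is_derive (fun r => f r ^ k) q (l * (INR k * f q ^ pred k)).
Proof.
intros H; apply (is_derive_comp (fun y => y ^ k) f q (INR k * f q ^ pred k) l); trivial.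
auto_derive; trivial; ring.
Qed.

(* Logarithmic derivatives of the two sides of the modular equation, by the
   differential equation for rho. *)
Lemma septic_multiplier q : 0 < q < 1 ->
  evn q ^ 4 * (sept q - rho q ^ 4) = 7 * evn (q ^ 7) ^ 4 * (rho (q ^ 7) ^ 4 - sept q).
Proof.
intros Hq; assert (Hq7 : 0 < q ^ 7 < 1) by (apply pow_lt_1; [easy|lia]).
assert (Hs := sept_pos q Hq); assert (Hs2 := sept_sqr q Hq).
destruct (sept_compl q Hq) as [Hc Hc8].
assert (P1 := rho_pos q Hq); assert (P7 := rho_pos _ Hq7).
assert (Q1 := rho_lt_1 q Hq); assert (Q7 := rho_lt_1 _ Hq7).
assert (D1 := is_derive_rho q Hq).
assert (D7 := is_derive_pow_arg rho q _ 7 (is_derive_rho _ Hq7)).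
(* Only existence of the derivative matters: [F1] and [F2] express 2 q l in two ways, and comparing
   them eliminates l. *)
assert (Ds : exists l, is_derive sept q l).
{ eexists; apply (is_derive_comp sqrt (fun r => rho r * rho (r ^ 7))).
  - apply is_derive_Reals, derivable_pt_lim_sqrt; now apply Rmult_lt_0_compat.
  - exact (is_derive_Rmult _ (fun r => rho (r ^ 7)) q _ _ D1 D7). }
destruct Ds as [l Ds].
assert (E1 := is_derive_eq_on _ _ q _ _ Hq sept_sqr (is_derive_pow_val _ _ _ 2 Ds)
  (is_derive_Rmult _ (fun r => rho (r ^ 7)) q _ _ D1 D7)).
assert (Dc := is_derive_minus (fun _ => 1) sept q 0 l (is_derive_const 1 q) Ds).
assert (D14 := is_derive_minus (fun _ => 1) (fun r => rho r ^ 4) q 0 _ (is_derive_const 1 q)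
  (is_derive_pow_val rho q _ 4 D1)).
assert (D74 := is_derive_minus (fun _ => 1) (fun r => rho (r ^ 7) ^ 4) q 0 _ (is_derive_const 1 q)
  (is_derive_pow_val (fun r => rho (r ^ 7)) q _ 4 D7)).
assert (E2 := is_derive_eq_on _ _ q _ _ Hq (fun r Hr => proj2 (sept_compl r Hr))
  (is_derive_pow_val _ _ _ 8 Dc) (is_derive_Rmult _ _ q _ _ D14 D74)).
unfold minus, plus, opp in E2; simpl in E1, E2.
change (q * (q * (q * (q * (q * (q * (q * 1))))))) with (q ^ 7) in *.
unfold drho in *.
set (s := sept q) in *; set (r := rho q) in *; set (r7 := rho (q ^ 7)) in *.
set (z := evn q) in *; set (z7 := evn (q ^ 7)) in *.
assert (F1 : 2 * (q * l) = s * ((1 - r ^ 4) * z ^ 4 + 7 * ((1 - r7 ^ 4) * z7 ^ 4))).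
{ apply Rmult_eq_reg_l with s; [|lra].
  transitivity (s ^ 2 * ((1 - r ^ 4) * z ^ 4 + 7 * ((1 - r7 ^ 4) * z7 ^ 4))); [|ring].
  rewrite Hs2; transitivity (q * (l * ((1 + 1) * (s * 1)))); [ring|].
  rewrite E1; field; repeat split; lra. }
assert (F2 : 2 * (q * l) = (1 - s) * (r ^ 4 * z ^ 4 + 7 * (r7 ^ 4 * z7 ^ 4))).
{ apply Rmult_eq_reg_l with (4 * (1 - s) ^ 7).
  2:{ apply Rgt_not_eq, Rmult_lt_0_compat; [lra|now apply pow_lt]. }
  transitivity (4 * (1 - s) ^ 8 * (r ^ 4 * z ^ 4 + 7 * (r7 ^ 4 * z7 ^ 4))); [|ring].
  rewrite Hc8.
  match type of E2 with ?a = ?b => transitivity (- (q * a)); [ring|rewrite E2] end.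
  field; repeat split; lra. }
rewrite F1 in F2; lra.
Qed.

(** * Solving the modular equations *)

(* The modular equation determines r^12 + r^(-12) = T^3 - 3 T, where
   T = r^4 + r^(-4), and T |-> T^3 - 3 T is injective for T > 2. *)
Lemma septic_class_equation (a b s r : R) :
  0 < s < 1 -> 0 < b * (1 - b) -> 1 < r ->
  s ^ 8 = a * b -> (1 - s) ^ 8 = (1 - a) * (1 - b) ->
  r ^ 24 * (a * (1 - a)) = b * (1 - b) ->
  (s * (1 - s)) ^ 4 * r ^ 12 = b * (1 - b) /\
  r ^ 4 + / r ^ 4 = 2 / (s * (1 - s)) + 4 * (s * (1 - s)) - 7.
Proof.
intros Hs HB Hr E1 E2 E3.
set (P := s * (1 - s)).
assert (HP : 0 < P) by (apply Rmult_lt_0_compat; lra).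
assert (HP4 : 0 < P ^ 4) by now apply pow_lt.
assert (Hr4 : 0 < r ^ 4) by (apply pow_lt; lra).
assert (Hr12 : 0 < r ^ 12) by (apply pow_lt; lra).
assert (HAB : a * (1 - a) * (b * (1 - b)) = P ^ 8).
{ transitivity (s ^ 8 * (1 - s) ^ 8); [rewrite E1, E2; ring|unfold P; ring]. }
assert (H12 : P ^ 4 * r ^ 12 = b * (1 - b)).
{ apply sqr_inj.
  - left; now apply Rmult_lt_0_compat.
  - lra.
  - transitivity (r ^ 24 * P ^ 8); [ring|rewrite <- HAB].
    transitivity (r ^ 24 * (a * (1 - a)) * (b * (1 - b))); [ring|rewrite E3; ring]. }
split; trivial.
assert (HA : a * (1 - a) = P ^ 4 / r ^ 12).
{ apply Rmult_eq_reg_r with (P ^ 4 * r ^ 12); [|apply Rgt_not_eq; now apply Rmult_lt_0_compat].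
  rewrite H12 at 1; rewrite HAB; field; lra. }
assert (Hsig : a + b = 1 + s ^ 8 - (1 - s) ^ 8) by (rewrite E1, E2; ring).
set (T := r ^ 4 + / r ^ 4); set (T1 := 2 / P + 4 * P - 7).
assert (ET : T ^ 3 - 3 * T = T1 ^ 3 - 3 * T1).
{ apply Rmult_eq_reg_l with (P ^ 4); [|lra].
  transitivity (a * (1 - a) + b * (1 - b)).
    rewrite <- H12, HA; unfold T; field; lra.
  transitivity ((a + b) - (a + b) ^ 2 + 2 * (a * b)); [ring|].
  rewrite Hsig, <- E1; unfold T1, P; field; lra. }
assert (HT : 2 < T).
{ assert (1 < r ^ 4) by (apply Rlt_pow_R1; [lra|lia]).
  unfold T; apply Rmult_lt_reg_r with (r ^ 4); trivial.
  replace ((r ^ 4 + / r ^ 4) * r ^ 4) with (r ^ 4 * r ^ 4 + 1) by (field; lra).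
  nra. }
assert (HF : (T - T1) * (T ^ 2 + T * T1 + T1 ^ 2 - 3) = 0).
{ transitivity ((T ^ 3 - 3 * T) - (T1 ^ 3 - 3 * T1)); [ring|rewrite ET; ring]. }
apply Rmult_integral in HF; destruct HF as [HF|HF]; [lra|].
exfalso; assert (0 <= (T1 + T / 2) ^ 2) by apply pow2_ge_0; nra.
Qed.

(* With P = s (1 - s) and t = 1 - 2 s, all the square roots that occur are
   rational in t and d, where d^2 = (2 - P) (2 - 5 P + 4 P^2); the two
   factorizations below come from 4 d^2 - t^2 (3 - 2 P)^2 = 7. *)
Lemma septic_resolution (a b s r X : R) :
  1 / 2 < b -> b < a -> a < 1 -> 0 < s < 1 -> 0 < r -> 0 < X ->
  s ^ 8 = a * b -> (1 - s) ^ 8 = (1 - a) * (1 - b) ->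
  X * (s - a) = 7 * (b - s) ->
  r ^ 24 * (a * (1 - a)) = b * (1 - b) ->
  1 < r /\ exists Y t, 0 < Y /\ X = Y ^ 2 /\ t < 0 /\
    1 - 4 * (s * (1 - s)) * r ^ 4 = t * Y /\ Y ^ 2 - 7 + 5 * t * Y + t ^ 3 * Y = 0.
Proof.
intros Hb Hba Ha Hs Hr HX E1 E2 EX E3.
assert (HA : 0 < a * (1 - a)) by (apply Rmult_lt_0_compat; lra).
assert (HB : a * (1 - a) < b * (1 - b)) by nra.
assert (Hr1 : 1 < r).
{ apply Rnot_le_lt; intros H.
  assert (r ^ 24 <= 1) by (rewrite <- (pow1 24); apply pow_incr; lra).
  assert (r ^ 24 * (a * (1 - a)) <= 1 * (a * (1 - a))) by (apply Rmult_le_compat_r; lra); lra. }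
split; trivial.
(* If s <= b < a, the two sides of [EX] would have opposite signs. With b > 1/2 this makes t = 1 -
   2s negative, which decides the signs of the square roots below. *)
assert (Hsb : b < s).
{ apply Rnot_le_lt; intros H.
  assert (0 < X * (a - s)) by (apply Rmult_lt_0_compat; lra); lra. }
destruct (septic_class_equation a b s r Hs ltac:(lra) Hr1 E1 E2 E3) as [_ ET].
set (P := s * (1 - s)) in *; set (t := 1 - 2 * s).
assert (Ht : t < 0) by (unfold t; lra).
assert (EP : 4 * P = 1 - t ^ 2) by (unfold P, t; ring).
assert (HP : 0 < P < 1 / 4).
{ split; [apply Rmult_lt_0_compat; lra|]; assert (0 < t ^ 2) by nra; lra. }
assert (Hsig : a + b = 1 + s ^ 8 - (1 - s) ^ 8) by (rewrite E1, E2; ring).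
(* The sum and product of a and b are polynomials in s, and [4 * P * (1 - P)] is the square root of
   the square factor of their discriminant. *)
set (d := (a - b) / (4 * P * (1 - P))).
assert (HPP : 0 < 4 * P * (1 - P)) by (apply Rmult_lt_0_compat; lra).
assert (Hd : 0 < d) by (apply Rdiv_lt_0_compat; lra).
assert (Eab : a - b = 4 * P * (1 - P) * d) by (unfold d; field; lra).
assert (Ed : d ^ 2 = (2 - P) * (2 - 5 * P + 4 * P ^ 2)).
{ apply Rmult_eq_reg_l with ((4 * P * (1 - P)) ^ 2); [|apply Rgt_not_eq; now apply pow_lt].
  rewrite <- Rpow_mult_distr, <- Eab.
  transitivity ((a + b) ^ 2 - 4 * (a * b)); [ring|].
  rewrite Hsig, <- E1; unfold P; ring. }
set (k := 3 - 2 * P).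
assert (E7 : (2 * d - t * k) * (2 * d + t * k) = 7).
{ transitivity (4 * d ^ 2 - t ^ 2 * k ^ 2); [ring|].
  rewrite Ed; replace (t ^ 2) with (1 - 4 * P) by lra; unfold k; ring. }
(* X turns out to be 7 times the quotient of the two factors in [E7]; as their product is 7, X is
   the square of the first. So Y is the multiplier m itself. *)
set (Y := 2 * d - t * k).
assert (HY : 0 < Y).
{ unfold Y; assert (0 < - t * k) by (apply Rmult_lt_0_compat; unfold k; lra); lra. }
assert (EU : (r ^ 4 - / r ^ 4) * P = - t * d).
{ assert (Hr4 : 1 < r ^ 4) by (apply Rlt_pow_R1; [lra|lia]).
  assert (/ r ^ 4 < 1) by (rewrite <- Rinv_1; apply Rinv_lt_contravar; lra).
  apply sqr_inj.
  - apply Rmult_le_pos; lra.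
  - apply Rmult_le_pos; lra.
  - transitivity (P ^ 2 * ((r ^ 4 + / r ^ 4) ^ 2 - 4)); [field; lra|].
    rewrite ET; transitivity (t ^ 2 * d ^ 2); [|ring].
    rewrite Ed; replace (t ^ 2) with (1 - 4 * P) by lra; field; lra. }
exists Y, t; repeat split; trivial.
- apply Rmult_eq_reg_l with 7; [|lra].
  rewrite <- E7 at 1; fold Y.
  assert (X * (2 * d + t * k) = 7 * Y); [|nra].
  apply Rmult_eq_reg_l with (2 * P * (1 - P)); [|lra].
  assert (Es : 2 * s - (a + b) = - 2 * t * P * (1 - P) * k).
  { rewrite Hsig; unfold k, P, t; ring. }
  transitivity (X * (a - b - (2 * s - (a + b)))); [rewrite Eab, Es; ring|].
  transitivity (7 * ((a - b) + (2 * s - (a + b)))); [|unfold Y; rewrite Eab, Es; ring].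
  lra.
- assert (E4 : 2 * P * r ^ 4 = P * (2 / P + 4 * P - 7) - t * d).
  { rewrite <- ET; transitivity (P * (r ^ 4 + / r ^ 4) + (r ^ 4 - / r ^ 4) * P); [ring|].
    rewrite EU; ring. }
  transitivity (1 - 2 * (2 * P * r ^ 4)); [ring|rewrite E4].
  unfold Y, k; transitivity (2 * t * d - t ^ 2 * (3 - 2 * P)); [|ring].
  replace (t ^ 2) with (1 - 4 * P) by lra; field; lra.
- transitivity (Y * (Y - (2 * d + t * k) + 5 * t + t ^ 3)).
    rewrite <- E7; fold Y; ring.
  replace (t ^ 3) with (t * (1 - 4 * P)) by (replace (1 - 4 * P) with (t ^ 2) by lra; ring).
  unfold Y, k; ring.
Qed.

(** In u = 1/r, which lies in (0, 1), the equation reads c2 u + c1 u^7 - 7 u^4 - u^8 = 1. The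
    difference quotient of the left side is at least c2 - 28 - 8, positive for c2 > 40. *)
Lemma schlaefli_unique (c1 c2 r r' : R) : 1 < r -> 1 < r' -> 40 < c2 -> 0 < c1 ->
  r ^ 4 + / r ^ 4 + 7 = c2 * r ^ 3 + c1 / r ^ 3 ->
  r' ^ 4 + / r' ^ 4 + 7 = c2 * r' ^ 3 + c1 / r' ^ 3 -> r = r'.
Proof.
intros Hr Hr' H2 H1 E E'.
set (u := / r); set (v := / r').
assert (Hu : 0 < u < 1).
{ split; [apply Rinv_0_lt_compat; lra|unfold u; rewrite <- Rinv_1; apply Rinv_lt_contravar; lra]. }
assert (Hv : 0 < v < 1).
{ split; [apply Rinv_0_lt_compat; lra|unfold v; rewrite <- Rinv_1; apply Rinv_lt_contravar; lra]. }
assert (F : forall x, 1 < x -> x ^ 4 + / x ^ 4 + 7 = c2 * x ^ 3 + c1 / x ^ 3 ->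
  1 + 7 * (/ x) ^ 4 + (/ x) ^ 8 = c2 * / x + c1 * (/ x) ^ 7).
{ intros x Hx Ex.
  transitivity ((x ^ 4 + / x ^ 4 + 7) / x ^ 4); [field; lra|].
  rewrite Ex; field; lra. }
apply F in E, E'; trivial; fold u in E; fold v in E'.
assert (G : (u - v) * (c2 + c1 * (u ^ 6 + u ^ 5 * v + u ^ 4 * v ^ 2 + u ^ 3 * v ^ 3 + u ^ 2 * v ^ 4
    + u * v ^ 5 + v ^ 6) - 7 * (u ^ 3 + u ^ 2 * v + u * v ^ 2 + v ^ 3)
    - (u ^ 7 + u ^ 6 * v + u ^ 5 * v ^ 2 + u ^ 4 * v ^ 3 + u ^ 3 * v ^ 4 + u ^ 2 * v ^ 5
       + u * v ^ 6 + v ^ 7)) = 0).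
{ transitivity ((c2 * u + c1 * u ^ 7 - 7 * u ^ 4 - u ^ 8) - (c2 * v + c1 * v ^ 7 - 7 * v ^ 4 - v ^ 8));
    [ring|lra]. }
assert (M : forall i j, 0 <= u ^ i * v ^ j <= 1).
{ intros i j.
  assert (0 < u ^ i) by (apply pow_lt; lra); assert (0 < v ^ j) by (apply pow_lt; lra).
  assert (u ^ i <= 1) by (rewrite <- (pow1 i); apply pow_incr; lra).
  assert (v ^ j <= 1) by (rewrite <- (pow1 j); apply pow_incr; lra).
  split; [nra|]; rewrite <- (Rmult_1_r 1); apply Rmult_le_compat; lra. }
apply Rmult_integral in G; destruct G as [G|G].
- assert (Euv : u = v) by lra; unfold u, v in Euv; now apply Rinv_eq_reg.
- exfalso.
  assert (0 <= c1 * (u ^ 6 + u ^ 5 * v + u ^ 4 * v ^ 2 + u ^ 3 * v ^ 3 + u ^ 2 * v ^ 4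
    + u * v ^ 5 + v ^ 6)).
  { apply Rmult_le_pos; [lra|].
    generalize (M 6 0)%nat (M 5 1)%nat (M 4 2)%nat (M 3 3)%nat (M 2 4)%nat (M 1 5)%nat (M 0 6)%nat;
      rewrite ?pow_1, ?pow_O; lra. }
  generalize (M 3 0)%nat (M 2 1)%nat (M 1 2)%nat (M 0 3)%nat (M 7 0)%nat (M 6 1)%nat (M 5 2)%nat
   (M 4 3)%nat (M 3 4)%nat (M 2 5)%nat (M 1 6)%nat (M 0 7)%nat;
      rewrite ?pow_1, ?pow_O; lra.
Qed.

(** * Evaluation of the degree 5 quantities at the fixed point of inversion *)

Lemma sqrt2_sqr : sqrt 2 ^ 2 = 2.
Proof. apply pow2_sqrt; lra. Qed.

Lemma sqrt5_sqr : sqrt 5 ^ 2 = 5.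
Proof. apply pow2_sqrt; lra. Qed.

(** Cleared of denominators the equation is (g^2 - g - 1)^2 (g^2 + 1) = 0, with a single positive
    root. *)
Lemma golden_root (g : R) : 0 < g -> (1 + 2 / g ^ 5) * (1 + 2 * g) = 5 -> g = (1 + sqrt 5) / 2.
Proof.
intros Hg E.
assert (H : (g ^ 2 - g - 1) ^ 2 * (g ^ 2 + 1) = 0).
{ transitivity (((1 + 2 / g ^ 5) * (1 + 2 * g) - 5) * g ^ 5 / 2); [field; lra|].
  rewrite E; field. }
apply Rmult_integral in H; destruct H as [H|H]; [|nra].
assert (H0 : g ^ 2 - g - 1 = 0).
{ replace ((g ^ 2 - g - 1) ^ 2) with ((g ^ 2 - g - 1) * (g ^ 2 - g - 1)) in H by ring.
  apply Rmult_integral in H; tauto. }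
assert (H5 := sqrt5_sqr); assert (P5 := sqrt_lt_R0 5 ltac:(lra)).
assert (E5 : 2 * g - 1 = sqrt 5 \/ 2 * g - 1 = - sqrt 5).
{ apply Rsqr_eq; rewrite !Rsqr_pow2, H5; lra. }
assert (sqrt 5 > 2) by nra.
destruct E5; lra.
Qed.

Lemma gs_inversion_sqr x : 0 < x -> gs x 0 ^ 2 = PI / x * gs (PI ^ 2 / x) 0 ^ 2.
Proof.
intros Hx; assert (HP := PI_RGT_0); rewrite (gs_inversion x Hx), Rpow_mult_distr, pow2_sqrt.
  easy.
left; apply Rdiv_lt_0_compat; lra.
Qed.

Lemma cls6_inversion x : 0 < x -> cls6 (PI ^ 2 / x) = cls6 x.
Proof.
intros Hx; assert (HP := PI_RGT_0).
assert (Hy : 0 < PI ^ 2 / x) by (apply Rdiv_lt_0_compat; nra).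
assert (Hd : 0 < PI / x) by (apply Rdiv_lt_0_compat; lra).
assert (Hs := sqrt_lt_R0 _ Hd).
assert (H2 := gs_pos _ (1 / 2) Hy ltac:(lra)); assert (H4 := t4_pos _ Hy).
unfold cls6; rewrite (gs_inversion_sqr x Hx), (gs_half_inversion x Hx), (t4_inversion x Hx).
rewrite <- (sqrt_sqrt (PI / x)) at 1 by lra.
field; lra.
Qed.

Lemma jacobi_quartic x : 0 < x -> gs x 0 ^ 4 = gs x (1 / 2) ^ 4 + t4 x ^ 4.
Proof.
intros Hx; assert (Hx4 : 0 < x / 4) by lra.
assert (Hq : 0 < exp (- (x / 4)) < 1) by (split; [apply exp_pos|apply exp_lt_1; lra]).
assert (H := cmp_quartic _ Hq); unfold cmp in H; rewrite ln_exp, evn_gs, odn_gs in H by lra.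
replace (4 * - - (x / 4)) with x in H by field; replace (4 * (x / 4)) with x in H by field.
lra.
Qed.

(** PI is fixed by the inversion, which exchanges theta_2 and theta_4; hence alpha = 1/2 at nome exp
    (- PI). *)
Lemma gs_half_PI : gs PI (1 / 2) = t4 PI.
Proof.
assert (HP := PI_RGT_0); rewrite gs_half_inversion by easy.
replace (PI / PI) with 1 by (field; lra); replace (PI ^ 2 / PI) with PI by (field; lra).
rewrite sqrt_1; ring.
Qed.

Lemma cls6_PI : cls6 PI = sqrt 2.
Proof.
assert (HP := PI_RGT_0); assert (H := jacobi_quartic PI HP).
assert (P4 := t4_pos PI HP).
unfold cls6; rewrite gs_half_PI in *.
apply sqr_inj; [|apply sqrt_pos|].
  apply Rdiv_le_0_compat; [apply pow2_ge_0|now apply Rmult_lt_0_compat].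
rewrite sqrt2_sqr; transitivity (gs PI 0 ^ 4 / t4 PI ^ 4); [field; lra|].
rewrite H; field; lra.
Qed.

Definition golden : R := (1 + sqrt 5) / 2.

Lemma golden_pos : 0 < golden.
Proof. unfold golden; assert (H := sqrt_pos 5); lra. Qed.

Lemma golden_pow5 : golden ^ 5 = (11 + 5 * sqrt 5) / 2.
Proof. assert (H := sqrt5_sqr); unfold golden; field [H]. Qed.

Lemma golden_pow6 : golden ^ 6 = 9 + 4 * sqrt 5.
Proof. assert (H := sqrt5_sqr); unfold golden; field [H]. Qed.

Lemma pow_lt_compat a b n : 0 <= a < b -> (0 < n)%nat -> a ^ n < b ^ n.
Proof.
intros Hab Hn; destruct n as [|n]; [lia|].
induction n as [|n IH]; [simpl; lra|]; specialize (IH ltac:(lia)).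
rewrite <- (tech_pow_Rmult a), <- (tech_pow_Rmult b).
assert (0 <= a ^ S n) by (apply pow_le; lra).
apply Rle_lt_trans with (b * a ^ S n); [nra|]; apply Rmult_lt_compat_l; lra.
Qed.

Lemma pow_inj_pos (a b : R) n : 0 <= a -> 0 <= b -> (0 < n)%nat -> a ^ n = b ^ n -> a = b.
Proof.
intros Ha Hb Hn E; destruct (Rtotal_order a b) as [H|[H|H]]; trivial; exfalso.
- generalize (pow_lt_compat a b n (conj Ha H) Hn); lra.
- generalize (pow_lt_compat b a n (conj Hb H) Hn); lra.
Qed.

Lemma quintic_values :
  gs PI 0 ^ 2 / gs (5 * PI) 0 ^ 2 = 5 * sqrt 5 - 10 /\
  cls6 (PI / 5) = sqrt 2 * golden ^ 6.
Proof.
assert (HP := PI_RGT_0).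
assert (G1 := gs_pos PI 0 HP ltac:(lra)); assert (G5 := gs_pos (5 * PI) 0 ltac:(lra) ltac:(lra)).
assert (A1 := gs_pos (5 * PI) (2 / 5) ltac:(lra) ltac:(lra)).
assert (A2 := gs_pos (5 * PI) (1 / 5) ltac:(lra) ltac:(lra)).
assert (B1 := gs_pos PI (2 / 5) ltac:(lra) ltac:(lra)).
assert (B2 := gs_pos PI (1 / 5) ltac:(lra) ltac:(lra)).
assert (Q1 := quintic_multiplier PI HP); assert (Q2 := quintic_multiplier (PI / 5) ltac:(lra)).
assert (R1 := gs_quintic PI HP); assert (R2 := gs_quintic (PI / 5) ltac:(lra)).
assert (I := gs_inversion_sqr (PI / 5) ltac:(lra)).
assert (J := cls6_inversion (PI / 5) ltac:(lra)).
replace (5 * (PI / 5)) with PI in * by field.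
replace (PI ^ 2 / (PI / 5)) with (5 * PI) in * by (field; lra).
replace (PI / (PI / 5)) with 5 in I by (field; lra).
rewrite cls6_PI in Q1, Q2; rewrite J in Q1.
assert (P2 := sqrt_lt_R0 2 ltac:(lra)); assert (S2 := sqrt2_sqr).
set (c := sqrt 2) in *; set (K := cls6 (PI / 5)) in *.
assert (HK : 0 < K) by (apply cls6_pos; lra).
set (m := gs PI 0 ^ 2 / gs (5 * PI) 0 ^ 2) in *.
assert (Em : gs (PI / 5) 0 ^ 2 / gs PI 0 ^ 2 = 5 / m) by (unfold m; rewrite I; field; lra).
rewrite Em in Q2.
(* The degree 5 relation is known only in sixth powers; positivity of m - 1 and of 5 / m - 1 allows
   the roots to be taken. *)
assert (Hm : 1 < m).
{ unfold m; apply Rmult_lt_reg_r with (gs (5 * PI) 0 ^ 2); [apply pow_lt; lra|].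
  replace (gs PI 0 ^ 2 / gs (5 * PI) 0 ^ 2 * gs (5 * PI) 0 ^ 2) with (gs PI 0 ^ 2) by (field; lra).
  rewrite R1, Rmult_1_l; assert (0 < gs (5 * PI) (2 / 5) * gs (5 * PI) (1 / 5)) by now apply Rmult_lt_0_compat.
  lra. }
assert (Hm' : 1 < 5 / m).
{ rewrite <- Em; apply Rmult_lt_reg_r with (gs PI 0 ^ 2); [apply pow_lt; lra|].
  replace (gs (PI / 5) 0 ^ 2 / gs PI 0 ^ 2 * gs PI 0 ^ 2) with (gs (PI / 5) 0 ^ 2) by (field; lra).
  rewrite R2, Rmult_1_l; assert (0 < gs PI (2 / 5) * gs PI (1 / 5)) by now apply Rmult_lt_0_compat.
  lra. }
(* By inversion the multiplier at PI / 5 is 5 / m. The relation there identifies g with G_25 ([EK]),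
   as G = 1 at PI; the relation at PI then gives (m - 1) / 2 = g^(-5) ([Ew]). *)
set (g := (5 / m - 1) / 2).
assert (Hg : 0 < g) by (unfold g; lra).
assert (Hc5 : c ^ 5 = 4 * c) by (transitivity (c ^ 2 * c ^ 2 * c); [ring|rewrite S2; ring]).
assert (EK : K = c * g ^ 6).
{ transitivity (64 * c * ((5 / m - 1) / 4) ^ 6); [|unfold g; field; lra].
  rewrite Q2, Hc5; field; lra. }
assert (Ew : (m - 1) / 2 = / g ^ 5).
{ assert (Hg5 : 0 < g ^ 5) by now apply pow_lt.
  apply pow_inj_pos with 6%nat; [lra|left; now apply Rinv_0_lt_compat|lia|].
  transitivity (64 * ((m - 1) / 4) ^ 6); [field|].
  rewrite Q1, EK, Rpow_mult_distr, Hc5; field; lra. }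
assert (Gg : g = golden).
{ apply golden_root; trivial.
  replace (1 + 2 / g ^ 5) with m by (unfold Rdiv; rewrite <- Ew; field).
  replace (1 + 2 * g) with (5 / m) by (unfold g; field; lra).
  field; lra. }
rewrite Gg in *; split; trivial.
replace m with (1 + 2 * ((m - 1) / 2)) by field; rewrite Ew, golden_pow5.
assert (S5 := sqrt5_sqr); assert (P5 := sqrt_pos 5).
apply Rmult_eq_reg_r with ((11 + 5 * sqrt 5) / 2); [|lra].
transitivity ((15 + 5 * sqrt 5) / 2); [field; lra|]; field [S5].
Qed.

(* Powers of N are reduced to degree 1 by the quadratic equation; the two
   remaining coefficients vanish because y = 28^(1/4) and v = sqrt 5. *)
Lemma schlaefli_octic (v y N : R) : v ^ 2 = 5 -> y ^ 4 = 28 ->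
  N ^ 2 = (2576 + 1118 * y + 486 * y ^ 2 + 211 * y ^ 3
     + (1152 + 502 * y + 218 * y ^ 2 + 95 * y ^ 3) * v) / 8 * N
   - (528 + 228 * y + 96 * y ^ 2 + 42 * y ^ 3
     + (224 + 98 * y + 44 * y ^ 2 + 19 * y ^ 3) * v) / 4 ->
  N ^ 8 + 14 * N ^ 6 + 51 * N ^ 4 + 14 * N ^ 2 + 1
  = 8 * N * ((161 + 72 * v) * N ^ 6 + 2 * N ^ 3 + (161 - 72 * v)).
Proof.
intros Hv Hy HN.
set (S := (2576 + 1118 * y + 486 * y ^ 2 + 211 * y ^ 3
     + (1152 + 502 * y + 218 * y ^ 2 + 95 * y ^ 3) * v) / 8) in *.
set (Q := (528 + 228 * y + 96 * y ^ 2 + 42 * y ^ 3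
     + (224 + 98 * y + 44 * y ^ 2 + 19 * y ^ 3) * v) / 4) in *.
(* Lucas sequence of the quadratic, starting from U1 = 1 and U2 = S: N^k = U_k N - Q U_(k-1). *)
set (U3 := S * S - Q); set (U4 := S * U3 - Q * S); set (U5 := S * U4 - Q * U3).
set (U6 := S * U5 - Q * U4); set (U7 := S * U6 - Q * U5); set (U8 := S * U7 - Q * U6).
assert (A : U8 + 14 * U6 + 35 * U4 + 14 * S - 8 * (161 + 72 * v) * U7 - 8 * (161 - 72 * v) = 0).
{ unfold U8, U7, U6, U5, U4, U3, S, Q; field [Hv Hy]. }
assert (B : 1 - Q * (U7 + 14 * U5 + 35 * U3 + 14 - 8 * (161 + 72 * v) * U6) = 0).
{ unfold U7, U6, U5, U4, U3, S, Q; field [Hv Hy]. }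
assert (N3 : N ^ 3 = U3 * N - Q * S).
{ transitivity (N * N ^ 2); [ring|rewrite HN].
  transitivity (S * N ^ 2 - Q * N); [ring|rewrite HN; unfold U3; ring]. }
assert (step : forall k a b, N ^ k = a * N - Q * b -> N ^ (1 + k) = (S * a - Q * b) * N - Q * a).
{ intros k a b E; transitivity (N * N ^ k); [reflexivity|rewrite E].
  transitivity (a * N ^ 2 - Q * b * N); [ring|rewrite HN; ring]. }
assert (N4 := step _ _ _ N3); assert (N5 := step _ _ _ N4); assert (N6 := step _ _ _ N5).
assert (N7 := step _ _ _ N6); assert (N8 := step _ _ _ N7); simpl Nat.add in *.
fold U4 in N4, N5, N6, N7, N8; fold U5 in N5, N6, N7, N8; fold U6 in N6, N7, N8.
fold U7 in N7, N8; fold U8 in N8.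
assert (E : 8 * N * ((161 + 72 * v) * N ^ 6 + 2 * N ^ 3 + (161 - 72 * v))
  = 8 * (161 + 72 * v) * N ^ 7 + 16 * N ^ 4 + 8 * (161 - 72 * v) * N) by ring.
rewrite E, N8, N7, N6, N4, HN; clear -A B.
apply Rminus_diag_uniq.
transitivity ((U8 + 14 * U6 + 35 * U4 + 14 * S - 8 * (161 + 72 * v) * U7 - 8 * (161 - 72 * v)) * N
  + (1 - Q * (U7 + 14 * U5 + 35 * U3 + 14 - 8 * (161 + 72 * v) * U6))); [ring|].
rewrite A, B; ring.
Qed.

(** * The stated radical and the Schlaefli equation *)

Lemma Rpower_half x : 0 < x -> Rpower x (1 / 2) = sqrt x.
Proof.
intros Hx; replace (1 / 2) with (/ 2) by field; now apply Rpower_sqrt.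
Qed.

Definition radical_p : R :=
  1 / 4 * (9 - 4 * sqrt 5) * sqrt (sqrt 14 + sqrt 10)
  * Rpower (Rpower 7 (1 / 4) + sqrt (4 + sqrt 7)) (3 / 2)
  * (sqrt (43 + 15 * sqrt 7 + (8 + 3 * sqrt 7) * sqrt (10 * sqrt 7))
     + sqrt (35 + 15 * sqrt 7 + (8 + 3 * sqrt 7) * sqrt (10 * sqrt 7))).

(* [r] is the ratio of the class invariants G_1225 and G_25. *)
Lemma radical_p_schlaefli : exists r, 1 < r /\
  radical_p = 2 * sqrt 2 / golden ^ 6 * r /\
  r ^ 4 + / r ^ 4 + 7 = 2 * sqrt 2 * golden ^ 6 * r ^ 3 + 2 * sqrt 2 / golden ^ 6 / r ^ 3.
Proof.
assert (Hc := sqrt2_sqr); assert (Hv := sqrt5_sqr).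
assert (Pc := sqrt_lt_R0 2 ltac:(lra)); assert (Pv := sqrt_lt_R0 5 ltac:(lra)).
assert (G6 := golden_pow6).
unfold radical_p.
(* Apart from [a], [be], [e1] and [e2] below, all radicals lie in the field generated by c = sqrt 2,
   v = sqrt 5 and w. *)
set (w := Rpower 7 (1 / 4)).
assert (Pw : 0 < w) by apply exp_pos.
assert (Hw : w ^ 4 = 7).
{ unfold w; rewrite <- Rpower_pow by apply exp_pos; rewrite Rpower_mult; simpl.
  replace (1 / 4 * (1 + 1 + 1 + 1)) with 1 by field; apply Rpower_1; lra. }
set (c := sqrt 2) in *; set (v := sqrt 5) in *.
assert (E7 : sqrt 7 = w ^ 2).
{ rewrite <- Hw; replace (w ^ 4) with ((w ^ 2) ^ 2) by ring; apply sqrt_pow2, pow2_ge_0. }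
assert (Pcw : 0 < c * w) by now apply Rmult_lt_0_compat.
assert (Pw2 : 0 < w ^ 2) by now apply pow_lt.
assert (E14 : sqrt 14 = c * w ^ 2).
{ replace 14 with ((c * w ^ 2) ^ 2) by (rewrite Rpow_mult_distr, Hc; transitivity (2 * w ^ 4); [ring|lra]).
  apply sqrt_pow2; left; now apply Rmult_lt_0_compat. }
assert (E10 : sqrt 10 = c * v).
{ replace 10 with ((c * v) ^ 2) by (rewrite Rpow_mult_distr, Hc, Hv; ring).
  apply sqrt_pow2; left; now apply Rmult_lt_0_compat. }
assert (E107 : sqrt (10 * sqrt 7) = c * v * w).
{ rewrite sqrt_mult_alt, E10, E7, sqrt_pow2 by lra; easy. }
assert (E47 : sqrt (4 + sqrt 7) = c * (w ^ 2 + 1) / 2).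
{ rewrite E7; replace (4 + w ^ 2) with ((c * (w ^ 2 + 1) / 2) ^ 2).
    apply sqrt_pow2; apply Rdiv_le_0_compat; [|lra]; apply Rmult_le_pos; lra.
  transitivity (c ^ 2 * (w ^ 4 + 2 * w ^ 2 + 1) / 4); [field|rewrite Hc, Hw; field]. }
rewrite E107, E47, E14, E10, E7.
set (B := w + c * (w ^ 2 + 1) / 2).
assert (HB : 2 < B).
{ unfold B; rewrite <- E47; assert (1 < w).
  { apply Rnot_le_lt; intros H; assert (w ^ 4 <= 1) by (rewrite <- (pow1 4); apply pow_incr; lra); lra. }
  assert (1 < sqrt (4 + sqrt 7)); [|lra].
  rewrite <- sqrt_1; apply sqrt_lt_1_alt; lra. }
set (be := Rpower B (3 / 2)).
assert (Pbe : 0 < be) by apply exp_pos.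
assert (Ebe : be ^ 2 = B ^ 3).
{ unfold be; rewrite <- (Rpower_pow 2) by apply exp_pos; rewrite Rpower_mult; simpl (INR 2).
  replace (3 / 2 * (1 + 1)) with (INR 3) by (simpl; field); apply Rpower_pow; lra. }
assert (Pcv : 0 < c * v) by now apply Rmult_lt_0_compat.
assert (Pcw2 : 0 < c * w ^ 2) by now apply Rmult_lt_0_compat.
set (a := sqrt (c * w ^ 2 + c * v)).
assert (Ea : a ^ 2 = c * w ^ 2 + c * v) by (apply pow2_sqrt; lra).
assert (Pa : 0 < a) by (apply sqrt_lt_R0; lra).
set (F := 35 + 15 * w ^ 2 + (8 + 3 * w ^ 2) * (c * v * w)).
assert (PF : 35 < F).
{ unfold F; assert (0 < (8 + 3 * w ^ 2) * (c * v * w)); [|lra].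
  apply Rmult_lt_0_compat; [lra|now apply Rmult_lt_0_compat]. }
replace (43 + 15 * w ^ 2 + (8 + 3 * w ^ 2) * (c * v * w)) with (F + 8) by (unfold F; ring).
set (e1 := sqrt (F + 8)); set (e2 := sqrt F).
assert (H1 : e1 ^ 2 = F + 8) by (apply pow2_sqrt; lra).
assert (H2 : e2 ^ 2 = F) by (apply pow2_sqrt; lra).
assert (P1 : 0 < e1) by (apply sqrt_lt_R0; lra); assert (P2 : 0 < e2) by (apply sqrt_lt_R0; lra).
set (D := e1 + e2).
assert (PD : 35 < D ^ 2) by (unfold D; nra).
(* Read off from p = 2 sqrt 2 r / golden^6, since 9 - 4 sqrt 5 is the inverse of golden^6. *)
set (r := a * be * D / (8 * c)).
assert (Pr : 0 < r).
{ unfold r, D; apply Rdiv_lt_0_compat; [|lra].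
  apply Rmult_lt_0_compat; [now apply Rmult_lt_0_compat|lra]. }
set (k := (c * w ^ 2 + c * v) * B ^ 3 / 16).
assert (EN : r ^ 2 = k * (D ^ 2 / 8)).
{ transitivity (a ^ 2 * be ^ 2 * D ^ 2 / (64 * c ^ 2)); [unfold r; field; lra|].
  rewrite Ea, Ebe, Hc; unfold k; field. }
(* Because 43 - 35 = 8, the sum and the difference of the two last radicals have product 8, so D^2 /
   8 is a root of a quadratic with constant term 1. Scaling by k gives the quadratic equation for N
   = r^2 that [schlaefli_octic] takes. *)
assert (ED : (D ^ 2 / 8) ^ 2 = (F + 4) / 2 * (D ^ 2 / 8) - 1).
{ assert (HD : D * (e1 - e2) = 8) by (unfold D; transitivity (e1 ^ 2 - e2 ^ 2); [ring|lra]).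
  assert (HF : F = (D ^ 2 + (e1 - e2) ^ 2) / 4 - 4).
  { transitivity ((2 * e1 ^ 2 + 2 * e2 ^ 2) / 4 - 4); [lra|unfold D; field]. }
  rewrite HF; transitivity ((D ^ 4 + (D * (e1 - e2)) ^ 2) / 64 - 1); [rewrite HD; field|field]. }
exists r; split; [|split].
(* Crude bounds suffice: B > 2 and c v > 2 give k > 1, and D^2 > 35 makes the other factor exceed
   4. *)
- apply Rnot_le_lt; intros H.
  assert (HN : r ^ 2 <= 1) by (rewrite <- (pow1 2); apply pow_incr; lra).
  rewrite EN in HN.
  assert (8 < B ^ 3).
  { replace 8 with (2 * (2 * 2)) by ring; replace (B ^ 3) with (B * (B * B)) by ring.
    apply Rmult_gt_0_lt_compat; nra. }
  assert (2 < c * v) by (apply Rnot_le_lt; intros Hle; assert ((c * v) ^ 2 <= 2 ^ 2) by (apply pow_incr; lra);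
    rewrite Rpow_mult_distr, Hc, Hv in *; lra).
  assert (2 * 8 < (c * w ^ 2 + c * v) * B ^ 3) by (apply Rmult_gt_0_lt_compat; lra).
  assert (1 * 4 < k * (D ^ 2 / 8)) by (apply Rmult_gt_0_lt_compat; unfold k; lra).
  lra.
- rewrite G6; unfold r.
  replace (1 / 4 * (9 - 4 * v) * a * be * D) with
    (1 / 4 * ((9 - 4 * v) * (9 + 4 * v)) / (9 + 4 * v) * a * be * D) by (field; lra).
  replace ((9 - 4 * v) * (9 + 4 * v)) with 1 by (transitivity (81 - 16 * v ^ 2); [rewrite Hv|]; ring).
  field; lra.
- assert (Pr4 : 0 < / r ^ 4) by (apply Rinv_0_lt_compat, pow_lt; lra).
  assert (Pr3 : 0 < r ^ 3) by now apply pow_lt.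
  assert (Pr4' : 0 < r ^ 4) by now apply pow_lt.
  (* The right side is odd in r and the left side even; squaring leaves an equation in N = r^2
     alone. *)
  apply sqr_inj.
  + lra.
  + rewrite G6; apply Rplus_le_le_0_compat; [apply Rmult_le_pos; nra|].
    apply Rdiv_le_0_compat; trivial; apply Rdiv_le_0_compat; lra.
  + set (N := r ^ 2) in *.
    assert (Hy : (c * w) ^ 4 = 28).
    { transitivity ((c ^ 2) ^ 2 * w ^ 4); [ring|rewrite Hc, Hw; ring]. }
    assert (Ek : k = (28 + 14 * (c * w) + 8 * (c * w) ^ 2 + 3 * (c * w) ^ 3
      + (16 + 6 * (c * w) + 2 * (c * w) ^ 2 + (c * w) ^ 3) * v) / 8).
    { unfold k, B; field [Hc Hv Hw]. }
    assert (EF : (F + 4) / 2 = (78 + 15 * (c * w) ^ 2 + (16 * (c * w) + 3 * (c * w) ^ 3) * v) / 4).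
    { unfold F; field [Hc Hv Hw]. }
    assert (O' := schlaefli_octic v (c * w) N Hv Hy).
    specialize (O' ltac:(transitivity (k * ((F + 4) / 2) * N - k ^ 2);
      [rewrite EN; transitivity (k ^ 2 * (D ^ 2 / 8) ^ 2); [ring|rewrite ED; ring]
      |rewrite Ek, EF; generalize (c * w) Hy; intros y Hy'; field [Hv Hy']])).
    transitivity ((N ^ 8 + 14 * N ^ 6 + 51 * N ^ 4 + 14 * N ^ 2 + 1) / N ^ 4).
      unfold N; field; lra.
    rewrite O', G6.
    transitivity (4 * c ^ 2 * ((9 + 4 * v) ^ 2 * r ^ 6 + 2 + (/ (9 + 4 * v)) ^ 2 / r ^ 6)); [|field; lra].
    replace (/ (9 + 4 * v)) with (9 - 4 * v).
    2:{ apply Rmult_eq_reg_r with (9 + 4 * v); [|lra]; rewrite Rinv_l by lra.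
        transitivity (81 - 16 * v ^ 2); [ring|rewrite Hv; ring]. }
    rewrite Hc; replace ((9 + 4 * v) ^ 2) with (161 + 72 * v) by (transitivity (81 + 72 * v + 16 * v ^ 2); [rewrite Hv|]; ring).
    replace ((9 - 4 * v) ^ 2) with (161 - 72 * v) by (transitivity (81 - 72 * v + 16 * v ^ 2); [rewrite Hv|]; ring).
    unfold N; field; lra.
Qed.

(** * The two multipliers combined *)

Lemma gs_half_ratio x : 0 < x ->
  (gs x (1 / 2) / gs x 0) ^ 4 = rho (exp (- (x / 4))) ^ 4.
Proof.
intros Hx; unfold rho; rewrite evn_gs, odn_gs by lra.
now replace (4 * (x / 4)) with x by field.
Qed.

Lemma rho_cls6 x : 0 < x ->
  rho (exp (- (x / 4))) ^ 4 * (1 - rho (exp (- (x / 4))) ^ 4) = / cls6 x ^ 4.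
Proof.
intros Hx; rewrite <- gs_half_ratio by easy.
assert (H := jacobi_quartic x Hx).
assert (P0 := gs_pos x 0 Hx ltac:(lra)); assert (P2 := gs_pos x (1 / 2) Hx ltac:(lra)).
assert (P4 := t4_pos x Hx).
replace (1 - (gs x (1 / 2) / gs x 0) ^ 4) with (t4 x ^ 4 / gs x 0 ^ 4).
  unfold cls6; field; lra.
apply Rmult_eq_reg_r with (gs x 0 ^ 4); [|apply pow_nonzero; lra].
transitivity (t4 x ^ 4); [field; lra|].
transitivity (gs x 0 ^ 4 - gs x (1 / 2) ^ 4); [lra|field; lra].
Qed.

Lemma rho_PI : rho (exp (- (PI / 4))) ^ 4 = 1 / 2.
Proof.
assert (HP := PI_RGT_0); assert (H := jacobi_quartic PI HP).
assert (P4 := t4_pos PI HP).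
rewrite <- gs_half_ratio by easy; rewrite gs_half_PI in *.
assert (P0 := gs_pos PI 0 HP ltac:(lra)).
apply Rmult_eq_reg_r with (gs PI 0 ^ 4); [|apply pow_nonzero; lra].
transitivity (t4 PI ^ 4); [field; lra|rewrite H; field].
Qed.

Lemma multiplier_35 :
  m radical_p = gs (PI / 35) 0 ^ 2 / gs (PI / 5) 0 ^ 2.
Proof.
assert (HP := PI_RGT_0).
(* The extra 4 compensates for [evn] and [rho], which evaluate at q^4. *)
set (q := exp (- (PI / 35 / 4))).
assert (Hq : 0 < q < 1) by (split; [apply exp_pos|apply exp_lt_1; lra]).
assert (Hq7 : 0 < q ^ 7 < 1) by (apply pow_lt_1; [easy|lia]).
assert (Eq7 : q ^ 7 = exp (- (PI / 5 / 4))) by (unfold q; rewrite exp_pow; f_equal; simpl; field).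
set (a := rho q ^ 4); set (b := rho (q ^ 7) ^ 4).
assert (R1 := rho_pos q Hq); assert (R7 := rho_pos _ Hq7).
assert (Hba : b < a).
{ apply pow_lt_compat; [split; [lra|]|lia]; apply rho_increasing; try lra.
  replace (q ^ 7) with (q * q ^ 6) by ring.
  assert (H6 := pow_lt_1 q 6 Hq ltac:(lia)); nra. }
(* The modulus is 1/2 at nome exp (- PI) and increases with the nome, which here is exp (- PI /
   5). *)
assert (Hb : 1 / 2 < b).
{ rewrite <- rho_PI; apply pow_lt_compat; [|lia].
  split; [left; apply rho_pos; split; [apply exp_pos|apply exp_lt_1; lra]|].
  apply rho_increasing; [apply exp_pos| |lra].
  rewrite Eq7; apply exp_increasing; lra. }
assert (Ha : a < 1) by (generalize (rho_lt_1 q Hq); unfold a; lra).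
assert (HbB : b * (1 - b) = / (4 * golden ^ 24)).
{ unfold b; rewrite Eq7, rho_cls6 by lra; rewrite (proj2 quintic_values).
  f_equal; transitivity ((sqrt 2 ^ 2) ^ 2 * golden ^ 24); [ring|rewrite sqrt2_sqr; ring]. }
assert (Hs := sept_pos q Hq); destruct (sept_compl q Hq) as [Hs1 Hs8].
set (s := sept q) in *.
assert (E8 : s ^ 8 = a * b).
{ unfold a, b; transitivity ((s ^ 2) ^ 4); [ring|]; unfold s; rewrite sept_sqr by easy; ring. }
set (X := evn q ^ 4 / evn (q ^ 7) ^ 4).
assert (Z1 := evn_pos q Hq); assert (Z7 := evn_pos _ Hq7).
assert (HX : 0 < X) by (apply Rdiv_lt_0_compat; now apply pow_lt).
assert (EX : X * (s - a) = 7 * (b - s)).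
{ assert (H := septic_multiplier q Hq); fold s a b in H.
  apply Rmult_eq_reg_r with (evn (q ^ 7) ^ 4); [|apply pow_nonzero; lra].
  transitivity (evn q ^ 4 * (s - a)); [unfold X; field; lra|rewrite H; ring]. }
assert (HA : 0 < a * (1 - a)) by (apply Rmult_lt_0_compat; lra).
assert (HB : 0 < b * (1 - b)) by (apply Rmult_lt_0_compat; lra).
(* By 4 alpha (1 - alpha) = G^(-24), this is the ratio of the class invariants at exp (- PI / 35)
   and exp (- PI / 5). *)
set (r := Rpower (b * (1 - b) / (a * (1 - a))) (/ 24)).
assert (Pr : 0 < r) by apply exp_pos.
assert (Er : r ^ 24 * (a * (1 - a)) = b * (1 - b)).
{ unfold r; rewrite <- Rpower_pow by apply exp_pos; rewrite Rpower_mult.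
  replace (/ 24 * INR 24) with 1 by (simpl; field).
  rewrite Rpower_1 by now apply Rdiv_lt_0_compat.
  field; lra. }
destruct (septic_resolution a b s r X Hb Hba Ha ltac:(lra) Pr HX E8 Hs8 EX Er)
  as (Hr1 & Y & t & HY & EXY & Ht & Ep & EY).
destruct (septic_class_equation a b s r ltac:(lra) HB Hr1 E8 Hs8 Er) as [E12 ET].
set (P := s * (1 - s)) in *.
assert (HPp : 0 < P) by (apply Rmult_lt_0_compat; lra).
assert (Gp := golden_pos); assert (Cp := sqrt_lt_R0 2 ltac:(lra)); assert (C2 := sqrt2_sqr).
set (c := sqrt 2) in *; set (g6 := golden ^ 6).
assert (Hg6 : 0 < g6) by now apply pow_lt.
assert (Pr3 : 0 < r ^ 3) by now apply pow_lt.
assert (EP : P * r ^ 3 = / (c * g6)).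
{ apply pow_inj_pos with 4%nat; [|left; apply Rinv_0_lt_compat|lia|].
  - left; now apply Rmult_lt_0_compat.
  - now apply Rmult_lt_0_compat.
  - transitivity (P ^ 4 * r ^ 12); [ring|rewrite E12, HbB, <- Rinv_pow_depr by (apply Rgt_not_eq; now apply Rmult_lt_0_compat)].
    f_equal; unfold g6; transitivity ((c ^ 2) ^ 2 * golden ^ 24); [rewrite C2; ring|ring]. }
assert (EP' : P = / (c * g6 * r ^ 3)).
{ apply Rmult_eq_reg_r with (r ^ 3); [|lra]; rewrite EP; field; lra. }
destruct radical_p_schlaefli as (r0 & Hr0 & Ep0 & Es0); fold c g6 in Ep0, Es0.
assert (Hrr : r = r0).
(* Here r comes from the modular equation and r0 from the radical. The required c2 > 40 is narrow: 2
   (6/5) 17 = 40.8. *)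
{ apply schlaefli_unique with (2 * c / g6) (2 * c * g6); trivial.
  - assert (6 / 5 < c) by (apply Rnot_le_lt; intros H; assert (c ^ 2 <= (6 / 5) ^ 2) by (apply pow_incr; lra); lra).
    assert (17 < g6).
    { unfold g6; rewrite golden_pow6; assert (2 < sqrt 5); [|lra].
      apply Rnot_le_lt; intros H'; assert (sqrt 5 ^ 2 <= 2 ^ 2) by (apply pow_incr; split; [apply sqrt_pos|lra]).
      rewrite sqrt5_sqr in *; lra. }
    assert (6 / 5 * 17 < c * g6) by (apply Rmult_gt_0_lt_compat; lra); lra.
  - apply Rdiv_lt_0_compat; lra.
  - rewrite ET, EP'; transitivity (2 * c * g6 * r ^ 3 + 2 * c ^ 2 / (c * g6 * r ^ 3));
      [rewrite C2|]; field; lra. }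
assert (E4 : radical_p = 4 * P * r ^ 4).
{ rewrite Ep0, <- Hrr, EP'; transitivity (2 * c ^ 2 / (c * g6) * r); [field; lra|rewrite C2; field; lra]. }
assert (E1p : 1 - radical_p = t * Y) by (rewrite E4; exact Ep).
unfold m; set (p := radical_p) in *.
assert (E2p : 2 + 5 * p = Y ^ 2 + t ^ 3 * Y) by (replace p with (1 - t * Y) by lra; lra).
assert (Ht3 : 0 < - t ^ 3 * Y).
{ replace (- t ^ 3 * Y) with ((- t) ^ 3 * Y) by ring; apply Rmult_lt_0_compat; [apply pow_lt; lra|easy]. }
(* Y^2 and t^3 Y have sum 2 + 5p and product (1 - p)^3, so this is the discriminant of their
   quadratic. As t^3 Y < 0 < Y^2, the positive square root selects Y^2. *)
replace ((2 + 5 * p) ^ 2 - 4 * (1 - p) ^ 3) with ((Y ^ 2 - t ^ 3 * Y) ^ 2) by (rewrite E1p, E2p; ring).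
rewrite sqrt_pow2 by nra.
replace (1 + 5 * p / 2 + 1 / 2 * (Y ^ 2 - t ^ 3 * Y)) with (Y ^ 2).
2:{ transitivity ((2 + 5 * p) / 2 + 1 / 2 * (Y ^ 2 - t ^ 3 * Y)); [rewrite E2p; field|field]. }
rewrite Rpower_half by now apply pow_lt.
rewrite sqrt_pow2 by lra.
assert (Q1 : evn q = gs (PI / 35) 0).
{ unfold q; rewrite evn_gs by lra; f_equal; field. }
assert (Q7 : evn (q ^ 7) = gs (PI / 5) 0).
{ rewrite Eq7, evn_gs by lra; f_equal; field. }
rewrite <- Q1, <- Q7; apply sqr_inj; [lra|left; apply Rdiv_lt_0_compat; now apply pow_lt|].
rewrite <- EXY; unfold X; field; lra.
Qed.

Theorem theorem6p5 (p : R)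
  (hp : p =
    1 / 4 * (9 - 4 * sqrt 5) * sqrt (sqrt 14 + sqrt 10)
    * Rpower (Rpower 7 (1 / 4) + sqrt (4 + sqrt 7)) (3 / 2)
    * (sqrt (43 + 15 * sqrt 7 + (8 + 3 * sqrt 7) * sqrt (10 * sqrt 7))
       + sqrt (35 + 15 * sqrt 7 + (8 + 3 * sqrt 7) * sqrt (10 * sqrt 7)))) :
  phi (exp (- 35 * PI)) / phi (exp (- PI))
  = Rpower (m p / (35 * (sqrt 5 - 2))) (1 / 2).
Proof.
change (p = radical_p) in hp; rewrite hp, multiplier_35; clear p hp.
assert (HP := PI_RGT_0).
replace (- 35 * PI) with (- (35 * PI)) by ring; rewrite !phi_gs.
assert (I35 := gs_inversion_sqr (PI / 35) ltac:(lra)).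
assert (I5 := gs_inversion_sqr (PI / 5) ltac:(lra)).
replace (PI ^ 2 / (PI / 35)) with (35 * PI) in I35 by (field; lra).
replace (PI / (PI / 35)) with 35 in I35 by (field; lra).
replace (PI ^ 2 / (PI / 5)) with (5 * PI) in I5 by (field; lra).
replace (PI / (PI / 5)) with 5 in I5 by (field; lra).
assert (G1 := gs_pos PI 0 HP ltac:(lra)); assert (G5 := gs_pos (5 * PI) 0 ltac:(lra) ltac:(lra)).
assert (G35 := gs_pos (35 * PI) 0 ltac:(lra) ltac:(lra)).
assert (V := proj1 quintic_values).
assert (S2 : 0 < sqrt 5 - 2).
{ assert (P1 : 0 < gs PI 0 ^ 2 / gs (5 * PI) 0 ^ 2) by (apply Rdiv_lt_0_compat; now apply pow_lt); lra. }
(* 35 (sqrt 5 - 2) is 7 times the degree 5 multiplier, and 7 = 35 / 5 is the quotient of the two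
   inversion factors; the thetas at 5 PI cancel. *)
assert (E : gs (PI / 35) 0 ^ 2 / gs (PI / 5) 0 ^ 2 / (35 * (sqrt 5 - 2))
  = (gs (35 * PI) 0 / gs PI 0) ^ 2).
{ replace (35 * (sqrt 5 - 2)) with (7 * (gs PI 0 ^ 2 / gs (5 * PI) 0 ^ 2)) by (rewrite V; ring).
  rewrite I35, I5; field; lra. }
assert (Hq : 0 < gs (35 * PI) 0 / gs PI 0) by now apply Rdiv_lt_0_compat.
rewrite E, Rpower_half by now apply pow_lt.
rewrite sqrt_pow2; lra.
Qed.
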